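(* Let $\lambda>0$, let $m\ge2$ be an integer and $0<\nu\le\min(1,2/m)$. The solution $u_\nu$ of $\frac{\partial^{\nu}u}{\partial t^{\nu}}=\lambda^2\frac{\partial^2u}{\partial x^2}$, $x\in\mathbb{R}$, $t>0$, $u(x,0)=\delta(x)$, satisfies \begin{align*} u_\nu(x,t)=\frac{m^{(m-1)/2}}{(2\pi)^{(m-1)/2}\sqrt t}\int_0^{+\infty}\!\!\cdots\!\int_0^{+\infty}&e^{-(w_1^m+\cdots+w_{m-1}^m)/\sqrt[m-1]{m^m t}}\;w_2w_3^2\cdots w_{m-1}^{m-2}\\ &\times u_{m\nu}(x,w_1w_2\cdots w_{m-1})\,dw_1\cdots dw_{m-1}, \end{align*} where $u_{m\nu}$ is the solution of $\frac{\partial^{m\nu}u}{\partial t^{m\nu}}=\lambda^2\frac{\partial^2u}{\partial x^2}$ with $u(x,0)=\delta(x)$, together with $u_t(x,0)=0$ when $m\nu>1$.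
   Context: Fractional derivatives are in the Dzherbashyan–Caputo sense: for $k-1<\mu<k$, $\frac{\partial^{\mu}u}{\partial t^{\mu}}(x,t)=\frac{1}{\Gamma(k-\mu)}\int_0^t (t-s)^{k-\mu-1}\frac{\partial^k u}{\partial s^k}(x,s)\,ds$; for $\mu=k$ the ordinary derivative. For $0<\mu\le2$ the solution is $u_\mu(x,t)=\frac{1}{2\lambda t^{\mu/2}}\sum_{k\ge0}\frac{(-|x|/(\lambda t^{\mu/2}))^k}{k!\,\Gamma(-\mu k/2+1-\mu/2)}$.
   Formalization: For mν=2 the series given for u_2 vanishes identically, so there u_2(·,s) is taken as the measure (δ_{λs}+δ_{-λs})/2 and the identity is stated in the sense of distributions, against continuous compactly supported test functions; for mν<2 it is pointwise in x. *)

(* Defs.v *)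
From HB Require Import structures.
From mathcomp Require Import all_boot all_order all_algebra.
From mathcomp Require Import all_classical all_reals all_analysis.
Set Implicit Arguments. Unset Strict Implicit. Unset Printing Implicit Defensive.
Import Order.TTheory GRing.Theory Num.Theory.
Import numFieldNormedType.Exports.
Local Open Scope classical_set_scope.
Local Open Scope ring_scope.

Section Defs.
Variable R : realType.

Definition Gamma_pos (y : R) : R :=
  \int[lebesgue_measure]_(s in `]0, +oo[) (s `^ (y - 1) * expR (- s)).

(* Reciprocal Gamma 1/Gamma(y) on all of R (entire; = 0 at the poles
   y = 0,-1,-2,...), via 1/Gamma(y) = y(y+1)...(y+n-1)/Gamma(y+n) with y+n>0. *)
Definition rgamma (y : R) : R :=
  let n := (`|Num.floor (- y)|%N).+1 in
  (\prod_(k < n) (y + k%:R)) / Gamma_pos (y + n%:R).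

Definition u_sol (lam mu x t : R) : R :=
  (2 * lam * t `^ (mu / 2))^-1 *
  limn (series (fun k : nat =>
     (- (`|x| / (lam * t `^ (mu / 2)))) ^+ k / (k`!)%:R
       * rgamma (- (mu * k%:R / 2) + 1 - mu / 2))).

(* The solution for mu = 2 (wave equation, u(x,0)=delta, u_t(x,0)=0) is the
   measure (delta_{lam t} + delta_{-lam t})/2; its pairing with a test function: *)
Definition wave_pair (lam s : R) (phi : R -> R) : R :=
  (phi (lam * s) + phi (- (lam * s))) / 2.

(* Iterated integral over (0,+oo)^n; the variable w_1 (index 0) is outermost. *)
Fixpoint iint (n : nat) (F : (nat -> R) -> R) : R :=
  match n with
  | 0 => F (fun _ => 0)
  | n'.+1 => \int[lebesgue_measure]_(w in `]0, +oo[)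
               iint n' (fun g => F (fun i => if i is j.+1 then g j else w))
  end.

Definition const5p2 (m : nat) (t : R) : R :=
  m%:R `^ ((m%:R - 1) / 2) / ((2 * pi) `^ ((m%:R - 1) / 2) * Num.sqrt t).

(* e^{-(w_1^m+...+w_{m-1}^m)/ (m^m t)^(1/(m-1))} * w_2 w_3^2 ... w_{m-1}^{m-2},
   where w_{i+1} = w i *)
Definition kern5p2 (m : nat) (t : R) (w : nat -> R) : R :=
  expR (- (\sum_(i < m.-1) w i ^+ m) / ((m%:R ^+ m * t) `^ (1 / (m.-1)%:R)))
  * \prod_(i < m.-1) w i ^+ i.

Definition has_compact_support (phi : R -> R) : Prop :=
  exists a b : R, forall x, (x < a \/ b < x) -> phi x = 0.

End Defs.

(* Main.v *)
Require Import Defs.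
From HB Require Import structures.
From mathcomp Require Import all_boot all_order all_algebra.
From mathcomp Require Import all_classical all_reals all_analysis.
From mathcomp Require Import measurable_realfun.
From mathcomp Require complex.
From mathcomp Require Import zify ring lra.
Set Implicit Arguments. Unset Strict Implicit. Unset Printing Implicit Defensive.
Import Order.TTheory GRing.Theory Num.Theory.
Import numFieldNormedType.Exports.
Local Open Scope classical_set_scope.
Local Open Scope ring_scope.

(**
With the Wright function [M_b y = sum_k (- y) ^ k / (k! Gamma(1 - b - b k))], [b = mu / 2] and [z = |x| / lam], one has
[u_mu(x, s) = s ^ (- b) * M_b (z * s ^ (- b)) / (2 lam)]. The series cannot be integrated term by
term against the kernel: the resulting series of integrals diverges. Instead the argument of the
inner solution is multiplied by a scaling variable [a > 0] and both sides are compared as functions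
of [a] through their Mellin transforms on a strip. Each of the [m - 1] integrals is a multiplicative
convolution, which multiplies the Mellin transform by a Gamma value, and Gauss' multiplication
formula collapses the product of these values, times the constant of the theorem, to
[t ^ (- p / m) * Gamma(1 - p) / Gamma(1 - p / m)]. The integral representation
[M_b y = 1/pi * int_0^oo e^(- cos k (r + y r^b)) sin (k + sin k (r - y r^b)) r^(b-1) dr],
[k = pi b / (1 + b)], gives the boundedness of [M_b] and its Mellin transform
[int_0^oo y ^ (- p) * M_b y dy = Gamma(1 - p) / Gamma(1 - b p)], so that the other side has the same
transform. Injectivity of the Mellin transform on a strip around [p0] follows by differentiating at
[p0], which kills all the moments against powers of [ln a], then moving along the vertical line by
Taylor expansion, and finally integrating against a Poisson kernel. For [m nu = 2] the same
comparison is made with the test function as the inner profile.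
*)

(** Scaling the inner argument by [a] amounts to replacing [t] by [a ^ m * t] on the left, so a
    single numerical identity becomes an identity between functions of [a], read off at [a = 1]. The
    strip is [0 < p < b]: since [M_b 0] is nonzero, the inner solution decays only like [s ^ (- b)].
    All transforms are computed for real [p], so inversion along a contour is not at hand; this is
    why uniqueness has to travel to the vertical line by itself, with real sines of arbitrary phase
    in place of complex exponentials. Two degenerate cases fall outside this scheme. At [x = 0] the
    inner solution is a pure power, which has a Mellin transform on no strip; it is integrated
    directly. For [m nu = 2] the index [b] would be 1 and [M_1] is not a function; there the
    left-hand solution, after [x = lam * w], acts as one kernel with the same Mellin transform as
    all the [m - 1] factors and the constant together. The Gamma facts start from the integral:
    rotating the ray of integration yields the reflection formula, Wendel's inequalities yield the
    multiplication formula. *)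

Section HalfLine.

(** * Integration over the open half-line: limits, primitives, substitution, Fubini *)

Variable R : realType.
Notation mu := (@lebesgue_measure R).
Notation D := (`]0%R, +oo[%classic : set R).

Definition mpos (f : R -> R) := measurable_fun D f.
Definition intpos (f : R -> R) := mu.-integrable D (EFin \o f).
(** A real-valued integral is the [fine] part of an extended one and is informative only for
    integrable functions, so [Ipos] and [intpos] are carried side by side. [Gamma_pos] unfolds to an
    [Ipos]. *)
Definition Ipos (f : R -> R) : R := \int[mu]_(x in D) f x.

Lemma inD x : D x = (0 < x) :> Prop.
Proof. by rewrite /= in_itv/= andbT. Qed.

Lemma mposT f : measurable_fun setT f -> mpos f.
Proof. by move=> mf; exact: measurable_funTS. Qed.

Lemma mpos_continuous f : (forall x : R, 0 < x -> {for x, continuous f}) -> mpos f.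
Proof.
move=> cf; apply: open_continuous_measurable_fun => // x.
by rewrite inE inD; exact: cf.
Qed.

Lemma intpos_mpos f : intpos f -> mpos f.
Proof. by move=> /integrableP[/measurable_EFinP]. Qed.

Lemma eq_mpos f g : (forall x : R, 0 < x -> f x = g x) -> mpos f -> mpos g.
Proof.
move=> fg; apply: eq_measurable_fun => x; rewrite inE inD; exact: fg.
Qed.

Lemma eq_intpos f g : (forall x : R, 0 < x -> f x = g x) -> intpos f -> intpos g.
Proof.
move=> fg; apply: eq_integrable => // x.
by rewrite inE inD /= => x0; rewrite fg.
Qed.

Lemma eq_Ipos f g : (forall x : R, 0 < x -> f x = g x) -> Ipos f = Ipos g.
Proof. by move=> fg; apply: eq_Rintegral => x; rewrite inE inD; exact: fg. Qed.

Lemma le_intpos f g : mpos f -> intpos g ->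
  (forall x : R, 0 < x -> `|f x| <= g x) -> intpos f.
Proof.
move=> mf ig fg; apply: (le_integrable _ _ _ ig) => //; first exact/measurable_EFinP.
by move=> x; rewrite inD => x0 /=; rewrite lee_fin (le_trans (fg _ x0))// ler_norm.
Qed.

Lemma intposD f g : intpos f -> intpos g -> intpos (fun x => f x + g x).
Proof. by move=> /integrableD h /h; exact. Qed.

Lemma intposZ k f : intpos f -> intpos (fun x => k * f x).
Proof. by move=> /integrableZl; exact. Qed.

Lemma intposB f g : intpos f -> intpos g -> intpos (fun x => f x - g x).
Proof. by move=> /integrableB h /h; exact. Qed.

Lemma intpos_norm f : intpos f -> intpos (fun x => `|f x|).
Proof. by move=> fi; exact: integrable_norm. Qed.

Lemma intpos_sum (I : Type) (s : seq I) (F : I -> R -> R) :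
  (forall i, intpos (F i)) -> intpos (fun x => \sum_(i <- s) F i x).
Proof.
move=> iF; elim: s => [|i s ih].
  apply: (@eq_intpos (cst 0)); first by move=> x _; rewrite big_nil.
  exact: integrable0.
apply: (@eq_intpos (fun x => F i x + \sum_(i <- s) F i x)).
  by move=> x _; rewrite big_cons.
exact: intposD.
Qed.

Lemma IposD f g : intpos f -> intpos g -> Ipos (fun x => f x + g x) = Ipos f + Ipos g.
Proof. by move=> ? ?; exact: RintegralD. Qed.

Lemma IposB f g : intpos f -> intpos g -> Ipos (fun x => f x - g x) = Ipos f - Ipos g.
Proof. by move=> ? ?; exact: RintegralB. Qed.

Lemma IposZ k f : intpos f -> Ipos (fun x => k * f x) = k * Ipos f.
Proof. by move=> ?; exact: RintegralZl. Qed.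

Lemma Ipos0 : Ipos (fun _ => 0) = 0.
Proof. by rewrite /Ipos /Rintegral integral0. Qed.

Lemma Ipos_sum (I : Type) (s : seq I) (F : I -> R -> R) :
  (forall i, intpos (F i)) ->
  Ipos (fun x => \sum_(i <- s) F i x) = \sum_(i <- s) Ipos (F i).
Proof.
move=> iF; elim: s => [|i s ih].
  by rewrite big_nil -[RHS]Ipos0; apply: eq_Ipos => x _; rewrite big_nil.
rewrite big_cons -ih -IposD//; last exact: intpos_sum.
by apply: eq_Ipos => x _; rewrite big_cons.
Qed.

Lemma Ipos_ge0 f : (forall x : R, 0 < x -> 0 <= f x) -> 0 <= Ipos f.
Proof. by move=> f0; apply: Rintegral_ge0 => x; rewrite inD; exact: f0. Qed.

Lemma le_Ipos f g : intpos f -> intpos g -> (forall x : R, 0 < x -> f x <= g x) ->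
  Ipos f <= Ipos g.
Proof. by move=> fi gi fg; apply: le_Rintegral => // x; rewrite inD; exact: fg. Qed.

Lemma le_norm_Ipos f g : mpos f -> intpos g -> (forall x : R, 0 < x -> `|f x| <= g x) ->
  `|Ipos f| <= Ipos g.
Proof.
move=> mf gi fg; have fi := le_intpos mf gi fg.
apply: (le_trans (le_normr_Rintegral _ fi)) => //.
by apply: le_Ipos => //; exact: intpos_norm.
Qed.

Lemma dct_pos (f_ : nat -> R -> R) f g : (forall n, mpos (f_ n)) ->
  (forall x : R, 0 < x -> f_ n x @[n --> \oo] --> f x) ->
  intpos g -> (forall n (x : R), 0 < x -> `|f_ n x| <= g x) ->
  intpos f /\ Ipos (f_ n) @[n --> \oo] --> Ipos f.
Proof.
move=> mf cf gi fg.
have mlim : mpos f.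
  by apply: (measurable_fun_cvg mf) => x; rewrite inD; exact: cf.
have [] := @dominated_convergence _ _ R mu D _ (fun n => EFin \o f_ n) (EFin \o f)
  (EFin \o g) _ _ _ gi _.
- by [].
- by move=> n; apply/measurable_EFinP; exact: mf.
- by apply/measurable_EFinP.
- apply/aeW => x; rewrite inD => x0; apply: cvg_EFin; first exact: nearW.
  exact: cf.
- by apply/aeW => x n; rewrite inD => x0 /=; rewrite lee_fin fg.
move=> fi _ lim; split => //.
apply: fine_cvg; rewrite fineK//.
exact: integrable_fin_num.
Qed.

(** Compact segments exhausting the half-line: the fundamental theorem of calculus and the
    substitution rules apply on compact intervals, and the results pass to the limit along [seg]. *)
Definition seg n : set R := `[n.+2%:R^-1, n.+2%:R]%classic.

Lemma seg_sub n : seg n `<=` D.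
Proof.
move=> x; rewrite inD /seg /= in_itv/= => /andP[h _]; apply: lt_le_trans h.
by rewrite invr_gt0.
Qed.

Lemma seg_near x : 0 < x -> \forall n \near \oo, seg n x.
Proof.
move=> x0; near=> n; rewrite /seg /= in_itv/=; apply/andP; split; last first.
  by apply: (@le_trans _ _ n%:R); [near: n; exact: nbhs_infty_ger|rewrite ler_nat; lia].
rewrite -[x]invrK lef_pV2 ?posrE ?invr_gt0//.
by apply: (@le_trans _ _ n%:R); [near: n; exact: nbhs_infty_ger|rewrite ler_nat; lia].
Unshelve. all: by end_near. Qed.

Lemma Ipos_exhaust f : intpos f ->
  \int[mu]_(x in seg n) f x @[n --> \oo] --> Ipos f.
Proof.
move=> fi.
have := @dct_pos (fun n => f \_ (seg n)) f (fun x => `|f x|).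
case.
- move=> n; apply/measurable_restrict => //; first exact: measurable_itv.
  by apply: (measurable_funS _ _ (intpos_mpos fi)) => // x [].
- move=> x x0; apply: cvg_near_cst.
  have := seg_near x0; apply: filterS => n An.
  by rewrite patchE mem_set.
- exact: intpos_norm.
- move=> n x x0; rewrite patchE; case: ifPn => // _.
  by rewrite normr0.
move=> _; apply: cvg_trans; apply: near_eq_cvg; apply: nearW => n /=.
by rewrite /Ipos -Rintegral_mkcondr setIidr//; exact: seg_sub.
Qed.

Lemma seg_nd : nondecreasing_seq seg.
Proof.
move=> n k nk; apply/subsetPset => x; rewrite /seg /= !in_itv/= => /andP[h1 h2].
apply/andP; split; last by apply: (le_trans h2); rewrite ler_nat.
by apply: le_trans h1; rewrite lef_pV2 ?posrE// ler_nat.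
Qed.

Lemma bigcup_seg : \bigcup_n seg n = D.
Proof.
apply/seteqP; split => [x [n _] /seg_sub//|x]; rewrite inD => /seg_near[n _ /(_ n (leqnn n)) An].
by exists n.
Qed.

Lemma integral_exhaust (f : R -> R) : (forall x : R, 0 < x -> {for x, continuous f}) ->
  (forall x : R, 0 < x -> 0 <= f x) ->
  (\int[mu]_(x in seg n) (f x)%:E @[n --> \oo] -->
   \int[mu]_(x in D) (f x)%:E)%E.
Proof.
move=> cf f0; rewrite -bigcup_seg.
apply: ge0_nondecreasing_set_cvg_integral => //.
- exact: seg_nd.
- by move=> i; exact: measurable_itv.
- move=> i; apply/measurable_EFinP.
  by apply: (measurable_funS _ (@seg_sub i)) => //; exact: mpos_continuous.
- by move=> i x /seg_sub; rewrite inD => x0; rewrite lee_fin f0.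
Qed.

Lemma intpos_exhaust (f : R -> R) (C : R) : (forall x : R, 0 < x -> {for x, continuous f}) ->
  (forall x : R, 0 < x -> 0 <= f x) ->
  (forall n, (\int[mu]_(x in seg n) (f x)%:E <= C%:E)%E) ->
  intpos f.
Proof.
move=> cf f0 fC; apply/integrableP; split.
  by apply/measurable_EFinP; exact: mpos_continuous.
have -> : (\int[mu]_(x in D) `|(EFin \o f) x| = \int[mu]_(x in D) (f x)%:E)%E.
  by apply: eq_integral => x; rewrite inE inD => x0 /=; rewrite ger0_norm// f0.
apply: (@le_lt_trans _ _ C%:E); last exact: ltry.
have h := integral_exhaust cf f0.
rewrite -(cvg_lim _ h)//; apply: lime_le; first exact: cvgP h.
by apply: nearW => n; exact: fC.
Qed.

Lemma is_derive_continuous (F : R -> R) (x d : R) : is_derive x 1 F d -> {for x, continuous F}.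
Proof. by move=> [dF _]; apply/differentiable_continuous/derivable1_diffP. Qed.

Lemma integral_derive (F f : R -> R) (a b : R) : 0 < a -> a < b ->
  (forall x : R, 0 < x -> is_derive x 1 F (f x)) ->
  (forall x : R, 0 < x -> {for x, continuous f}) ->
  (\int[mu]_(x in `[a, b]) (f x)%:E = (F b - F a)%:E)%E.
Proof.
move=> a0 ab dF cf; rewrite EFinB.
have cF (x : R) : 0 < x -> {for x, continuous F} by move=> /dF; exact: is_derive_continuous.
have b0 := lt_trans a0 ab.
apply: continuous_FTC2 => //.
- apply: continuous_in_subspaceT => x; rewrite inE /= in_itv/= => /andP[ax _].
  by apply: cf; apply: lt_le_trans ax.
- split.
  + move=> x; rewrite in_itv/= => /andP[ax _].
    by have [] := dF _ (lt_trans a0 ax).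
  + by apply: cvg_at_right_filter; exact: cF.
  + by apply: cvg_at_left_filter; exact: cF.
- move=> x; rewrite in_itv/= => /andP[ax _].
  by rewrite derive1E; apply: derive_val; exact: dF (lt_trans a0 ax).
Qed.

Lemma lt_seg n : n.+2%:R^-1 < n.+2%:R :> R.
Proof.
by apply: (@lt_trans _ _ 1); rewrite ?invf_lt1// ltr1n.
Qed.

(** The integral over each segment is a difference of two values of the bounded primitive, hence at
    most [C + C]; as [f] is nonnegative, monotone convergence carries the bound to the half-line. *)
Lemma intpos_derive (F f : R -> R) (C : R) :
  (forall x : R, 0 < x -> is_derive x 1 F (f x)) ->
  (forall x : R, 0 < x -> {for x, continuous f}) ->
  (forall x : R, 0 < x -> 0 <= f x) ->
  (forall x : R, 0 < x -> `|F x| <= C) -> intpos f.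
Proof.
move=> dF cf f0 FC; apply: (@intpos_exhaust _ (C + C)) => // n.
rewrite (integral_derive _ (lt_seg n) dF)// lee_fin.
have := FC n.+2%:R (ltr0Sn _ _); have := FC n.+2%:R^-1.
rewrite invr_gt0 ltr0Sn => /(_ isT); rewrite !ler_norml => /andP[h1 _] /andP[_ h2].
by apply: lerD => //; rewrite lerNl.
Qed.

Lemma cvgn_SS : (n.+2%:R : R) @[n --> \oo] --> +oo /\
  (n.+2%:R^-1 : R) @[n --> \oo] --> (0 : R).
Proof.
have ny : (n.+2%:R : R) @[n --> \oo] --> +oo.
  have c2 : n.+2 @[n --> \oo] --> \oo.
    by have := @cvg_addnr 2; under eq_fun do rewrite addn2.
  exact: (cvg_comp _ _ c2 (@cvgr_idn R)).
split => //.
by apply/(gtr0_cvgV0 (f := fun n => n.+2%:R)) => //; exact: nearW.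
Qed.

Lemma Ipos_derive (F f : R -> R) (l0 l1 : R) :
  (forall x : R, 0 < x -> is_derive x 1 F (f x)) ->
  (forall x : R, 0 < x -> {for x, continuous f}) ->
  intpos f ->
  F x @[x --> 0^'+] --> l0 ->
  F x @[x --> +oo] --> l1 ->
  Ipos f = l1 - l0.
Proof.
move=> dF cf fi F0 Foo.
have /cvg_unique := Ipos_exhaust fi; apply => //.
have [ny h] := @cvgn_SS.
have -> : (fun n => \int[mu]_(x in seg n) f x) =
   (fun n => F n.+2%:R - F n.+2%:R^-1).
  by apply/funext => n; rewrite /Rintegral (integral_derive _ (lt_seg n) dF).
apply: cvgB.
  exact: (cvg_comp _ _ ny Foo).
by move/cvg_at_rightP : F0; apply; split => // n.
Qed.

Lemma powRD_gt0 (x a b : R) : 0 < x -> x `^ (a + b) = x `^ a * x `^ b.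
Proof. by move=> x0; rewrite powRD// (gt_eqF x0) implybT. Qed.

Lemma continuous_powR (x g : R) : 0 < x -> {for x, continuous (fun y : R => y `^ g)}.
Proof. by move=> x0; apply: is_derive_continuous; exact: is_derive1_powR. Qed.

Lemma continuous_derive1 (F F' : R -> R) :
  (forall y : R, 0 < y -> is_derive y 1 F (F' y)) ->
  (forall y : R, 0 < y -> {for y, continuous F'}) ->
  forall y : R, 0 < y -> derive1 F y = F' y /\ {for y, continuous (derive1 F)}.
Proof.
move=> dF cF y y0.
have E z : 0 < z -> derive1 F z = F' z.
  by move=> z0; rewrite derive1E; apply: derive_val; exact: dF.
split; first exact: E.
have -> : {for y, continuous (derive1 F)} = (derive1 F x @[x --> y] --> F' y).
  by rewrite -E.
apply: cvg_trans (cF _ y0); apply: near_eq_cvg.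
near=> z; apply/esym/E; near: z; exact: lt_nbhsr.
Unshelve. all: by end_near. Qed.

Section substitution.
Variables (F F' f : R -> R).
Hypothesis dF : forall y : R, 0 < y -> is_derive y 1 F (F' y).
Hypothesis cF' : forall y : R, 0 < y -> {for y, continuous F'}.
Hypothesis F_gt0 : forall y : R, 0 < y -> 0 < F y.
Hypothesis F_surj : forall x : R, 0 < x -> exists2 y, 0 < y & F y = x.
Hypothesis cf : forall x : R, 0 < x -> {for x, continuous f}.
Hypothesis f_ge0 : forall x : R, 0 < x -> 0 <= f x.

Let cF (y : R) : 0 < y -> {for y, continuous F}.
Proof. by move=> y0; apply: is_derive_continuous; exact: dF. Qed.

Let cfF (y : R) : 0 < y -> {for y, continuous (f \o F)}.
Proof. by move=> y0; apply: continuous_comp; [exact: cF|exact/cf/F_gt0]. Qed.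

Let seg_gt0 n (y : R) : (seg n y -> 0 < y).
Proof. by move=> /seg_sub; rewrite inD. Qed.

Let derive_seg n :
  [/\ {in `](n.+2%:R^-1 : R), n.+2%:R[, continuous (derive1 F)},
      cvg (derive1 F x @[x --> (n.+2%:R^-1 : R)^'+]),
      cvg (derive1 F x @[x --> (n.+2%:R : R)^'-]) &
      derivable_oo_LRcontinuous F n.+2%:R^-1 n.+2%:R].
Proof.
have n0 : 0 < (n.+2%:R^-1 : R) by [].
have n1 : 0 < (n.+2%:R : R) by [].
split.
- move=> x; rewrite in_itv/= => /andP[h _].
  exact: (continuous_derive1 dF cF' (lt_trans n0 h)).2.
- apply/cvg_ex; exists (derive1 F n.+2%:R^-1); apply: cvg_at_right_filter.
  exact: (continuous_derive1 dF cF' n0).2.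
- apply/cvg_ex; exists (derive1 F n.+2%:R); apply: cvg_at_left_filter.
  exact: (continuous_derive1 dF cF' n1).2.
- split.
  + move=> x; rewrite in_itv/= => /andP[h _].
    by have [] := dF (lt_trans n0 h).
  + by apply: cvg_at_right_filter; exact: cF.
  + by apply: cvg_at_left_filter; exact: cF.
Qed.

(** Common core of the two monotone cases: [B n] stands for the image of [seg n] under [F], an
    interval whose end points swap when [F] decreases. Surjectivity of [F] makes the [B n] exhaust
    the half-line. *)
Let integral_subst_cvg (B : nat -> set R) :
  (forall n, measurable (B n)) -> nondecreasing_seq B ->
  (forall n x, B n x -> 0 < x) -> (forall n y, seg n y -> B n (F y)) ->
  (forall n, (\int[mu]_(x in B n) (f x)%:E =
    \int[mu]_(y in seg n) (f (F y) * `|F' y|)%:E)%E) ->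
  (\int[mu]_(x in D) (f x)%:E = \int[mu]_(y in D) (f (F y) * `|F' y|)%:E)%E.
Proof.
move=> mB ndB B0 BF E.
have DE : D = \bigcup_n B n.
  apply/seteqP; split => [x|x [n _ /B0]]; rewrite inD// => x0.
  have [y y0 <-] := F_surj x0.
  have [n _ /(_ n (leqnn n)) sy] := seg_near y0.
  by exists n => //; exact: BF.
have h1 : (\int[mu]_(x in B n) (f x)%:E @[n --> \oo] --> \int[mu]_(x in D) (f x)%:E)%E.
  rewrite DE; apply: ge0_nondecreasing_set_cvg_integral => //.
    move=> i; apply/measurable_EFinP; apply: (measurable_funS (E := D)) => //.
      by move=> x /B0; rewrite inD.
    exact: mpos_continuous.
  by move=> i x /B0 x0; rewrite lee_fin f_ge0.
have h2 : (\int[mu]_(y in seg n) (f (F y) * `|F' y|)%:E @[n --> \oo] -->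
    \int[mu]_(y in D) (f (F y) * `|F' y|)%:E)%E; last first.
  by move: h1; rewrite (funext E) => h1; exact: cvg_unique h1 h2.
apply: integral_exhaust => x x0.
  apply: continuousM; first exact: cfF.
  by apply: continuous_comp; [exact: cF'|exact: norm_continuous].
by rewrite mulr_ge0// f_ge0// F_gt0.
Qed.

Lemma integral_subst_increasing :
  (forall x y : R, 0 < x -> x < y -> F x < F y) ->
  (forall x : R, 0 < x -> 0 <= F' x) ->
  (\int[mu]_(x in D) (f x)%:E = \int[mu]_(y in D) (f (F y) * `|F' y|)%:E)%E.
Proof.
move=> incF F'0.
have leF (x y : R) : 0 < x -> x <= y -> F x <= F y.
  by move=> x0; rewrite le_eqVlt => /predU1P[->//|/(incF _ _ x0)/ltW].
apply: (@integral_subst_cvg (fun n => `[F n.+2%:R^-1, F n.+2%:R]%classic)).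
- by move=> n; exact: measurable_itv.
- move=> n k nk; apply/subsetPset => x; rewrite /= !in_itv/= => /andP[h1 h2].
  apply/andP; split.
    by apply: le_trans h1; apply: leF => //; rewrite lef_pV2 ?posrE// ler_nat.
  by apply: (le_trans h2); apply: leF => //; rewrite ler_nat.
- by move=> n x; rewrite /= in_itv/= => /andP[h _]; apply: lt_le_trans h; exact: F_gt0.
- move=> n y sy; have y0 := seg_gt0 sy; move: sy; rewrite /seg /= !in_itv/= => /andP[h1 h2].
  by rewrite !leF.
move=> n; have [h1 h2 h3 h4] := derive_seg n.
rewrite (integration_by_substitution_increasing _ _ h1 h2 h3 h4).
- apply: eq_integral => y; rewrite inE => /seg_gt0 y0.
  by rewrite fctE (continuous_derive1 dF cF' y0).1 ger0_norm// F'0.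
- exact: ltW (lt_seg n).
- move=> x y; rewrite !in_itv/= => /andP[x0 _] _; apply: incF.
  by apply: lt_le_trans x0.
- apply: continuous_in_subspaceT => x; rewrite inE /= in_itv/= => /andP[h _].
  by apply: cf; apply: lt_le_trans h; exact: F_gt0.
Qed.

Lemma integral_subst_decreasing :
  (forall x y : R, 0 < x -> x < y -> F y < F x) ->
  (forall x : R, 0 < x -> F' x <= 0) ->
  (\int[mu]_(x in D) (f x)%:E = \int[mu]_(y in D) (f (F y) * `|F' y|)%:E)%E.
Proof.
move=> decF F'0.
have leF (x y : R) : 0 < x -> x <= y -> F y <= F x.
  by move=> x0; rewrite le_eqVlt => /predU1P[->//|/(decF _ _ x0)/ltW].
apply: (@integral_subst_cvg (fun n => `[F n.+2%:R, F n.+2%:R^-1]%classic)).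
- by move=> n; exact: measurable_itv.
- move=> n k nk; apply/subsetPset => x; rewrite /= !in_itv/= => /andP[h1 h2].
  apply/andP; split.
    by apply: le_trans h1; apply: leF => //; rewrite ler_nat.
  by apply: (le_trans h2); apply: leF => //; rewrite lef_pV2 ?posrE// ler_nat.
- by move=> n x; rewrite /= in_itv/= => /andP[h _]; apply: lt_le_trans h; exact: F_gt0.
- move=> n y sy; have y0 := seg_gt0 sy; move: sy; rewrite /seg /= !in_itv/= => /andP[h1 h2].
  by rewrite !leF.
move=> n; have [h1 h2 h3 h4] := derive_seg n.
rewrite (integration_by_substitution_decreasing _ _ h1 h2 h3 h4).
- apply: eq_integral => y; rewrite inE => /seg_gt0 y0.
  by rewrite !fctE (continuous_derive1 dF cF' y0).1 ler0_norm// F'0.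
- exact: ltW (lt_seg n).
- move=> x y; rewrite !in_itv/= => _ /andP[x0 _]; apply: decF.
  by apply: lt_le_trans x0.
- apply: continuous_in_subspaceT => x; rewrite inE /= in_itv/= => /andP[h _].
  by apply: cf; apply: lt_le_trans h; exact: F_gt0.
Qed.

End substitution.

Section power_substitution.
Variables (c g : R).
Hypotheses (c0 : 0 < c) (g0 : g != 0).

Lemma is_derive_scale_powR (y : R) : 0 < y ->
  is_derive y 1 (fun y => c * y `^ g) (c * (g * y `^ (g - 1))).
Proof. by move=> y0; have := is_derive1_powR g y0 => ?; apply: is_deriveZ. Qed.

(** The sign of [g] decides between the increasing and the decreasing rule. Later uses are [g = 1]
    (scaling), [g = 2^-1] (reflection), [g = m] (kernel factors) and a negative exponent (the
    profile of the solution). *)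
Lemma integral_powR_subst (f : R -> R) :
  (forall x : R, 0 < x -> {for x, continuous f}) ->
  (forall x : R, 0 < x -> 0 <= f x) ->
  (\int[mu]_(x in D) (f x)%:E =
   \int[mu]_(y in D) (c * `|g| * y `^ (g - 1) * f (c * y `^ g))%:E)%E.
Proof.
move=> cf f_ge0.
pose F y := c * y `^ g; pose F' y := c * (g * y `^ (g - 1)).
have dF (y : R) : 0 < y -> is_derive y 1 F (F' y) by exact: is_derive_scale_powR.
have cF' (y : R) : 0 < y -> {for y, continuous F'}.
  move=> y0; apply: continuousM; first exact: cst_continuous.
  apply: continuousM; first exact: cst_continuous.
  exact: continuous_powR.
have F_gt0 (y : R) : 0 < y -> 0 < F y by move=> y0; rewrite mulr_gt0// powR_gt0.
have F_surj (x : R) : 0 < x -> exists2 y, 0 < y & F y = x.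
  move=> x0; exists ((x / c) `^ g^-1); first by rewrite powR_gt0// divr_gt0.
  by rewrite /F -powRrM mulVf// powRr1 ?divr_ge0 ?ltW// mulrC divfK// gt_eqF.
have lnF (x y : R) : 0 < x -> x < y -> ln x < ln y.
  by move=> x0 xy; rewrite ltr_ln// posrE// (lt_trans x0).
transitivity (\int[mu]_(y in D) (f (F y) * `|F' y|)%:E)%E; last first.
  apply: eq_integral => y _; congr EFin.
  by rewrite /F' !normrM (gtr0_norm c0) (ger0_norm (powR_ge0 _ _)) mulrC !mulrA.
have [g_gt0|g_lt0|/eqP] := ltgtP 0 g; last by rewrite eq_sym (negbTE g0).
- apply: integral_subst_increasing => //.
  + move=> x y x0 xy; rewrite ltr_pM2l// gt0_ltr_powR//.
      by rewrite nnegrE ltW.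
    by rewrite nnegrE ltW// (lt_trans x0).
  + by move=> x x0; rewrite mulr_ge0 ?ltW// mulr_gt0// powR_gt0.
- apply: integral_subst_decreasing => //.
  + move=> x y x0 xy; rewrite ltr_pM2l// /powR !gt_eqF// ?(lt_trans x0)//.
    by rewrite ltr_expR ltr_nM2l// lnF.
  + by move=> x x0; rewrite mulr_ge0_le0 ?ltW// nmulr_rlt0// powR_gt0.
Qed.

Lemma intpos_powR_subst (f : R -> R) : (forall x : R, 0 < x -> {for x, continuous f}) ->
  intpos f <-> intpos (fun y => c * `|g| * y `^ (g - 1) * f (c * y `^ g)).
Proof.
move=> cf.
have cg (x : R) : 0 < x -> {for x, continuous (fun y => c * `|g| * y `^ (g - 1) * f (c * y `^ g))}.
  move=> x0; apply: continuousM.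
    apply: continuousM; first exact: cst_continuous.
    exact: continuous_powR.
  apply: continuous_comp; last by apply: cf; rewrite mulr_gt0// powR_gt0.
  exact: is_derive_continuous (is_derive_scale_powR x0).
have cnf (x : R) : 0 < x -> {for x, continuous (fun x => `|f x|)}.
  by move=> x0; apply: continuous_comp; [exact: cf|exact: norm_continuous].
have E := integral_powR_subst cnf (fun x _ => normr_ge0 _).
have E2 : (\int[mu]_(x in D) `|(EFin \o f) x| = \int[mu]_(x in D)
   `|(EFin \o (fun y => (c * `|g| * y `^ (g - 1) * f (c * y `^ g))%R)) x|)%E.
  rewrite [LHS]E; apply: eq_integral => y; rewrite inE inD => y0 /=; congr EFin.
  by rewrite [RHS]normrM; congr (_ * _); rewrite ger0_norm// !mulr_ge0// ?powR_ge0// ltW.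
split=> /integrableP[mf fi]; apply/integrableP; split.
- by apply/measurable_EFinP; exact: mpos_continuous.
- by rewrite -E2.
- by apply/measurable_EFinP; exact: mpos_continuous.
- by rewrite E2.
Qed.

Lemma Ipos_powR_subst (f : R -> R) : (forall x : R, 0 < x -> {for x, continuous f}) ->
  intpos f ->
  Ipos f = Ipos (fun y => c * `|g| * y `^ (g - 1) * f (c * y `^ g)).
Proof.
move=> cf fi.
have cnf (x : R) : 0 < x -> {for x, continuous (fun x => `|f x|)}.
  by move=> x0; apply: continuous_comp; [exact: cf|exact: norm_continuous].
have ge0 (h : R -> R) : (forall x : R, 0 < x -> {for x, continuous h}) ->
    (forall x : R, 0 < x -> 0 <= h x) ->
    Ipos h = Ipos (fun y => c * `|g| * y `^ (g - 1) * h (c * y `^ g)).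
  by move=> ch h0; rewrite /Ipos /Rintegral (integral_powR_subst ch h0).
have cd (x : R) : 0 < x -> {for x, continuous (fun x => `|f x| - f x)}.
  by move=> x0; apply: continuousB; [exact: cnf|exact: cf].
have nfi := intpos_norm fi.
have dfi := intposB nfi fi.
(* Both [|f|] and [|f| - f] are nonnegative and still continuous, so the rule for nonnegative
   functions applies to each piece. *)
have -> : Ipos f = Ipos (fun x => `|f x|) - Ipos (fun x => `|f x| - f x).
  by rewrite IposB// subKr.
rewrite (ge0 _ cnf)// (ge0 _ cd); last by move=> x _; rewrite subr_ge0 ler_norm.
rewrite -IposB; last 2 first.
- exact/(intpos_powR_subst cnf).
- exact/(intpos_powR_subst cd).
by apply: eq_Ipos => y y0; rewrite -mulrBr opprB addrCA subrr addr0.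
Qed.

End power_substitution.

Definition mpos2 (f : R * R -> R) := measurable_fun (D `*` D) f.

Lemma mDD : measurable (D `*` D). Proof. exact: measurableX. Qed.

Lemma mpos2_fst f : mpos f -> mpos2 (fun z => f z.1).
Proof.
move=> mf; apply: (measurable_comp (F := D)) => //.
- by move=> _ [[x y] [Dx Dy] <-].
- by apply: measurable_funTS; exact: measurable_fst.
Qed.

Lemma mpos2_snd f : mpos f -> mpos2 (fun z => f z.2).
Proof.
move=> mf; apply: (measurable_comp (F := D)) => //.
- by move=> _ [[x y] [Dx Dy] <-].
- by apply: measurable_funTS; exact: measurable_snd.
Qed.

Lemma mpos2_comp f g : mpos f -> mpos2 g ->
  (forall x y : R, 0 < x -> 0 < y -> 0 < g (x, y)) -> mpos2 (f \o g).
Proof.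
move=> mf mg g0; apply: (measurable_comp (F := D)) => //.
move=> _ [[x y] [Dx Dy] <-]; rewrite inD.
by move: Dx Dy; rewrite !inD; exact: g0.
Qed.

Lemma mpos2_prod f : mpos f -> mpos2 (fun z => f (z.1 * z.2)).
Proof.
move=> mf; apply: (mpos2_comp (f := f) (g := fun z => z.1 * z.2)) => //.
  by apply: measurable_funM; apply: measurable_funTS; [exact: measurable_fst|exact: measurable_snd].
by move=> x y x0 y0; exact: mulr_gt0.
Qed.

Lemma mpos2M f g : mpos2 f -> mpos2 g -> mpos2 (fun z => f z * g z).
Proof. exact: measurable_funM. Qed.

(** Extending [f] by 0 outside the quadrant reduces this to Fubini on the plane; [h] bounds the
    inner integrals of [|f|], so Tonelli gives integrability on the product. *)
Lemma Fubini_pos (f : R -> R -> R) (h : R -> R) : mpos2 (fun z => f z.1 z.2) ->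
  (forall x : R, 0 < x -> intpos (f x)) ->
  (forall x : R, 0 < x -> Ipos (fun y => `|f x y|) <= h x) -> intpos h ->
  [/\ Ipos (fun x => Ipos (f x)) = Ipos (fun y => Ipos (fun x => f x y)),
      intpos (fun x => Ipos (f x)) & intpos (fun y => Ipos (fun x => f x y))].
Proof.
move=> mf fi fh hi.
pose g := (EFin \o (fun z : R * R => f z.1 z.2)) \_ (D `*` D).
have mg : measurable_fun setT g.
  by apply/(measurable_restrictT _ mDD)/measurable_EFinP.
have gE x y : g (x, y) = ((fun y => ((fun x => (f x y)%:E) \_ D) x) \_ D) y.
  rewrite /g !patchE in_setX /=.
  by case: (x \in D); case: (y \in D).
have gE' x y : g (x, y) = ((fun x => ((fun y => (f x y)%:E) \_ D) y) \_ D) x.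
  rewrite gE !patchE; case: ifPn => //; case: ifPn => //.
have intF x : (\int[mu]_y g (x, y))%E = ((fun x => \int[mu]_(y in D) (f x y)%:E) \_ D)%E x.
  under eq_integral do rewrite gE'.
  rewrite patchE; case: ifPn => xD.
    rewrite [RHS]integral_mkcond; apply: eq_integral => y _.
    by rewrite patchE xD.
  by rewrite integral0_eq// => y _; rewrite patchE (negbTE xD).
have intG y : (\int[mu]_x g (x, y))%E = ((fun y => \int[mu]_(x in D) (f x y)%:E) \_ D)%E y.
  under eq_integral do rewrite gE.
  rewrite patchE; case: ifPn => yD.
    rewrite [RHS]integral_mkcond; apply: eq_integral => x _.
    by rewrite patchE yD.
  by rewrite integral0_eq// => x _; rewrite patchE (negbTE yD).
have IfE x : 0 < x -> (\int[mu]_(y in D) (f x y)%:E = (Ipos (f x))%:E)%E.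
  move=> x0; rewrite /Ipos /Rintegral fineK//.
  by apply: integrable_fin_num => //; exact: fi.
have gi : (mu \x mu)%E.-integrable setT g.
  apply/integrable12ltyP => //.
  apply: (@le_lt_trans _ _ (\int[mu]_(x in D) (h x)%:E)%E); last first.
    exact: integrable_lty.
  rewrite [leRHS]integral_mkcond; apply: ge0_le_integral => //.
  - by move=> x _; exact: integral_ge0.
  - have mag : measurable_fun setT (abse \o g) by exact: measurableT_comp.
    have ag0 z : (0 <= (abse \o g) z)%E by exact: abse_ge0.
    exact: (@measurable_fun_fubini_tonelli_F _ _ _ _ _ mu _ mag ag0).

  - have mh : measurable_fun D (EFin \o h) by apply/measurable_EFinP; exact: intpos_mpos.
    by apply/(measurable_restrictT (EFin \o h)) => //.
  move=> x _; rewrite patchE.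
  under eq_integral do rewrite gE' patchE.
  case: ifPn => [|xD]; last by rewrite integral0_eq// => y _; rewrite abse0.
  rewrite inE inD => x0.
  have -> : (\int[mu]_y `|((fun y => (f x y)%:E) \_ D) y| =
      (Ipos (fun y => `|f x y|))%:E)%E; last first.
    by rewrite lee_fin fh.
  transitivity (\int[mu]_(y in D) (`|f x y|)%:E)%E.
    rewrite [RHS]integral_mkcond; apply: eq_integral => y _.
    by rewrite !patchE; case: ifPn => // _; rewrite abse0.
  rewrite /Ipos /Rintegral fineK//.
  apply: integrable_fin_num => //; exact: intpos_norm (fi _ x0).
have E1 : (\int[mu]_x \int[mu]_y g (x, y) = \int[mu]_(x in D) (Ipos (f x))%:E)%E.
  rewrite [RHS]integral_mkcond; apply: eq_integral => x _.
  rewrite intF !patchE; case: ifPn => //; rewrite inE inD => x0; exact: IfE.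
have iG : mu.-integrable setT (fubini_G mu g).
  have mG := measurable_fubini_G gi.
  have mag : measurable_fun setT (abse \o g) by exact: measurableT_comp.
  apply/integrableP; split => //.
  have lt : (\int[mu]_y \int[mu]_x `|g (x, y)| < +oo)%E by apply/integrable21ltyP.
  apply: le_lt_trans lt.
  apply: ge0_le_integral => //.
  - exact: measurableT_comp.
  - by apply: (@measurable_fun_fubini_tonelli_G _ _ _ _ _ mu _ mag) => z; exact: abse_ge0.
  - move=> y _; apply: le_abse_integral => //.
    exact: measurableT_comp mg (measurable_pair2 y).
have iF := integrable_fubini_F gi.
(* For a null set of [y] the inner integral may fail to be finite. Taking [fine] replaces those
   values by 0, which does not change the outer integral. *)
have IGfin y : 0 < y -> Ipos (fun x => f x y) = fine (fubini_G mu g y).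
  by move=> y0; rewrite /fubini_G intG patchE mem_set// inD.
have ifG : mu.-integrable setT (EFin \o (fine \o fubini_G mu g)).
  have mfG : measurable_fun setT (fine \o fubini_G mu g).
    by apply: measurableT_comp => //; exact: (measurable_int mu iG).
  apply: (le_integrable _ _ _ iG) => //; first exact/measurable_EFinP.
  by move=> y _ /=; case: (fubini_G mu g y) => [r||] //=; rewrite normr0 leey.
have iFD : mu.-integrable D (fubini_F mu g) by apply: integrableS iF.
have iGD : mu.-integrable D (EFin \o (fine \o fubini_G mu g)) by apply: integrableS ifG.
have E2 : (\int[mu]_y \int[mu]_x g (x, y) = \int[mu]_(y in D) (fine (fubini_G mu g y))%:E)%E.
  rewrite [RHS]integral_mkcond; apply: ae_eq_integral => //.
  - exact: (measurable_int mu iG).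
  - have mh := measurable_int mu iGD.
    by apply/(measurable_restrictT (EFin \o (fine \o fubini_G mu g))).
  have := integrable_ae measurableT iG; apply: filterS => y /(_ I) yfin _.
  rewrite patchE; case: ifPn => yD; first by rewrite fineK.
  by rewrite intG patchE (negbTE yD).
split.
- transitivity (fine (\int[mu]_x \int[mu]_y g (x, y))%E); first by rewrite E1.
  rewrite (Fubini gi) E2; apply: eq_Ipos => y y0; by rewrite IGfin.
- apply: eq_integrable iFD => // x; rewrite inE inD => x0.
  by rewrite /fubini_F intF patchE mem_set ?inD//= IfE.
- apply: eq_integrable iGD => // y; rewrite inE inD => y0.
  by rewrite /= IGfin.
Qed.

End HalfLine.

(** * The Gamma integral: convergence, functional equation, Wendel's inequalities *)

Section GammaFunction.
Variable R : realType.
Notation mu := (@lebesgue_measure R).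
Notation D := (`]0%R, +oo[%classic : set R).
Implicit Types (a x y d p X Y : R).

(** Comparison with the step function of height [m] on [[p, q]]. It serves positivity of Gamma, and
    later the mass of the Poisson kernel near its peak. *)
Lemma Ipos_lower_bound (f : R -> R) (p q m : R) : intpos f ->
  (forall x : R, 0 < x -> 0 <= f x) -> 0 < p -> p <= q -> 0 <= m ->
  (forall x : R, p <= x <= q -> m <= f x) -> m * (q - p) <= Ipos f.
Proof.
move=> fi f0 p0 pq m0 fm.
pose g := (cst m : R -> R) \_ `[p, q].
have sub : `[p, q]%classic `<=` D.
  by move=> x; rewrite inD /= in_itv/= => /andP[h _]; exact: lt_le_trans h.
have gf (x : R) : 0 < x -> g x <= f x.
  rewrite /g patchE; case: ifPn => [|_ x0]; last exact: f0.
  by rewrite inE /= in_itv/= => h _; exact: fm.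
have Ig : Ipos g = m * (q - p).
  rewrite /Ipos /g -Rintegral_mkcondr setIidr//.
  rewrite (@Rintegral_cst _ _ _ mu `[p, q]%classic)//.
  congr (_ * _); have /= -> := lebesgue_measure_itv `[p, q]; rewrite lte_fin; case: ltP => [_ //|qp].
  by apply/eqP; rewrite eq_sym subr_eq0 eq_le pq qp.
rewrite -Ig; apply: le_Ipos => //.
apply: (@le_intpos _ _ f) => //.
  apply/measurable_restrict => //; exact: measurable_cst.
move=> x x0; rewrite ger0_norm ?gf// /g patchE.
by case: ifPn.
Qed.

Lemma powR_le_expR (c d : R) : 0 <= c -> 0 < d ->
  exists2 C : R, 0 < C & forall x : R, 0 < x -> x `^ c <= C * expR (d * x).
Proof.
(* Writing [ln x = ln (x / k) + ln k] with [ln (x / k) <= x / k] leaves the slope [c / k], which is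
   at most [d]. The [+ 1] keeps [k] positive when [c = 0]. *)
move=> c0 d0; pose k := (c + 1) / d.
have c1 : 0 < c + 1 by rewrite ltr_wpDl.
have k0 : 0 < k by rewrite divr_gt0.
exists (expR (c * ln k)); first exact: expR_gt0.
move=> x x0; rewrite /powR gt_eqF// -expRD ler_expR.
have xk : 0 < x / k by rewrite divr_gt0.
have -> : ln x = ln (x / k) + ln k by rewrite -lnM ?posrE// divfK// gt_eqF.
have h : ln (x / k) <= x / k by exact/ltW/ln_sublinear.
rewrite mulrDr addrC lerD2l.
apply: (@le_trans _ _ (c * (x / k))); first by rewrite ler_wpM2l.
rewrite /k (_ : c * _ = d * x * (c / (c + 1))); last by field; rewrite !gt_eqF.
by rewrite ler_piMr ?mulr_ge0 ?ltW// ltr_pdivrMr// mul1r ltrDl.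
Qed.

(** The bounded primitive [- (1 + r^a)^-1] controls both ends at once: its derivative behaves like
    [r^(a - 1)] near 0, and [(1 + r^a)^2] is at most a multiple of [expR (d * r)], so a multiple of
    it dominates the integrand. *)
Lemma intpos_powR_expR (a d : R) : 0 < a -> 0 < d ->
  intpos (fun r => r `^ (a - 1) * expR (- (r * d))).
Proof.
move=> a0 d0.
pose F (r : R) := - (1 + r `^ a)^-1.
pose f (r : R) := a * r `^ (a - 1) / (1 + r `^ a) ^+ 2.
have den (r : R) : 0 < 1 + r `^ a by rewrite ltr_pwDl// powR_ge0.
have dF (r : R) : 0 < r -> is_derive r 1 F (f r).
  move=> r0; have h1 := is_derive1_powR a r0.
  have h2 : is_derive r 1 (fun r => 1 + r `^ a) (a * r `^ (a - 1)).
    apply: is_derive_eq.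
    by rewrite add0r mul1r.
  have h3 := @is_deriveV _ (fun r => 1 + r `^ a) r _ _ (lt0r_neq0 (den r)) h2.
  by apply: is_derive_eq; rewrite /GRing.scale/= mulNr opprK mulrC.
have fi : intpos f.
  apply: (@intpos_derive _ F f 1) => //.
  - move=> r r0.
    have h1 := is_derive1_powR a r0; have h2 := is_derive1_powR (a - 1) r0.
    apply: continuousM; first exact: is_derive_continuous.
    apply: continuousV; first by rewrite gt_eqF// exprn_gt0.
    exact: is_derive_continuous.
  - by move=> r r0; rewrite divr_ge0 ?exprn_ge0 ?mulr_ge0 ?powR_ge0// ltW.
  - move=> r r0; rewrite normrN ger0_norm ?invr_ge0 ?(ltW (den r))//.
    by rewrite invf_le1// lerDl powR_ge0.
have [C C0 hC] := powR_le_expR (mulr_ge0 (ler0n _ 2) (ltW a0)) d0.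
apply: (@le_intpos _ _ (fun r => (2 + 2 * C) / a * f r)); last 1 first.
- move=> r r0; rewrite ger0_norm ?mulr_ge0 ?powR_ge0 ?expR_ge0//.
  have := hC r r0; rewrite mulrC powRrM.
  have rE : (r `^ a) `^ 2 = (r `^ a) ^+ 2 by rewrite -powR_mulrn ?powR_ge0.
  rewrite mulrC rE => h.
  have e1 : 1 <= expR (d * r) by rewrite -expR0 ler_expR mulr_ge0 ?ltW.
  have E : expR (- (r * d)) = (expR (d * r))^-1 by rewrite expRN mulrC.
  rewrite E ler_pdivrMr ?expR_gt0//.
  rewrite /f (_ : _ * expR (d * r) = r `^ (a - 1) * (((2 + 2 * C) * expR (d * r)) / (1 + r `^ a) ^+ 2)); last first.
    by field; rewrite !gt_eqF.
  rewrite ler_peMr ?powR_ge0// ler_pdivlMr ?exprn_gt0// mul1r.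
  set u := r `^ a in h *; set E1 := expR _ in h e1 *.
  have u0 : 0 <= u by exact: powR_ge0.
  have := sqr_ge0 (1 - u); nra.
- apply: mposT; apply: measurable_funM => //.
  apply: measurableT_comp => //; apply: measurableT_comp => //; exact: measurable_funM.
- exact: intposZ.
Qed.

Lemma powR_expR_cvg0 (a d : R) (f : R -> R) : 0 < a -> 0 < d ->
  (forall r : R, 0 < r -> `|f r| <= r `^ a * expR (- (r * d))) ->
  f r @[r --> 0^'+] --> (0 : R) /\ f r @[r --> +oo] --> (0 : R).
Proof.
move=> a0 d0 fa; split; apply: norm_cvg0.
- have h := powR_cvg0 a0.
  apply: (@squeeze_cvgr _ _ _ _ (cst 0) _ _ _ _ _ h); last exact: cvg_cst.
  near=> r; have r0 : 0 < r by [].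
  rewrite normr_ge0/= (le_trans (fa _ r0))// ler_piMr ?powR_ge0// -expR0 ler_expR.
  by rewrite oppr_le0 mulr_ge0 ?ltW.
- have d2 : 0 < d / 2 by rewrite divr_gt0.
  have [C C0 hC] := powR_le_expR (ltW a0) d2.
  have h : C * expR (- (r * (d / 2))) @[r --> +oo] --> C * 0.
    apply: cvgMr; apply: (cvg_comp _ _ _ (@cvgr_expR R)).
    by apply: gt0_cvgMly => //; exact: cvg_id.
  rewrite mulr0 in h.
  apply: (@squeeze_cvgr _ _ _ _ (cst 0) _ _ _ _ _ h); last exact: cvg_cst.
  near=> r; have r0 : 0 < r by [].
  rewrite normr_ge0/= (le_trans (fa _ r0))//.
  apply: (@le_trans _ _ (C * expR (d / 2 * r) * expR (- (r * d)))).
    by rewrite ler_wpM2r ?expR_ge0// hC.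
  rewrite -mulrA -expRD ler_wpM2l ?(ltW C0)// ler_expR.
  by rewrite (_ : d / 2 * r + _ = - (r * (d / 2))) //; field.
Unshelve. all: by end_near. Qed.

Lemma intpos_Gamma a : 0 < a -> intpos (fun r => r `^ (a - 1) * expR (- r)).
Proof.
move=> a0; apply: eq_intpos (intpos_powR_expR a0 ltr01) => r _.
by rewrite mulr1.
Qed.

Lemma Gamma_pos_gt0 a : 0 < a -> 0 < Gamma_pos a.
Proof.
move=> a0; pose m := Num.min 1 (2 `^ (a - 1)) * expR (-2) : R.
have m0 : 0 < m by rewrite mulr_gt0 ?expR_gt0// lt_min ltr01 powR_gt0.
apply: lt_le_trans (Ipos_lower_bound (m := m) (p := 1) (q := 2) (intpos_Gamma a0) _ _ _ _ _).
- by rewrite mulr_gt0// subr_gt0 ltr1n.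
- by move=> x _; rewrite mulr_ge0 ?powR_ge0 ?expR_ge0.
- by [].
- by rewrite ler1n.
- exact: ltW.
move=> x /andP[x1 x2]; apply: ler_pM.
- by rewrite le_min ler01 powR_ge0.
- exact: expR_ge0.
- rewrite ge_min; have [a1|a1] := leP 1 a.
    have : (1 : R) `^ (a - 1) <= x `^ (a - 1).
      by apply: ge0_ler_powR; rewrite ?subr_ge0 ?nnegrE ?ler01 ?(le_trans ler01 x1).
    by rewrite powR1 => ->.
  apply/orP; right; have x0 : 0 < x by apply: lt_le_trans x1.
  rewrite /powR !gt_eqF// ler_expR ler_nM2l ?subr_lt0//.
  by rewrite ler_ln ?posrE.
- by rewrite ler_expR lerN2.
Qed.

Lemma Gamma_posS a : 0 < a -> Gamma_pos (a + 1) = a * Gamma_pos a.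
Proof.
move=> a0.
pose F (r : R) := - (r `^ a * expR (- r)).
pose f (r : R) := r `^ a * expR (- r) - a * (r `^ (a - 1) * expR (- r)).
have i1 : intpos (fun r : R => r `^ a * expR (- r)).
  have := intpos_Gamma (addr_gt0 a0 ltr01).
  by under eq_fun do rewrite addrK.
have i2 := intpos_Gamma a0.
have dF (r : R) : 0 < r -> is_derive r 1 F (f r).
  move=> r0; have h := is_derive1_powR a r0.
  by apply: is_derive_eq; rewrite /GRing.scale/= /f; ring.
have cf (r : R) : 0 < r -> {for r, continuous f}.
  move=> r0; have h := is_derive1_powR a r0; have h' := is_derive1_powR (a - 1) r0.
  exact: is_derive_continuous.
have [F0 Fy] : F r @[r --> 0^'+] --> (0 : R) /\ F r @[r --> +oo] --> (0 : R).
  apply: (powR_expR_cvg0 a0 ltr01) => r r0.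
  by rewrite normrN ger0_norm ?mulr_ge0 ?powR_ge0 ?expR_ge0// mulr1.
have := Ipos_derive dF cf (intposB i1 (intposZ a i2)) F0 Fy.
rewrite subrr /f IposB//; last exact: intposZ.
rewrite IposZ// => /eqP; rewrite subr_eq0 => /eqP <-.
by rewrite /Gamma_pos addrK.
Qed.

Lemma Gamma_pos1 : Gamma_pos 1 = 1 :> R.
Proof.
pose F (r : R) := - expR (- r).
pose f (r : R) := expR (- r).
have fi : intpos f.
  apply: eq_intpos (intpos_Gamma ltr01) => r _.
  by rewrite subrr powRr0 mul1r.
have dF (r : R) : 0 < r -> is_derive r 1 F (f r).
  by move=> r0; apply: is_derive_eq; rewrite mulrN1 opprK.
have cf (r : R) : 0 < r -> {for r, continuous f}.
  by move=> r0; exact: is_derive_continuous.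
have F0 : F r @[r --> 0^'+] --> F 0.
  by apply: cvg_at_right_filter; exact: is_derive_continuous.
have Fy : F r @[r --> +oo] --> - (0 : R) by apply: cvgN; exact: cvgr_expR.
transitivity (Ipos f).
  by apply: eq_Ipos => r _; rewrite subrr powRr0 mul1r.
by rewrite (Ipos_derive dF cf fi F0 Fy) /F oppr0 expR0 opprK add0r.
Qed.

(** Concavity of [ln] at [v]: the inequality [ln z <= z - 1] is used at [u / v] and [1 / v] with
    weights [x] and [1 - x], for which the right-hand sides cancel. *)
Lemma powR_le_tangent (x u : R) : 0 <= x <= 1 -> 0 < u -> u `^ x <= 1 - x + x * u.
Proof.
move=> /andP[x0 x1] u0; set v := 1 - x + x * u.
have v0 : 0 < v.
  move: x0; rewrite le_eqVlt => /predU1P[x0|x0]; last by rewrite ltr_wpDl ?subr_ge0// mulr_gt0.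
  by rewrite /v -x0 mul0r addr0 subr0.
have lnle (z : R) : 0 < z -> ln z <= z - 1.
  by move=> z0; have := @le_ln1Dx R (z - 1); rewrite (addrC 1) subrK; apply; lra.
have h1 := lnle _ (divr_gt0 u0 v0); have h2 := lnle _ (divr_gt0 ltr01 v0).
move: h1 h2; rewrite !ln_div ?posrE// ln1 => h1 h2.
rewrite /powR gt_eqF// -[leRHS]lnK ?posrE// ler_expR.
have E : x * (u / v - 1) + (1 - x) * (1 / v - 1) = 0.
  transitivity (v / v - 1); last by rewrite divff ?subrr// lt0r_neq0.
  by rewrite {3}/v; field; rewrite lt0r_neq0.
nra.
Qed.

(* Integrating the tangent line of the concave power [s^x] at [s = y]. *)
Lemma Gamma_pos_le x y : 0 <= x <= 1 -> 0 < y ->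
  Gamma_pos (y + x) <= y `^ x * Gamma_pos y.
Proof.
move=> x01 y0; have /andP[x0 x1] := x01.
have tangent (s : R) : 0 < s -> s `^ x <= y `^ x * (1 - x) + y `^ x * x / y * s.
  move=> s0; rewrite (_ : y `^ x * (1 - x) + _ = y `^ x * (1 - x + x * (s / y))); last first.
    by field; rewrite gt_eqF.
  rewrite -{1}(divfK (lt0r_neq0 y0) s) powRM ?(ltW y0) ?(ltW (divr_gt0 s0 y0))// mulrC.
  by rewrite ler_wpM2l ?powR_ge0// powR_le_tangent// divr_gt0.
have yx0 : 0 < y + x by rewrite ltr_pwDl.
have i1 := intpos_Gamma y0.
have i2 := intpos_Gamma (addr_gt0 y0 ltr01).
have i3 := intpos_Gamma yx0.
have -> : y `^ x * Gamma_pos y = y `^ x * (1 - x) * Gamma_pos y + y `^ x * x / y * Gamma_pos (y + 1).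
  by rewrite Gamma_posS//; field; rewrite gt_eqF.
rewrite /Gamma_pos -!IposZ// -IposD; [|exact: intposZ..].
apply: le_Ipos => //; first by apply: intposD; exact: intposZ.
move=> s s0.
have -> : y + x - 1 = (y - 1) + x by ring.
have -> : y + 1 - 1 = (y - 1) + 1 by ring.
move: (y - 1) => Y; rewrite !powRD_gt0// powRr1 ?(ltW s0)//.
set P := s `^ Y; set E := expR (- s).
rewrite (_ : _ + _ = P * E * (y `^ x * (1 - x) + y `^ x * x / y * s)); last by ring.
rewrite mulrAC ler_wpM2l ?tangent// mulr_ge0 ?powR_ge0 ?expR_ge0//.
Qed.

(** The upper bound started from [y + x] with exponent [1 - x] reaches [y + 1], where the functional
    equation applies. *)
Lemma Gamma_pos_ge x y : 0 <= x <= 1 -> 0 < y ->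
  y * (y + x) `^ (x - 1) * Gamma_pos y <= Gamma_pos (y + x).
Proof.
move=> /andP[x0 x1] y0.
have yx0 : 0 < y + x by rewrite ltr_pwDl.
have := @Gamma_pos_le (1 - x) (y + x).
rewrite (_ : y + x + (1 - x) = y + 1); last by ring.
rewrite Gamma_posS// subr_ge0 x1 lerBlDl lerDr x0 => /(_ isT yx0) h.
rewrite -mulrA mulrCA -ler_pdivlMl ?powR_gt0// -powRN opprB.
exact: h.
Qed.

End GammaFunction.

(** * Gamma integrals along rotated rays and Euler's reflection formula *)

Section RotatedGamma.
Variable R : realType.
Notation mu := (@lebesgue_measure R).
Notation D := (`]0%R, +oo[%classic : set R).
Implicit Types (a x y d p r s X Y phi psi : R).

Lemma measurable_sin : measurable_fun setT (@sin R).
Proof. by apply: continuous_measurable_fun; exact: continuous_sin. Qed.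

Section rotation.
Variables (a psi : R).
Hypothesis a0 : 0 < a.

(* Differentiating [g x] in the angle [x] gives [dg x], which is also the derivative of [h x] in [r];
   hence [int_0^oo g x r dr] does not depend on the rotation angle [x]. *)
Let g x r := r `^ (a - 1) * expR (- (r * cos x)) * sin (psi + a * x - r * sin x).
Let dg x r := r `^ (a - 1) * expR (- (r * cos x)) *
  (r * sin x * sin (psi + a * x - r * sin x) + (a - r * cos x) * cos (psi + a * x - r * sin x)).
Let h x r := r `^ a * (expR (- (r * cos x)) * cos (psi + a * x - r * sin x)).

Let is_derive_g x r : is_derive x 1 (g ^~ r) (dg x r).
Proof. by rewrite /g; apply: is_derive_eq; rewrite /dg /GRing.scale/=; ring. Qed.

Let is_derive_h x r : 0 < r -> is_derive r 1 (h x) (dg x r).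
Proof.
move=> r0; have H := is_derive1_powR a r0.
rewrite /h; apply: is_derive_eq; rewrite /dg /GRing.scale/=.
have -> : r `^ a = r `^ (a - 1) * r.
  by rewrite mulrC mulr_powRB1// ltW.
by move: (r `^ (a - 1)) => P; ring.
Qed.

Let mg x : mpos (g x).
Proof.
apply: mpos_continuous => r r0; have H := is_derive1_powR (a - 1) r0.
exact: is_derive_continuous.
Qed.

Let cdg x r : 0 < r -> {for r, continuous (dg x)}.
Proof.
move=> r0; have H := is_derive1_powR (a - 1) r0.
exact: is_derive_continuous.
Qed.

Let bound b r := r `^ (a - 1) * expR (- (r * cos b)) * (2 * r + a).

Let norm_g b x r : 0 < r -> cos b <= cos x -> `|g x r| <= r `^ (a - 1) * expR (- (r * cos b)).
Proof.
move=> r0 bx; rewrite /g !normrM (ger0_norm (powR_ge0 _ _)) (ger0_norm (expR_ge0 _)).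
rewrite -[leRHS]mulr1 ler_pM ?mulr_ge0 ?powR_ge0 ?expR_ge0 ?sin_max//.
by rewrite ler_wpM2l ?powR_ge0// ler_expR lerN2 ler_wpM2l// ltW.
Qed.

Let norm_dg b x r : 0 < r -> cos b <= cos x -> `|dg x r| <= bound b r.
Proof.
move=> r0 bx; rewrite /dg /bound !normrM (ger0_norm (powR_ge0 _ _)) (ger0_norm (expR_ge0 _)).
rewrite ler_pM ?mulr_ge0 ?powR_ge0 ?expR_ge0//.
  by rewrite ler_wpM2l ?powR_ge0// ler_expR lerN2 ler_wpM2l// ltW.
set A := psi + _ - _.
have h1 : `|r * sin x * sin A| <= r.
  rewrite !normrM (gtr0_norm r0) -mulrA ler_piMr ?(ltW r0)//.
  by rewrite mulr_ile1// sin_max.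
have h2 : `|(a - r * cos x) * cos A| <= a + r.
  rewrite normrM -[leRHS]mulr1 ler_pM ?cos_max//.
  apply: (le_trans (ler_normB _ _)); rewrite (gtr0_norm a0) lerD2l normrM (gtr0_norm r0).
  by rewrite ler_piMr ?(ltW r0)// cos_max.
apply: (le_trans (ler_normD _ _)).
by apply: (le_trans (lerD h1 h2)); lra.
Qed.

Let int_bound b : 0 < cos b -> intpos (bound b).
Proof.
move=> cb.
have i1 := intpos_powR_expR a0 cb.
have i2 := intpos_powR_expR (addr_gt0 a0 ltr01) cb.
apply: eq_intpos (intposD (intposZ 2 i2) (intposZ a i1)) => r r0.
rewrite /bound (_ : a + 1 - 1 = a - 1 + 1); last by ring.
by rewrite powRD_gt0// powRr1 ?(ltW r0)//; ring.
Qed.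

Let Ipos_dg x : 0 < cos x -> Ipos (dg x) = 0.
Proof.
move=> cx.
have [h0 hy] : h x r @[r --> 0^'+] --> (0 : R) /\ h x r @[r --> +oo] --> (0 : R).
  apply: (powR_expR_cvg0 a0 cx) => r r0.
  rewrite /h !normrM (ger0_norm (powR_ge0 _ _)) (ger0_norm (expR_ge0 _)).
  by rewrite ler_wpM2l ?powR_ge0// ler_piMr ?expR_ge0// cos_max.
rewrite (Ipos_derive (@is_derive_h x) (@cdg x) _ h0 hy) ?subrr//.
apply: le_intpos (int_bound cx) _; first by apply: mpos_continuous; exact: cdg.
by move=> r r0; exact: norm_dg.
Qed.

Let int_g x : 0 < cos x -> intpos (g x).
Proof.
move=> cx; apply: le_intpos (intpos_powR_expR a0 cx) _ => // r r0.
exact: norm_g.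
Qed.

Let le_cos b x : 0 <= b -> b <= pi -> - b <= x -> x <= b -> cos b <= cos x.
Proof.
move=> b0 bpi xb bx; rewrite -(cos_norm x).
have [xb'|xb'|<-//] := ltgtP `|x| b.
  by apply/ltW; rewrite ltr_cos// in_itv/= ?normr_ge0 ?b0 ?bpi// (le_trans (ltW xb')).
by have := lt_le_trans xb' (_ : `|x| <= b); rewrite ltxx ler_norml xb bx => /(_ isT).
Qed.

(** On []-b, b[] the cosine stays above [cos b > 0], so [bound b] dominates [dg] uniformly and
    differentiation under the integral is allowed. The result is 0 because [dg x] has the primitive
    [h x], which vanishes at both ends. *)
Let derive_G b x : 0 < b -> b < pi / 2 -> - b < x -> x < b ->
  is_derive x 1 (fun x => Ipos (g x)) 0.
Proof.
move=> b0 bpi xb bx.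
have pi0 := pi_gt0 R.
have cb : 0 < cos b by apply: cos_gt0_pihalf; rewrite bpi andbT; lra.
have cI z : `]- b, b[%classic z -> cos b <= cos z.
  by rewrite /= in_itv/= => /andP[h1 h2]; apply: le_cos; lra.
have Ix : `]- b, b[%classic x by rewrite /= in_itv/= xb bx.
have intf z : `]- b, b[%classic z -> mu.-integrable D (EFin \o g z).
  by move=> /cI cz; apply: int_g; exact: lt_le_trans cz.
have der z r : `]- b, b[%classic z -> D r -> derivable (g ^~ r) z 1.
  by move=> _ _; have [] := is_derive_g z r.
have dE z r : partial1of2 g z r = dg z r.
  by rewrite partial1of2E; apply: derive_val.
have G0 r : 0 <= `|bound b r| by [].
have iG : mu.-integrable D (EFin \o (fun r => `|bound b r|)).
  by apply: intpos_norm; exact: int_bound.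
have Gub z r : `]- b, b[%classic z -> D r -> `|partial1of2 g z r| <= `|bound b r|.
  rewrite inD dE => /cI cz r0; apply: le_trans (ler_norm _); exact: norm_dg.
have mD : measurable D by exact: measurable_itv.
have d1 := @derivable_under_integral _ _ _ mu g D mD x _ _ Ix intf der _ G0 iG Gub.
have d2 := @differentiation_under_integral _ _ _ mu g D mD x _ _ Ix intf der _ G0 iG Gub.
apply: DeriveDef => //; rewrite -derive1E d2.
transitivity (Ipos (dg x)); last exact: Ipos_dg (lt_le_trans cb (cI _ Ix)).
by apply: eq_Ipos => r _; exact: dE.
Qed.

Lemma Ipos_rotated_aux x : - (pi / 2) < x -> x < pi / 2 ->
  Ipos (g x) = sin psi * Gamma_pos a.
Proof.
move=> x1 x2; have pi0 := pi_gt0 R.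
pose b := (`|x| + pi / 2) / 2.
have nx : `|x| < pi / 2 by rewrite ltr_norml x1 x2.
have b0 : 0 < b by rewrite divr_gt0// ltr_wpDl// divr_gt0.
have bpi : b < pi / 2 by rewrite /b; lra.
have xb : `|x| < b by rewrite /b; lra.
have dG z : - b < z -> z < b -> is_derive z 1 (fun x => Ipos (g x)) 0.
  exact: derive_G.
have -> : Ipos (g x) = Ipos (g 0).
  move: xb; rewrite ltr_norml => /andP[xb bx].
  have cG p q : - b < p -> q < b -> {within `[p, q], continuous (fun x => Ipos (g x))}.
    move=> bp qb; apply: continuous_in_subspaceT => z; rewrite inE /= in_itv/= => /andP[h1 h2].
    by apply: is_derive_continuous; apply: dG; [exact: lt_le_trans h1|exact: le_lt_trans qb].
  have [x0|x0|->//] := ltgtP x 0.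
  - have [|||c _] := @MVT R (fun x => Ipos (g x)) (fun=> 0) x 0 => //.
    + by move=> z; rewrite in_itv/= => /andP[h1 h2]; apply: dG; lra.
    + by apply: cG; lra.
    by rewrite mul0r => /eqP; rewrite subr_eq0 => /eqP.
  - have [|||c _] := @MVT R (fun x => Ipos (g x)) (fun=> 0) 0 x => //.
    + by move=> z; rewrite in_itv/= => /andP[h1 h2]; apply: dG; lra.
    + by apply: cG; lra.
    by rewrite mul0r => /eqP; rewrite subr_eq0 => /eqP.
rewrite -IposZ; last exact: intpos_Gamma.
by apply: eq_Ipos => r _; rewrite /g cos0 sin0 !mulr0 mulr1 addr0 subr0 mulrC.
Qed.

Lemma intpos_rotated_aux x : - (pi / 2) < x -> x < pi / 2 -> intpos (g x).
Proof. by move=> x1 x2; apply: int_g; apply: cos_gt0_pihalf; rewrite x1. Qed.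

End rotation.

Lemma intpos_rotated a phi psi X : 0 < a -> - (pi / 2) < phi -> phi < pi / 2 -> 0 < X ->
  intpos (fun r => r `^ (a - 1) * expR (- (r * (X * cos phi))) * sin (psi - r * (X * sin phi))).
Proof.
move=> a0 p1 p2 X0.
have c0 : 0 < X * cos phi by rewrite mulr_gt0// cos_gt0_pihalf// p1.
apply: le_intpos (intpos_powR_expR a0 c0) _.
  apply: mpos_continuous => r r0; have H := is_derive1_powR (a - 1) r0.
  exact: is_derive_continuous.
move=> r r0; rewrite !normrM (ger0_norm (powR_ge0 _ _)) (ger0_norm (expR_ge0 _)).
by rewrite ler_piMr ?sin_max// mulr_ge0 ?powR_ge0 ?expR_ge0.
Qed.

(** Imaginary part of [int r^(a-1) exp(i psi - r X exp(i phi)) dr = Gamma(a) X^(-a) exp(i (psi - a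
    phi))]. The free phase [psi] makes one real identity cover both real and imaginary parts. *)
Lemma Ipos_rotated a phi psi X : 0 < a -> - (pi / 2) < phi -> phi < pi / 2 -> 0 < X ->
  Ipos (fun r => r `^ (a - 1) * expR (- (r * (X * cos phi))) * sin (psi - r * (X * sin phi)))
  = X `^ (- a) * Gamma_pos a * sin (psi - a * phi).
Proof.
move=> a0 p1 p2 X0.
have E := Ipos_rotated_aux (psi - a * phi) a0 p1 p2.
have fi := intpos_rotated_aux (psi - a * phi) a0 p1 p2.
rewrite -mulrA [Gamma_pos a * _]mulrC -E.
have cf (r : R) : 0 < r -> {for r, continuous (fun r =>
    r `^ (a - 1) * expR (- (r * cos phi)) * sin (psi - a * phi + a * phi - r * sin phi))}.
  move=> r0; have H := is_derive1_powR (a - 1) r0.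
  exact: is_derive_continuous.
have fi' := (intpos_powR_subst X0 (oner_neq0 R) cf).1 fi.
rewrite (Ipos_powR_subst X0 (oner_neq0 R) cf fi) -IposZ//.
apply: eq_Ipos => r r0; rewrite subrr powRr0 powRr1 ?(ltW r0)// normr1 !mulr1.
rewrite powRM ?(ltW r0) ?(ltW X0)// subrK.
have -> : X `^ (- a) * (X * (X `^ (a - 1) * r `^ (a - 1) * expR (- (X * r * cos phi)) *
    sin (psi - X * r * sin phi))) =
   (X `^ (- a) * (X `^ 1 * X `^ (a - 1))) * (r `^ (a - 1) * expR (- (X * r * cos phi)) *
    sin (psi - X * r * sin phi)) by rewrite (powRr1 (ltW X0)); ring.
rewrite -!powRD_gt0// (_ : - a + (1 + (a - 1)) = 0) ?powRr0 ?mul1r; last by ring.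
by rewrite ![r * (X * _)]mulrA ![r * X]mulrC.
Qed.

Lemma Ipos_powR_expR a X : 0 < a -> 0 < X ->
  Ipos (fun r => r `^ (a - 1) * expR (- (r * X))) = X `^ (- a) * Gamma_pos a.
Proof.
move=> a0 X0; have pi0 := pi_gt0 R.
have := @Ipos_rotated a 0 (pi / 2) X a0; rewrite !mulr0 subr0 sin_pihalf mulr1 => <-//; [|lra|lra].
by apply: eq_Ipos => r r0; rewrite sin0 cos0 !(mulr1, mulr0) subr0 sin_pihalf mulr1.
Qed.

Lemma Ipos_expR_sin X Y psi : 0 < X ->
  Ipos (fun r => expR (- (r * X)) * sin (psi - r * Y)) =
  (X * sin psi - Y * cos psi) / (X ^+ 2 + Y ^+ 2).
Proof.
move=> X0; set N := X ^+ 2 + Y ^+ 2.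
have N0 : 0 < N by rewrite ltr_pwDl ?sqr_ge0// exprn_gt0.
pose F r := - (expR (- (r * X)) * (X * sin (psi - r * Y) - Y * cos (psi - r * Y)) / N).
pose f r := expR (- (r * X)) * sin (psi - r * Y).
have dF (r : R) : 0 < r -> is_derive r 1 F (f r).
  move=> r0; rewrite /F; apply: is_derive_eq; rewrite /f /GRing.scale/= /N.
  by field; rewrite -/N gt_eqF.
have cf (r : R) : 0 < r -> {for r, continuous f}.
  by move=> r0; exact: is_derive_continuous.
have fi : intpos f.
  apply: le_intpos (intpos_powR_expR ltr01 X0) _; first exact: mpos_continuous.
  move=> r r0; rewrite subrr powRr0 mul1r /f normrM (ger0_norm (expR_ge0 _)).
  by rewrite ler_piMr ?expR_ge0// sin_max.
have F0 : F r @[r --> 0^'+] --> F 0.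
  by apply: cvg_at_right_filter; exact: is_derive_continuous.
have Fy : F r @[r --> +oo] --> (0 : R).
  have C0 : 0 <= (X + `|Y|) / N 
    by apply: divr_ge0; [exact: addr_ge0 (ltW X0) (normr_ge0 _)|exact: ltW].
  have h : (X + `|Y|) / N * expR (- (r * X)) @[r --> +oo] --> (X + `|Y|) / N * 0.
    apply: cvgMr; apply: (cvg_comp _ _ _ (@cvgr_expR R)).
    by apply: gt0_cvgMly => //; exact: cvg_id.
  rewrite mulr0 in h; apply: norm_cvg0.
  apply: (@squeeze_cvgr _ _ _ _ (cst 0) _ _ _ _ _ h); last exact: cvg_cst.
  near=> r; rewrite normr_ge0/= normrN -mulrA normrM (ger0_norm (expR_ge0 _)).
  rewrite mulrC ler_wpM2r ?expR_ge0// normrM (gtr0_norm (_ : 0 < N^-1)) ?invr_gt0//.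
  rewrite ler_wpM2r ?invr_ge0 ?(ltW N0)// (le_trans (ler_normB _ _))//.
  rewrite !normrM (gtr0_norm X0) lerD// ?ler_piMr ?sin_max ?cos_max// ltW//.
rewrite (Ipos_derive dF cf fi F0 Fy) sub0r /F opprK mul0r oppr0 expR0 mul1r.
by rewrite mul0r subr0.
Unshelve. all: by end_near. Qed.

Lemma intpos_expR_sin X Y psi : 0 < X -> intpos (fun r => expR (- (r * X)) * sin (psi - r * Y)).
Proof.
move=> X0; apply: le_intpos (intpos_powR_expR ltr01 X0) _.
  by apply: mpos_continuous => r r0; exact: is_derive_continuous.
move=> r r0; rewrite subrr powRr0 mul1r normrM (ger0_norm (expR_ge0 _)).
by rewrite ler_piMr ?expR_ge0// sin_max.
Qed.

Opaque Gamma_pos Ipos pi.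

Section reflection.
Variable a : R.
Hypothesis a01 : 0 < a < 1.

Let a0 : 0 < a. Proof. by case/andP: a01. Qed.
Let a1 : 0 < 1 - a. Proof. by case/andP: a01; rewrite subr_gt0. Qed.

(** The imaginary part of [exp(i psi) / (s + exp(i phi))], that is, the Laplace transform at [s] of
    [exp(- r cos phi) sin(psi - r sin phi)]. *)
Let Q phi psi s := ((s + cos phi) * sin psi - sin phi * cos psi) /
  ((s + cos phi) ^+ 2 + sin phi ^+ 2).

(** The factor [r^(a-1) Gamma(1-a)] is itself the integral of [s^(-a) exp(- s r)] over [s].
    Integrating over [s] first gives a rotated Gamma integral, over [r] first gives [Q]. *)
Let reflect_Fubini phi psi : - (pi / 2) < phi -> phi < pi / 2 ->
  intpos (fun s => s `^ (- a) * Q phi psi s) /\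
  Ipos (fun s => s `^ (- a) * Q phi psi s) =
  Gamma_pos a * Gamma_pos (1 - a) * sin (psi - a * phi).
Proof.
move=> p1 p2.
have c0 : 0 < cos phi by rewrite cos_gt0_pihalf// p1.
pose f r s := expR (- (r * cos phi)) * sin (psi - r * sin phi) *
  (s `^ (- a) * expR (- (s * r))).
have aE : - a = (1 - a) - 1 by ring.
have ias r : 0 < r -> intpos (fun s => s `^ (- a) * expR (- (s * r))).
  by rewrite aE; exact: intpos_powR_expR.
have IsE r : 0 < r -> Ipos (fun s => s `^ (- a) * expR (- (s * r))) =
    r `^ (a - 1) * Gamma_pos (1 - a).
  by move=> r0; have := Ipos_powR_expR a1 r0; rewrite -aE opprB.
have [||||E i1 i2] := @Fubini_pos R f
  (fun r => r `^ (a - 1) * expR (- (r * cos phi)) * Gamma_pos (1 - a)).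
- apply: mpos2M; last apply: mpos2M.
  + apply: (mpos2_fst (f := fun r => expR (- (r * cos phi)) * sin (psi - r * sin phi))).
    by apply: mpos_continuous => r r0; exact: is_derive_continuous.
  + by apply: (mpos2_snd (f := fun s => s `^ (- a))); exact: mposT.
  + under eq_fun do rewrite mulrC.
    by apply: (mpos2_prod (f := fun u => expR (- u))); apply: mposT; exact: measurableT_comp.
- by move=> r r0; apply: intposZ; exact: ias.
- move=> r r0.
  rewrite (@eq_Ipos _ _ (fun s => `|expR (- (r * cos phi)) * sin (psi - r * sin phi)| *
     (s `^ (- a) * expR (- (s * r))))); last first.
    move=> s s0; rewrite normrM; congr (_ * _).
    by rewrite ger0_norm ?mulr_ge0 ?powR_ge0 ?expR_ge0.
  rewrite (IposZ _ (ias r r0)) (IsE r r0) mulrA; apply: ler_wpM2r; first exact/ltW/Gamma_pos_gt0.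
  rewrite mulrC ler_wpM2l ?powR_ge0// normrM (ger0_norm (expR_ge0 _)).
  by rewrite ler_piMr ?expR_ge0// sin_max.
- apply: eq_intpos (intposZ (Gamma_pos (1 - a)) (intpos_powR_expR a0 c0)) => r _.
  by rewrite mulrC.
have QE s : 0 < s -> Ipos (fun r => f r s) = s `^ (- a) * Q phi psi s.
  move=> s0; have sc0 := addr_gt0 s0 c0.
  rewrite /Q -(Ipos_expR_sin (sin phi) psi sc0) -(IposZ _ (intpos_expR_sin (sin phi) psi sc0)).
  apply: eq_Ipos => r r0; rewrite /f mulrDr opprD expRD (mulrC r s); ring.
split; first by apply: eq_intpos i2; exact: QE.
rewrite -(eq_Ipos QE) -E.
transitivity (Ipos (fun r => Gamma_pos (1 - a) *
   (r `^ (a - 1) * expR (- (r * (1 * cos phi))) * sin (psi - r * (1 * sin phi))))).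
  by apply: eq_Ipos => r r0; rewrite /f (IposZ _ (ias r r0)) (IsE r r0) !mul1r; ring.
rewrite IposZ; last exact: intpos_rotated.
by rewrite (Ipos_rotated psi a0 p1 p2 ltr01) powR1 mul1r; ring.
Qed.

Lemma Ipos_Stieltjes : intpos (fun s => s `^ (- a) / (1 + s)) /\
  Ipos (fun s => s `^ (- a) / (1 + s)) = Gamma_pos a * Gamma_pos (1 - a).
Proof.
have pi0 := pi_gt0 R.
have [||] := @reflect_Fubini 0 (pi / 2); [lra|lra|].
have QE s : 0 < s -> s `^ (- a) * Q 0 (pi / 2) s = s `^ (- a) / (1 + s).
  move=> s0; rewrite /Q cos0 sin0 sin_pihalf mul0r subr0 mulr1 expr0n addr0 (addrC s).
  by congr (_ * _); rewrite expr2 invfM mulrA divff ?mul1r// gt_eqF// addr_gt0.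
rewrite mulr0 subr0 sin_pihalf mulr1 => i1 <-; split; first exact: eq_intpos i1.
by apply: eq_Ipos => s s0; rewrite QE.
Qed.

(** With [psi = pi], the integrand tends to [s^(-a) / (1 + s^2)] as [phi] tends to [pi / 2]. The
    angle [pi / 2] itself is out of reach because the exponential decay [cos phi] disappears there,
    hence the sequence [phi n]. *)
Lemma Ipos_Stieltjes_sqr : intpos (fun s => s `^ (- a) / (1 + s ^+ 2)) /\
  Ipos (fun s => s `^ (- a) / (1 + s ^+ 2)) =
  Gamma_pos a * Gamma_pos (1 - a) * sin (a * (pi / 2)).
Proof.
have pi0 := pi_gt0 R.
pose phi n : R := (pi / 2) * (1 - n.+2%:R^-1).
have phi1 n : 0 < phi n /\ phi n < pi / 2.
  have h : 0 < (n.+2%:R^-1 : R) < 1 by rewrite invr_gt0 ltr0n/= invf_lt1 ?ltr1n.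
  have p2 : 0 < pi / 2 :> R by rewrite divr_gt0.
  case/andP: h => h1 h2; split; first by rewrite mulr_gt0// subr_gt0.
  by rewrite /phi gtr_pMr// ltrBlDr ltrDl.
have phic : phi n @[n --> \oo] --> pi / 2.
  rewrite -[X in _ --> X]mulr1 -{2}(subr0 1); apply: cvgMr; apply: cvgB; first exact: cvg_cst.
  by have [_] := @cvgn_SS R.
pose q n s : R := s `^ (- a) * Q (phi n) pi s.
have qE n s : 0 < s -> q n s = s `^ (- a) * (sin (phi n) / (s ^+ 2 + 2 * s * cos (phi n) + 1)).
  move=> s0; rewrite /q /Q sinpi cospi mulr0 mulrN1 opprK add0r; congr (_ * (_ / _)).
  by rewrite -[X in _ = _ + X](cos2Dsin2 (phi n)); ring.
have sc n : 0 < cos (phi n) /\ 0 < sin (phi n).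
  have [h1 h2] := phi1 n; split.
    by rewrite cos_gt0_pihalf// h2 andbT; lra.
  by rewrite sin_gt0_pihalf// h1.
have refl n : intpos (q n) /\ Ipos (q n) = Gamma_pos a * Gamma_pos (1 - a) * sin (pi - a * phi n).
  by have [h1 h2] := phi1 n; apply: reflect_Fubini => //; lra.
pose g s : R := s `^ (- a) / (1 + s ^+ 2).
have den s : 0 < 1 + s ^+ 2 by rewrite ltr_pwDl// sqr_ge0.
have den2 n s : 0 < s -> 1 + s ^+ 2 <= s ^+ 2 + 2 * s * cos (phi n) + 1 <= 2 * (1 + s ^+ 2).
  move=> s0; have [c0 _] := sc n; have c1 := cos_le1 (phi n).
  have := mulr_gt0 s0 c0; have : s * cos (phi n) <= s by rewrite ler_piMr// ltW.
  have := sqr_ge0 (s - 1); move=> h1 h2 h3; apply/andP; split; nra.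
have mg : mpos g.
  apply: mposT; apply: measurable_funM => //.
  apply: continuous_measurable_fun => s.
  apply: (@continuousV _ _ (fun s : R => 1 + s ^+ 2)); first exact: lt0r_neq0.
  exact: is_derive_continuous.
(* The denominator of [q 0] is at most twice [1 + s^2], so integrability of the limit is inherited
   from the first term of the sequence. *)
have gi : intpos g.
  apply: le_intpos mg (intposZ (2 / sin (phi 0%N)) (refl 0%N).1) _ => s s0.
  rewrite ger0_norm; last by rewrite divr_ge0 ?powR_ge0// ltW.
  have [_ sn] := sc 0%N; have /andP[d1 d2] := den2 0%N s s0.
  rewrite qE// /g mulrCA ler_wpM2l ?powR_ge0//.
  have dd : 0 < s ^+ 2 + 2 * s * cos (phi 0%N) + 1 by apply: lt_le_trans d1.
  rewrite mulrA divfK ?lt0r_neq0// ler_pdivlMr// mulrC ler_pdivrMr//.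
split => //.
have qs s : 0 < s -> q n s @[n --> \oo] --> g s.
  move=> s0; under eq_fun do rewrite qE//.
  apply: cvgMr.
  have -> : (1 + s ^+ 2)^-1 = sin (pi / 2) / (s ^+ 2 + 2 * s * cos (pi / 2) + 1).
    by rewrite sin_pihalf cos_pihalf mulr0 addr0 mul1r addrC.
  apply: cvgM; first exact: (cvg_comp _ _ phic (@continuous_sin R _)).
  apply: cvgV; first by rewrite cos_pihalf mulr0 addr0 addrC lt0r_neq0.
  apply: cvgD; last exact: cvg_cst.
  apply: cvgD; first exact: cvg_cst.
  by apply: cvgMr; exact: (cvg_comp _ _ phic (@continuous_cos R _)).
have qb n s : 0 < s -> `|q n s| <= g s.
  move=> s0; have [_ sn] := sc n; have /andP[d1 d2] := den2 n s s0.
  have dd : 0 < s ^+ 2 + 2 * s * cos (phi n) + 1 by apply: lt_le_trans d1.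
  rewrite qE// ger0_norm; last by rewrite mulr_ge0 ?powR_ge0// divr_ge0 ?(ltW sn) ?(ltW dd).
  rewrite /g ler_wpM2l ?powR_ge0// ler_pdivrMr// ler_pdivlMl//.
  by apply: le_trans d1; rewrite ler_piMr ?sin_le1// ltW.
have [_ lim] := dct_pos (fun n => intpos_mpos (refl n).1) qs gi qb.
apply/esym; apply: cvg_unique lim => //.
have -> : sin (a * (pi / 2)) = sin (pi - a * (pi / 2)).
  by rewrite sinB sinpi cospi mul0r sub0r mulN1r opprK.
rewrite (funext (fun n => (refl n).2)).
apply: cvgMr; apply: continuous_cvg; first exact: continuous_sin.
by apply: cvgB; [exact: cvg_cst|exact: cvgMr].
Qed.

End reflection.

(** Substituting the square root of [y] for [s] turns the integral with [1 + s^2] into half the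
    Stieltjes integral with exponent [b = (1 + a) / 2]. Multiplying by [2 cos(a pi / 2)] and using
    [sin(pi b) = cos(a pi / 2)] gives the claim. *)
Lemma reflection_step a : 0 < a < 1 ->
  Gamma_pos a * Gamma_pos (1 - a) * sin (pi * a) =
  Gamma_pos ((1 + a) / 2) * Gamma_pos (1 - (1 + a) / 2) * sin (pi * ((1 + a) / 2)).
Proof.
move=> a01; set b := (1 + a) / 2.
have b01 : 0 < b < 1 by rewrite /b; lra.
have [i1 E1] := Ipos_Stieltjes b01.
have [i2 E2] := Ipos_Stieltjes_sqr a01.
have cf s : 0 < s -> {for s, continuous (fun s : R => s `^ (- a) / (1 + s ^+ 2))}.
  move=> s0; apply: continuousM; first exact: continuous_powR.
  apply: continuousV; first by rewrite lt0r_neq0// ltr_pwDl// sqr_ge0.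
  exact: is_derive_continuous.
have h20 : (2^-1 : R) != 0 by rewrite invr_neq0.
have := Ipos_powR_subst ltr01 h20 cf i2.
have -> : Ipos (fun y => 1 * `|2^-1| * y `^ (2^-1 - 1) *
    ((1 * y `^ 2^-1) `^ (- a) / (1 + (1 * y `^ 2^-1) ^+ 2))) =
    2^-1 * (Gamma_pos b * Gamma_pos (1 - b)).
  rewrite -E1 -(IposZ _ i1); apply: eq_Ipos => y y0.
  have h1 : (y `^ 2^-1) ^+ 2 = y.
    by rewrite -powR_mulrn ?powR_ge0// -powRrM mulVf// powRr1// ltW.
  have h2 : y `^ (2^-1 - 1) * y `^ (2^-1 * - a) = y `^ (- b).
    by rewrite -powRD_gt0//; congr (_ `^ _); rewrite /b; field.
  have h3 : `|2^-1 : R| = 2^-1 by rewrite ger0_norm ?invr_ge0.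
  by rewrite !mul1r h1 h3 -powRrM -h2 !mulrA.
rewrite E2 => E.
have -> : pi * a = a * (pi / 2) + a * (pi / 2) by field.
have -> : sin (pi * b) = cos (a * (pi / 2)).
  by rewrite (_ : pi * b = a * (pi / 2) + pi / 2) ?sinDpihalf//; rewrite /b; field.
rewrite sinD; move: E; set S := sin _; set C := cos _ => E.
move: (Gamma_pos a * _) (Gamma_pos b * _) E => g h E.
rewrite (_ : g * _ = 2 * C * (g * S)); last by ring.
by rewrite E; field.
Qed.

(** The left-hand side is invariant under [a -> (1 + a) / 2], whose iterates tend to 1. Near 1 it is
    read off from [Gamma(1 - x) = Gamma(2 - x) / (1 - x)] and the derivative of [sin] at 0, which
    gives [pi]. *)
Lemma Gamma_reflection a : 0 < a < 1 ->
  Gamma_pos a * Gamma_pos (1 - a) * sin (pi * a) = pi.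
Proof.
move=> a01.
pose T x := Gamma_pos x * Gamma_pos (1 - x) * sin (pi * x).
pose e n : R := (1 - a) / 2 ^+ n.
have en n : 0 < e n < 1.
  case/andP: a01 => a0 a1; have a10 : 0 < 1 - a by rewrite subr_gt0.
  rewrite /e divr_gt0 ?exprn_gt0//= ltr_pdivrMr ?exprn_gt0// mul1r.
  by apply: (@lt_le_trans _ _ 1); [lra|rewrite exprn_ege1// ler1n].
have Te n : T a = T (1 - e n).
  elim: n => [|n ->]; first by rewrite /e expr0 divr1 subKr.
  rewrite /T reflection_step; last by have := en n; lra.
  have -> : (1 + (1 - e n)) / 2 = 1 - e n.+1; last by [].
  by rewrite /e exprS; field; rewrite expf_neq0.
have ec : e n @[n --> \oo] --> (0 : R).
  have -> : e = geometric (1 - a) 2^-1 by apply/funext => n; rewrite /e /geometric/= exprVn.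
  by apply: cvg_geometric; rewrite ger0_norm ?invr_ge0// invf_lt1// ltr1n.
have G1 x : 0 <= x <= 1 -> Gamma_pos (1 + x) <= 1.
  by move=> x01; have := Gamma_pos_le x01 (@ltr01 R); rewrite powR1 Gamma_pos1 mul1r.
have G2 x : 0 <= x <= 1 -> (1 + x) `^ (x - 1) <= Gamma_pos (1 + x).
  by move=> x01; have := Gamma_pos_ge x01 (@ltr01 R); rewrite Gamma_pos1 mul1r mulr1.
(* Wendel's bounds at [y = 1] squeeze [Gamma (1 + u)] between [(1 + u)^(u - 1)] and 1; the lower one
   tends to 1 exactly at the two limits needed, [l = 0] and [l = 1]. *)
have Gc (u : nat -> R) (l : R) : 0 <= l <= 1 -> (1 + l) `^ (l - 1) = 1 ->
    (forall n, 0 < u n < 1) -> u n @[n --> \oo] --> l ->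
    Gamma_pos (1 + u n) @[n --> \oo] --> (1 : R).
  move=> l01 l1 u01 ul.
  apply: (@squeeze_cvgr _ _ _ _ (fun n => (1 + u n) `^ (u n - 1)) (cst 1)).
  - apply: nearW => n; have /andP[h1 h2] := u01 n.
    by rewrite G2 ?G1 ?(ltW h1) ?(ltW h2).
  - rewrite -[X in _ --> X]l1.
    have l0 : 0 < 1 + l by case/andP: l01 => h _; rewrite ltr_pwDl.
    have E n : (1 + u n) `^ (u n - 1) = expR ((u n - 1) * ln (1 + u n)).
      by rewrite /powR gt_eqF//; have /andP[h _] := u01 n; rewrite addr_gt0.
    rewrite (funext E) /powR gt_eqF//.
    apply: continuous_cvg; first exact: continuous_expR.
    apply: cvgM; first by apply: cvgB => //; exact: cvg_cst.
    apply: continuous_cvg; first exact: continuous_ln.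
    by apply: cvgD => //; exact: cvg_cst.
  - exact: cvg_cst.
have Tn n : T (1 - e n) = Gamma_pos (1 + (1 - e n)) / (1 - e n) * Gamma_pos (1 + e n) *
    (sin (pi * e n) / e n).
  have /andP[h1 h2] := en n; have h3 : 0 < 1 - e n by rewrite subr_gt0.
  rewrite /T subKr (addrC _ (1 - e n)) (addrC _ (e n)) !Gamma_posS//.
  rewrite (_ : pi * (1 - e n) = pi - pi * e n); last by ring.
  rewrite sinB sinpi cospi mul0r sub0r mulN1r opprK.
  move: (Gamma_pos _) (Gamma_pos _) (sin _) => g h S.
  by field; rewrite !gt_eqF.
have sc : sin (pi * e n) / e n @[n --> \oo] --> (pi : R).
  have [dsin dE] := is_derive_sin (0 : R).
  have : (h^-1 *: (sin (h *: 1 + 0) - sin 0)) @[h --> (0:R)^'] --> cos 0.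
    by rewrite -dE; exact: dsin.
  rewrite cos0 sin0 => /cvgr_dnbhsP h.
  have : (pi * e n)^-1 *: (sin (pi * e n *: 1 + 0) - 0) @[n --> \oo] --> (1 : R).
    apply: (h (fun n => pi * e n)); split.
      by move=> n; have /andP[h1 _] := en n; rewrite mulf_neq0// gt_eqF ?pi_gt0.
    by rewrite -(mulr0 pi); exact: cvgMr.
  move=> /(@cvgMr _ _ _ _ _ (pi : R)); rewrite mulr1; apply: cvg_trans; apply: near_eq_cvg.
  apply: nearW => n; have /andP[h1 _] := en n.
  rewrite subr0 addr0 /GRing.scale/= mulr1.
  by rewrite invfM -mulrA mulVKf ?gt_eqF ?pi_gt0// mulrC.
have lim : T (1 - e n) @[n --> \oo] --> (pi : R).
  have ec1 : 1 - e n @[n --> \oo] --> (1 : R).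
    by rewrite -{2}(subr0 1); apply: cvgB => //; exact: cvg_cst.
  have l1 : Gamma_pos (1 + (1 - e n)) @[n --> \oo] --> (1 : R).
    apply: (Gc (fun n => 1 - e n) 1) => //.
    - by rewrite ler01 lexx.
    - by rewrite subrr powRr0.
    - by move=> n; have := en n; lra.
  have l2 : (1 - e n)^-1 @[n --> \oo] --> (1^-1 : R).
    by apply: cvgV => //; exact: oner_neq0.
  have l3 : Gamma_pos (1 + e n) @[n --> \oo] --> (1 : R).
    by apply: (Gc e 0) => //; rewrite ?ler01 ?lexx// addr0 powR1.
  have -> : (pi : R) = 1 * 1^-1 * 1 * pi by rewrite invr1 !mul1r.
  by rewrite (funext Tn); exact: (cvgM (cvgM (cvgM l1 l2) l3) sc).
have : (fun n => T (1 - e n)) = cst (T a) by apply/funext => n; rewrite -Te.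
by move=> E; move: lim; rewrite E => lim; apply: cvg_unique lim => //; exact: cvg_cst.
Qed.

End RotatedGamma.

(** * The product of sines, by roots of unity *)

Section SineProduct.
Variable R : realType.
Import mathcomp.real_closed.complex Normc.

Let z n : R[i] := Complex (cos (2 * pi / n.+1%:R)) (sin (2 * pi / n.+1%:R)).

Let z_exp n k : z n ^+ k = Complex (cos (2 * pi / n.+1%:R * k%:R)) (sin (2 * pi / n.+1%:R * k%:R)).
Proof.
elim: k => [|k ih]; first by rewrite expr0 mulr0 cos0 sin0.
rewrite exprS ih /z; set x := 2 * pi / n.+1%:R.
have -> : x * k.+1%:R = x + x * k%:R by rewrite -addn1 natrD; ring.
rewrite cosD sinD.
by apply/eqP; rewrite eq_complex /= eqxx [sin _ * cos _ + _]addrC eqxx.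
Qed.

Let normc_sub n k : (k <= n)%N ->
  normc (1 - z n ^+ k) = 2 * sin (pi * k%:R / n.+1%:R).
Proof.
move=> kn; rewrite z_exp; set x := pi * k%:R / n.+1%:R.
have -> : 2 * pi / n.+1%:R * k%:R = x *+ 2 by rewrite /x mulr2n; ring.
rewrite cos_mulr2n sin_mulr2n /=.
have -> : (1 - (cos x ^+ 2 *+ 2 - 1)) ^+ 2 + (0 - (cos x * sin x) *+ 2) ^+ 2 =
    (2 * sin x) ^+ 2.
  transitivity ((2 - 2 * cos x ^+ 2) ^+ 2 + 4 * cos x ^+ 2 * sin x ^+ 2); first by ring.
  by rewrite cos2sin2; ring.
rewrite sqrtr_sqr ger0_norm// mulr_ge0// sin_ge0_pi//.
rewrite /x -mulrA mulr_ge0 ?pi_ge0 ?divr_ge0//= ler_piMr ?pi_ge0//.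
by rewrite ler_pdivrMr// mul1r ler_nat ltnW.
Qed.

(** If the order [k] of [z n] were at most [n], then [1 - z^k = 0] would have modulus
    [2 sin(pi k / (n + 1)) > 0]. *)
Let z_prim n : n.+1.-primitive_root (z n).
Proof.
have zn1 : z n ^+ n.+1 = 1.
  rewrite z_exp divfK ?pnatr_eq0// mulrC mulr_natr cos2pi sin2pi.
  by [].
have [k pk kn] := prim_order_exists (ltn0Sn n) zn1.
suff -> : n.+1 = k by [].
have k0 := prim_order_gt0 pk; have := dvdn_leq (ltn0Sn n) kn.
rewrite leq_eqVlt => /predU1P[->//|kn'].
have := @normc_sub n k kn'; rewrite (prim_expr_order pk) subrr normc0 => /esym/eqP.
rewrite mulf_eq0 pnatr_eq0/= gt_eqF// sin_gt0_pi//.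
rewrite -mulrA mulr_gt0 ?pi_gt0 ?divr_gt0 ?ltr0n//= gtr_pMr ?pi_gt0//.
by rewrite ltr_pdivrMr// mul1r ltr_nat.
Qed.

(** Dividing [X^(n+1) - 1] by [X - 1] and evaluating at 1 gives the product of the [1 - z^k] on one
    side and [n + 1] on the other; the formula is the modulus of this. *)
Lemma prod_sin n : \prod_(k < n) (2 * sin (pi * k.+1%:R / n.+1%:R)) = n.+1%:R :> R.
Proof.
have F := factor_Xn_sub_1 (z_prim n).
rewrite big_ltn// expr0 subrX1 in F.
have {F} : \prod_(1 <= i < n.+1) ('X - (z n ^+ i)%:P) = \sum_(i < n.+1) 'X^i :> {poly R[i]}.
  have X1 : ('X - 1%:P : {poly R[i]}) != 0 by rewrite polyXsubC_eq0.
  exact: (mulfI X1).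
move=> /(congr1 (horner^~ 1)); rewrite horner_prod horner_sum.
under eq_bigr do rewrite hornerXsubC.
under [RHS]eq_bigr do rewrite hornerXn expr1n.
rewrite sumr_const card_ord big_add1 big_mkord => /(congr1 (@normc R)).
rewrite (_ : normc (1 *+ n.+1) = n.+1%:R); last first.
  rewrite -(rmorph_nat (real_complex R)) /= expr0n addr0 sqrtr_sqr ger0_norm//.
move=> E; rewrite -[RHS]E (big_morph (@normc R) (@normcM R) (@normc1 R)).
by apply: eq_bigr => k _; rewrite normc_sub.
Qed.

End SineProduct.

Opaque Gamma_pos Ipos pi.

(** * The reciprocal Gamma function on the whole line *)

Section ReciprocalGamma.
Variable R : realType.
Implicit Types (a x y : R).

(** The definition fixes the number of factors by a floor. By the functional equation an extra
    factor cancels, so any admissible [N] gives the same value; this freedom is what makes shifts of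
    [y] comparable. *)
Lemma rgammaE y N : 0 < y + N%:R ->
  rgamma y = (\prod_(k < N) (y + k%:R)) / Gamma_pos (y + N%:R).
Proof.
pose P N := (\prod_(k < N) (y + k%:R)) / Gamma_pos (y + N%:R).
have PS n : 0 < y + n%:R -> P n.+1 = P n.
  move=> yn; rewrite /P big_ord_recr/= -[n.+1%:R]natr1 addrA Gamma_posS// invfM.
  by rewrite mulrA mulfK// gt_eqF.
have PD n k : 0 < y + n%:R -> P (n + k)%N = P n.
  move=> yn; elim: k => [|k <-]; first by rewrite addn0.
  rewrite addnS PS//; apply: lt_le_trans yn _.
  by rewrite lerD2l ler_nat leq_addr.
have Pe n k : 0 < y + n%:R -> 0 < y + k%:R -> P n = P k.
  move=> yn yk; have [nk|/ltnW kn] := leqP n k.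
    by rewrite -(subnKC nk) PD.
  by rewrite -(subnKC kn) PD.
move=> yN; apply: Pe => //.
set f := Num.floor (- y).
have : - y < (f + 1)%:~R by rewrite floorD1_gt.
rewrite intrD mulr1z => h.
have h2 : f%:~R <= `|f|%N%:R :> R.
  by rewrite -[`|f|%N%:R]/((`|f|%N : int)%:~R) ler_int abszE ler_norm.
by rewrite -natr1; lra.
Qed.

Lemma rgamma_inv y : 0 < y -> rgamma y = (Gamma_pos y)^-1.
Proof. by move=> y0; rewrite (@rgammaE y 0) ?addr0// big_ord0 mul1r. Qed.

Lemma rgammaS y : rgamma y = y * rgamma (y + 1).
Proof.
have [N yN] : exists N, 0 < y + N%:R.
  exists (Num.truncn (- y)).+1.
  by rewrite addrC -ltrBlDr sub0r truncnS_gt.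
have yN1 : 0 < y + N.+1%:R by rewrite -natr1 addrA; exact: addr_gt0 yN ltr01.
have yN2 : 0 < y + 1 + N%:R by rewrite -addrA nat1r.
rewrite (rgammaE yN1) (rgammaE yN2) big_ord_recl/= addr0 -nat1r addrA mulrA.
congr (_ * _ / _); apply: eq_bigr => k _.
by rewrite /bump/= add1n -nat1r addrA.
Qed.

(** Turns each Wright coefficient into a convergent Gamma integral times a sine. Reflection gives
    [0 < a < 1], both sides vanish at [a = 1], and a unit shift of [a] multiplies both sides by the
    same factor. *)
Lemma rgamma_reflection a : 0 < a -> rgamma (1 - a) = Gamma_pos a * sin (pi * a) / pi.
Proof.
have base x : 0 < x <= 1 -> rgamma (1 - x) = Gamma_pos x * sin (pi * x) / pi.
  case/andP => x0; rewrite le_eqVlt => /predU1P[->|x1].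
    by rewrite subrr rgammaS mul0r mulr1 sinpi mulr0 mul0r.
  rewrite rgamma_inv ?subr_gt0//.
  have E := @Gamma_reflection R x; rewrite x0 x1 in E; have {}E := E isT.
  have g1 := Gamma_pos_gt0 x0; have g2 : 0 < Gamma_pos (1 - x) by apply: Gamma_pos_gt0; rewrite subr_gt0.
  have s0 : 0 < sin (pi * x) by rewrite sin_gt0_pi// mulr_gt0 ?pi_gt0//= gtr_pMr ?pi_gt0.
  move: (Gamma_pos x) (Gamma_pos (1 - x)) (sin _) g1 g2 s0 E => g h s g1 g2 s0 <-.
  by field; rewrite !gt_eqF.
have step n x : 0 < x <= 1 -> rgamma (1 - (x + n%:R)) =
    Gamma_pos (x + n%:R) * sin (pi * (x + n%:R)) / pi.
  move=> x01; have x0 : 0 < x by case/andP: x01.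
  elim: n => [|n ih]; first by rewrite addr0; exact: base.
  rewrite rgammaS -natr1 (addrA x) (_ : 1 - (x + n%:R + 1) + 1 = 1 - (x + n%:R)); last by ring.
  rewrite ih Gamma_posS; last by rewrite ltr_wpDr// ler0n.
  rewrite (mulrDr pi _ 1) mulr1 sinDpi.
  move: (Gamma_pos _) (sin _) => g s; ring.
move=> a0.
have [n [x [x01 ->]]] : exists n x, 0 < x <= 1 /\ a = x + n%:R.
  pose k := Num.truncn a.
  have h1 : k%:R <= a by rewrite truncn_le// ltW.
  have h2 : a < k.+1%:R by exact: truncnS_gt.
  move: h1; rewrite le_eqVlt => /predU1P[ka|ka]; last first.
    by exists k, (a - k%:R); rewrite subrK subr_gt0 ka; move: h2; rewrite -natr1; split=> //=; lra.
  have k0 : (0 < k)%N by rewrite -(ltr0n R) ka.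
  exists k.-1, 1; rewrite ltr01 lexx; split => //.
  by rewrite -ka -{1}(prednK k0) nat1r.
exact: step.
Qed.

End ReciprocalGamma.

(** * Gauss' multiplication formula *)

Section Multiplication.
Variable R : realType.
Implicit Types (a x y : R).

Lemma cvg_prod1 m (F : nat -> nat -> R) :
  (forall j, (j < m)%N -> F n j @[n --> \oo] --> (1 : R)) ->
  \prod_(j < m) F n j @[n --> \oo] --> (1 : R).
Proof.
elim: m => [|m ih] hF.
  by under eq_fun do rewrite big_ord0; exact: cvg_cst.
under eq_fun do rewrite big_ord_recr/=.
suff : \prod_(i < m) F n i * F n m @[n --> \oo] --> (1 * 1 : R) by rewrite mulr1.
apply: cvgM; last exact: hF.
by apply: ih => j jm; apply: hF; exact: ltnW.
Qed.

Lemma cvg_powR1 (c : R) (v : nat -> R) : v n @[n --> \oo] --> (1 : R) ->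
  v n `^ c @[n --> \oo] --> (1 : R).
Proof.
move=> v1; have := @continuous_powR R 1 c ltr01.
move=> /continuous_cvg /(_ v1); by rewrite powR1.
Qed.

Let W x y := Gamma_pos (y + x) / (y `^ x * Gamma_pos y).

(** After division, Wendel's inequalities read [(1 + x / u)^(x - 1) <= W x u <= 1]. *)
Let W_cvg x (u : nat -> R) : 0 <= x <= 1 -> (forall n, 0 < u n) ->
  (u n)^-1 @[n --> \oo] --> (0 : R) -> W x (u n) @[n --> \oo] --> (1 : R).
Proof.
move=> x01 u0 uc.
apply: (@squeeze_cvgr _ _ _ _ (fun n => (1 + x * (u n)^-1) `^ (x - 1)) (cst 1)).
- apply: nearW => n; rewrite /W.
  have g0 := Gamma_pos_gt0 (u0 n); have p0 : 0 < u n `^ x by rewrite powR_gt0.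
  rewrite ler_pdivlMr ?mulr_gt0// ler_pdivrMr ?mulr_gt0// mul1r.
  rewrite (Gamma_pos_le x01 (u0 n)) andbT.
  apply: le_trans (Gamma_pos_ge x01 (u0 n)).
  rewrite mulrA ler_wpM2r ?(ltW g0)//.
  have xu : 0 < 1 + x * (u n)^-1.
    by case/andP: x01 => x0 _; rewrite ltr_pwDl// mulr_ge0// invr_ge0 ltW.
  rewrite (_ : u n + x = (1 + x * (u n)^-1) * u n); last by field; rewrite gt_eqF.
  rewrite powRM ?(ltW xu) ?(ltW (u0 n))//.
  have -> : u n `^ x = u n * u n `^ (x - 1).
    rewrite -[X in X * _](powRr1 (ltW (u0 n))) -powRD_gt0//.
    by congr (_ `^ _); ring.
  by rewrite mulrCA.
- apply: cvg_powR1; rewrite -[X in _ --> X]addr0; apply: cvgD; first exact: cvg_cst.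
  by rewrite -(mulr0 x); exact: cvgMr.
- exact: cvg_cst.
Qed.

Variable m : nat.
Hypothesis m0 : (0 < m)%N.

Let mR : 0 < m%:R :> R. Proof. by rewrite ltr0n. Qed.

(* [Q] has period 1, and Wendel's inequalities force [Q (n + x)] and [Q n] to have the same limit. *)
Let Q x := m%:R `^ x * \prod_(j < m) Gamma_pos ((x + j%:R) / m%:R) / Gamma_pos x.

Let QS x : 0 < x -> Q (x + 1) = Q x.
Proof.
move=> x0; rewrite /Q.
have E : \prod_(j < m) Gamma_pos ((x + 1 + j%:R) / m%:R) =
   x / m%:R * \prod_(j < m) Gamma_pos ((x + j%:R) / m%:R).
  pose F j : R := Gamma_pos ((x + j%:R) / m%:R).
  have F0 j : F j != 0.
    by rewrite gt_eqF// Gamma_pos_gt0// divr_gt0// ltr_pwDl// ler0n.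
  have h : F 0%N * \prod_(j < m) Gamma_pos ((x + 1 + j%:R) / m%:R) =
      \prod_(j < m) F j * F m.
    rewrite -[RHS](big_ord_recr m (fun j => F (val j)))/= big_ord_recl; congr (_ * _).
    by apply: eq_bigr => j _; rewrite lift0 /F -nat1r addrA.
  apply: (mulfI (F0 0%N)); rewrite h mulrC mulrA; congr (_ * _).
  rewrite /F addr0 mulrDl divff ?gt_eqF// Gamma_posS ?divr_gt0// mulrC.
  by [].
rewrite E Gamma_posS// powRD_gt0// powRr1 ?(ltW mR)//.
have := Gamma_pos_gt0 x0; move: (Gamma_pos x) (\prod_(j < m) _) (_ `^ x) => g P M g0.
by field; rewrite !gt_eqF.
Qed.

Let QSn x n : 0 < x -> Q (n%:R + x) = Q x.
Proof.
move=> x0; elim: n => [|n <-]; first by rewrite add0r.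
by rewrite -natr1 (_ : n%:R + 1 + x = n%:R + x + 1) ?QS// ?ltr_wpDl//; ring.
Qed.

Let Q_const x : 0 < x <= 1 -> Q x = Q 1.
Proof.
move=> /andP[x0 x1].
pose N n : R := n.+1%:R.
have N0 n : 0 < N n by [].
have Nc : (N n)^-1 @[n --> \oo] --> (0 : R) by exact: cvg_harmonic.
(* This is [Gamma((N + x + j) / m) / Gamma((N + j) / m)] divided by [(N / m)^(x / m)]. Over the [m]
   values of [j] these powers multiply to [(N / m)^x], and with [m^x] they form the [N^x] hidden in
   [W x N]; what remains tends to 1. *)
pose A n j := W (x / m%:R) ((N n + j%:R) / m%:R) * (1 + j%:R * (N n)^-1) `^ (x / m%:R).
have Nj0 n j : 0 < (N n + j%:R) / m%:R by rewrite divr_gt0// ltr_pwDl// ler0n.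
have xm : 0 <= x / m%:R <= 1.
  by rewrite divr_ge0 ?(ltW x0)//= ler_pdivrMr// mul1r (le_trans x1)// ler1n.
have Ac j : (j < m)%N -> A n j @[n --> \oo] --> (1 : R).
  move=> jm; suff : A n j @[n --> \oo] --> (1 * 1 : R) by rewrite mulr1.
  have cj : 1 + j%:R * (N n)^-1 @[n --> \oo] --> (1 : R).
    rewrite -[X in _ --> X]addr0; apply: cvgD; first exact: cvg_cst.
    by rewrite -(mulr0 j%:R); exact: cvgMr.
  apply: cvgM; last exact: cvg_powR1.
  apply: (W_cvg xm (fun n => Nj0 n j)).
  have : m%:R * ((N n)^-1 * (1 + j%:R * (N n)^-1)^-1) @[n --> \oo] --> (m%:R * (0 * 1^-1) : R).
    by apply: cvgMr; apply: cvgM => //; apply: cvgV => //; exact: oner_neq0.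
  rewrite mul0r mulr0; apply: cvg_trans; apply: near_eq_cvg; apply: nearW => n.
  have h : 0 < N n + j%:R by rewrite ltr_pwDl// ler0n.
  by field; rewrite !gt_eqF.
have QE n : Q x = Q 1 * (\prod_(j < m) A n j / W x (N n)).
  rewrite -(QSn n.+1 x0) -/(N n) -[Q 1](QSn n ltr01) (_ : n%:R + 1 = N n) ?natr1//.
  rewrite /Q powRD_gt0//.
  have E : \prod_(j < m) Gamma_pos ((N n + x + j%:R) / m%:R) =
      \prod_(j < m) Gamma_pos ((N n + j%:R) / m%:R) * \prod_(j < m) A n j *
      (N n / m%:R) `^ x.
    have -> : (N n / m%:R) `^ x = \prod_(j < m) (N n / m%:R) `^ (x / m%:R).
      rewrite prodr_const card_ord -powR_mulrn ?powR_ge0// -powRrM divfK ?gt_eqF//.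
    rewrite -!big_split/=; apply: eq_bigr => j _.
    rewrite /A /W; set y := (N n + j%:R) / m%:R.
    have y0 : 0 < y by exact: Nj0.
    have yE : y = (1 + j%:R * (N n)^-1) * (N n / m%:R) by rewrite /y; field; rewrite !gt_eqF.
    have jn : 0 <= 1 + j%:R * (N n)^-1 by rewrite addr_ge0// mulr_ge0 ?ler0n// invr_ge0 ltW.
    have -> : (N n + x + j%:R) / m%:R = y + x / m%:R by rewrite /y; ring.
    have y1 : y `^ (x / m%:R) = (1 + j%:R * (N n)^-1) `^ (x / m%:R) * (N n / m%:R) `^ (x / m%:R).
      by rewrite yE; apply: powRM => //; exact: divr_ge0 (ltW (N0 n)) (ltW mR).
    have g0 := Gamma_pos_gt0 y0; have p0 : 0 < y `^ (x / m%:R) by rewrite powR_gt0.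
    rewrite -[LHS](@divfK _ (y `^ (x / m%:R) * Gamma_pos y)); last by rewrite mulf_neq0 ?gt_eqF.
    rewrite {2}y1; move: (Gamma_pos (y + _)) => G; ring.
  have mN : m%:R `^ x * (N n / m%:R) `^ x = N n `^ x.
    by rewrite -powRM ?ler0n ?divr_ge0// mulrC divfK// gt_eqF.
  have g0 := Gamma_pos_gt0 (N0 n).
  have g1 : 0 < Gamma_pos (N n + x) by rewrite Gamma_pos_gt0// addr_gt0.
  have p0 : 0 < N n `^ x by rewrite powR_gt0.
  rewrite E /W; set M1 := _ `^ N n; set P := \prod_(j < m) Gamma_pos _; set P2 := \prod_(j < m) A n j.
  transitivity (M1 * P * P2 * N n `^ x / Gamma_pos (N n + x)); first by rewrite -mN; ring.
  by move: (Gamma_pos _) (Gamma_pos _) (_ `^ x) g0 g1 p0 => g h p g0 g1 p0; field; rewrite !gt_eqF.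
have lim : Q 1 * (\prod_(j < m) A n j / W x (N n)) @[n --> \oo] --> Q 1 * (1 * 1^-1).
  apply: cvgMr; apply: cvgM; first exact: cvg_prod1.
  apply: cvgV; first exact: oner_neq0.
  by apply: W_cvg => //; rewrite (ltW x0) x1.
rewrite invr1 !mulr1 in lim.
apply: cvg_unique lim => //.
have -> : (fun n => Q 1 * (\prod_(j < m) A n j / W x (N n))) = cst (Q x).
  by apply/funext => n; rewrite -QE.
exact: cvg_cst.
Qed.

(* Squaring pairs [j] with [m - j], so that the reflection formula applies to each factor. *)
Lemma prod_Gamma_rational :
  \prod_(j < m) Gamma_pos ((1 + j%:R) / m%:R) = (2 * pi) `^ ((m%:R - 1) / 2) / m%:R `^ 2^-1 :> R.
Proof.
have [n mE] : exists n, m = n.+1 by exists m.-1; rewrite prednK.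
rewrite mE big_ord_recr/= nat1r divff ?pnatr_eq0// Gamma_pos1 mulr1.
set P := \prod_(j < n) _.
have g0 (j : 'I_n) : 0 < ((1 + j%:R) / n.+1%:R : R) < 1.
  by rewrite nat1r divr_gt0//= ltr_pdivrMr// mul1r ltr_nat ltnS.
have P0 : 0 <= P by apply: prodr_ge0 => j _; apply/ltW/Gamma_pos_gt0; case/andP: (g0 j).
have PP : P * P = (2 * pi) ^+ n / n.+1%:R.
  rewrite {2}/P (reindex_inj rev_ord_inj)/= /P -big_split/=.
  rewrite -[X in _ = _ / X](prod_sin R n) -[X in _ ^+ X / _]card_ord -prodr_const -prodf_div.
  apply: eq_bigr => j _.
  have -> : (1 + (n - j.+1)%:R) / n.+1%:R = 1 - (1 + j%:R) / n.+1%:R :> R.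
    rewrite natrB ?ltn_ord// -[j.+1%:R]nat1r -[n.+1%:R]nat1r; field.
    by rewrite nat1r pnatr_eq0.
  have E := Gamma_reflection (g0 j).
  have -> : pi * j.+1%:R / n.+1%:R = pi * ((1 + j%:R) / n.+1%:R) :> R.
    by rewrite nat1r mulrA.
  have s0 : 0 < sin (pi * ((1 + j%:R) / n.+1%:R)) :> R.
    case/andP: (g0 j) => h1 h2.
    by rewrite sin_gt0_pi// mulr_gt0 ?pi_gt0//= gtr_pMr ?pi_gt0.
  move: s0 E; move: (sin _) (Gamma_pos _) (Gamma_pos _) => S g h s0 <-.
  by field; rewrite gt_eqF.
apply/eqP; rewrite -(@eqrXn2 _ 2)//; last by rewrite divr_ge0 ?powR_ge0.
have e1 : ((2 * pi) `^ ((n.+1%:R - 1) / 2)) ^+ 2 = (2 * pi) ^+ n :> R.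
  by rewrite -powR_mulrn ?powR_ge0// -powRrM divfK// -[n.+1%:R]natr1 addrK powR_mulrn// mulr_ge0 ?pi_ge0.
have e2 : (n.+1%:R `^ 2^-1) ^+ 2 = n.+1%:R :> R.
  by rewrite -powR_mulrn ?powR_ge0// -powRrM mulVf// powRr1.
by rewrite expr2 PP expr_div_n e1 e2.
Qed.

Lemma Gamma_multiplication x : 0 < x <= 1 ->
  \prod_(j < m) Gamma_pos ((x + j%:R) / m%:R) =
  (2 * pi) `^ ((m%:R - 1) / 2) * m%:R `^ (2^-1 - x) * Gamma_pos x.
Proof.
move=> x01; have x0 : 0 < x by case/andP: x01.
have : Q x = m%:R * ((2 * pi) `^ ((m%:R - 1) / 2) / m%:R `^ 2^-1).
  by rewrite (Q_const x01) /Q prod_Gamma_rational Gamma_pos1 divr1 (powRr1 (ltW mR)).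
rewrite /Q.
have g0 := Gamma_pos_gt0 x0; have p0 : 0 < m%:R `^ x :> R by rewrite powR_gt0.
have -> : m%:R `^ (2^-1 - x) = m%:R * (m%:R `^ 2^-1)^-1 / m%:R `^ x :> R.
  rewrite -!powRN -{2}(powRr1 (ltW mR)) -!powRD_gt0//; congr (_ `^ _).
  by field.
move: p0 g0; move: (\prod_(j < m) _) (m%:R `^ x) (Gamma_pos x) => P p g p0 g0.
move: ((2 * pi) `^ _) (_ `^ 2^-1) => A B E.
have -> : A * (m%:R * B^-1 / p) * g = m%:R * (A / B) * (g / p) by ring.
by rewrite -E; field; rewrite !gt_eqF.
Qed.

End Multiplication.

(** * Power series of an exponential times a sine, with a uniform remainder bound *)

Section SineExponentialSeries.
Variable R : realType.
Implicit Types x psi chi : R.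

Let T (c : nat -> R) n x := \sum_(k < n) x ^+ k / k`!%:R * c k.

Let is_derive_T c n x : is_derive x 1 (T c n.+1) (T (c \o S) n x).
Proof.
elim: n => [|n ih].
  have -> : T c 1 = cst (c 0%N).
    by apply/funext => y; rewrite /T big_ord_recl big_ord0 expr0 fact0 divr1 mul1r addr0.
  by rewrite /T big_ord0; exact: is_derive_cst.
have -> : T c n.+2 = (fun y => T c n.+1 y + y ^+ n.+1 / n.+1`!%:R * c n.+1).
  by apply/funext => y; rewrite /T big_ord_recr.
have hX : is_derive x 1 (fun y : R => y ^+ n.+1) (n.+1%:R * x ^+ n).
  have -> : (fun y : R => y ^+ n.+1) = id ^+ n.+1 by rewrite exprfctE.
  by apply: is_derive_eq; rewrite /GRing.scale/= mulr1.
apply: is_derive_eq.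
rewrite [in RHS]/T big_ord_recr/= -/(T (c \o S) n x); congr (_ + _).
have h1 : n`!%:R != 0 :> R by rewrite pnatr_eq0 -lt0n fact_gt0.
have h2 : n.+1%:R != 0 :> R by rewrite pnatr_eq0.
rewrite /GRing.scale/= factS natrM; field.
by rewrite h1 nat1r h2.
Qed.

Let T0 c n : T c n.+1 0 = c 0%N.
Proof.
rewrite /T big_ord_recl expr0 fact0 divr1 mul1r big1 ?addr0// => i _.
by rewrite lift0 expr0n/= !mul0r.
Qed.

Let B n x := expR x - T (fun=> 1) n x.

(** The imaginary part of [exp(i psi + x exp(i chi))]; differentiating in [x] only rotates the phase
    [psi] by [chi]. *)
Let f psi chi x := expR (x * cos chi) * sin (psi + x * sin chi).

Let is_derive_f psi chi x : is_derive x 1 (f psi chi) (f (psi + chi) chi x).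
Proof.
rewrite /f; apply: is_derive_eq.
rewrite (_ : psi + chi + x * sin chi = (psi + x * sin chi) + chi); last by ring.
by rewrite (sinD _ chi) /GRing.scale/=; ring.
Qed.

Lemma sum_pow_fact_le n x : 0 <= x -> \sum_(k < n) x ^+ k / k`!%:R <= expR x.
Proof.
move=> x0; have := is_cvg_series_exp_coeff x => h.
rewrite [leRHS](_ : _ = limn (series (exp_coeff x)))//.
have nd : nondecreasing_seq (series (exp_coeff x)).
  by apply/nondecreasing_seqP => k; rewrite seriesSr lerDl/= /exp_coeff divr_ge0 ?exprn_ge0.
apply: le_trans (nondecreasing_cvgn_le nd h n).
by rewrite /series/= big_mkord.
Qed.

(** Induction on [n]: the remainder of [f] and that of the exponential both vanish at 0, and their
    derivatives are the remainders of order [n], the former with phase [psi + chi]. Monotonicity of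
    the sum and the difference carries the bound up one order. *)
Lemma exp_sin_series_le n psi chi x : 0 <= x ->
  `|f psi chi x - \sum_(k < n) x ^+ k / k`!%:R * sin (psi + k%:R * chi)|
  <= expR x - \sum_(k < n) x ^+ k / k`!%:R.
Proof.
have -> : \sum_(k < n) x ^+ k / k`!%:R = T (fun=> 1) n x.
  by apply: eq_bigr => k _; rewrite mulr1.
rewrite -/(B n x) -/(T (fun k => sin (psi + k%:R * chi)) n x).
elim: n psi x => [|n ih] psi x x0.
  rewrite /B /T !big_ord0 !subr0 /f normrM (ger0_norm (expR_ge0 _)).
  rewrite -[leRHS]mulr1 ler_pM ?expR_ge0 ?sin_max// ler_expR.
  by rewrite -[leRHS]mulr1 ler_wpM2l// cos_le1.
set d := fun x => f psi chi x - T (fun k => sin (psi + k%:R * chi)) n.+1 x.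
pose d' x := f (psi + chi) chi x - T (fun k => sin ((psi + chi) + k%:R * chi)) n x.
have dd (z : R) : is_derive z 1 d (d' z).
  have h1 := is_derive_f psi chi z.
  have h2 := is_derive_T (fun k => sin (psi + k%:R * chi)) n z.
  apply: is_derive_eq; rewrite /d'; congr (_ - _).
  by apply: eq_bigr => k _ /=; rewrite -nat1r; congr (_ * sin _); ring.
have dB (z : R) : is_derive z 1 (B n.+1) (B n z).
  by have h := is_derive_T (fun=> 1) n z; apply: is_derive_eq.
have d0 : d 0 = 0 by rewrite /d T0 /f !mul0r expR0 mul1r !addr0 subrr.
have B0 : B n.+1 0 = 0 by rewrite /B T0 expR0 subrr.
have mono (h h' : R -> R) : (forall z : R, is_derive z 1 h (h' z)) ->
    (forall z, 0 <= z -> 0 <= h' z) -> h 0 = 0 -> 0 <= h x.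
  move=> dh h'0 h0; rewrite -h0.
  have := @ger0_derive1_ndecr R h 0 x; apply => //.
  - move=> z; rewrite in_itv/= => /andP[z0 _].
    rewrite derive1E; have -> := @derive_val _ _ _ _ _ _ _ (dh z).
    by rewrite h'0 ?(ltW z0).
  - apply: continuous_in_subspaceT => z _.
    exact: is_derive_continuous (dh z).
have ih' z : 0 <= z -> - B n z <= d' z <= B n z.
  by move=> z0; rewrite -ler_norml; exact: ih.
rewrite -/(d x) ler_norml; apply/andP; split.
  rewrite -subr_ge0 opprK; apply: (mono (fun x => d x + B n.+1 x) (fun x => d' x + B n x)).
  - by move=> z /ih' /andP[h _]; rewrite -(opprK (B n z)) subr_ge0.
  - by rewrite d0 B0 addr0.
rewrite -subr_ge0; apply: (mono (fun x => B n.+1 x - d x) (fun x => B n x - d' x)).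
- by move=> z /ih' /andP[_ h]; rewrite subr_ge0.
- by rewrite d0 B0 subrr.
Qed.

Lemma exp_sin_series_cvg psi chi x : 0 <= x ->
  (\sum_(k < n) x ^+ k / k`!%:R * sin (psi + k%:R * chi)) @[n --> \oo] -->
  expR (x * cos chi) * sin (psi + x * sin chi).
Proof.
move=> x0; have h := is_cvg_series_exp_coeff x.
have hB : expR x - \sum_(k < n) x ^+ k / k`!%:R @[n --> \oo] --> (0 : R).
  suff : expR x - \sum_(k < n) x ^+ k / k`!%:R @[n --> \oo] --> expR x - expR x by rewrite subrr.
  apply: cvgB; first exact: cvg_cst.
  have -> : (fun n => \sum_(k < n) x ^+ k / k`!%:R) = series (exp_coeff x).
    by apply/funext => n; rewrite /series/= big_mkord.
  exact: h.
apply/subr_cvg0; apply: norm_cvg0.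
apply: (@squeeze_cvgr _ _ _ _ (cst 0) _ _ _ _ _ hB); last exact: cvg_cst.
by apply: nearW => n; rewrite normr_ge0/= distrC; exact: exp_sin_series_le.
Qed.

End SineExponentialSeries.

(** * The Wright function: integral representation, boundedness, Mellin transform *)

Section WrightFunction.
Variable R : realType.
Notation mu := (@lebesgue_measure R).
Notation D := (`]0%R, +oo[%classic : set R).
Implicit Types (a x y r p psi : R).

Definition wright_term (b y : R) (k : nat) : R :=
  (- y) ^+ k / k`!%:R * rgamma (1 - b * k.+1%:R).

Definition wright (b y : R) : R := limn (series (wright_term b y)).

Lemma mul_powR_le_linear (b d y : R) : 0 < b < 1 -> 0 < d -> 0 <= y ->
  exists C : R, forall r : R, 0 < r -> y * r `^ b <= d * r + C.
Proof.
move=> /andP[b0 b1] d0 y0.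
(* The concave power is bounded by its tangent at [K], chosen so that [K^(b - 1) = q]; the slope is
   then [y * b * q], at most [d]. The [+ 1] covers [y = 0]. *)
pose q := d / (y + 1); have q0 : 0 < q by rewrite divr_gt0// ltr_wpDl.
pose K := q `^ (b - 1)^-1; have K0 : 0 < K by rewrite powR_gt0.
have b10 : b - 1 != 0 by rewrite subr_eq0 lt_eqF.
have KE : K `^ (b - 1) = q by rewrite /K -powRrM mulVf// powRr1// ltW.
exists (y * (K `^ b * (1 - b))) => r r0.
have rK0 : 0 < r / K by rewrite divr_gt0.
rewrite -{1}(divfK (lt0r_neq0 K0) r) powRM ?(ltW K0) ?(ltW rK0)//.
have h : (r / K) `^ b <= 1 - b + b * (r / K).
  by apply: powR_le_tangent; rewrite // !ltW.
apply: (@le_trans _ _ (y * ((1 - b + b * (r / K)) * K `^ b))).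
  by rewrite ler_wpM2l// ler_wpM2r// powR_ge0.
have -> : y * ((1 - b + b * (r / K)) * K `^ b) =
   y * b * (K `^ b / K) * r + y * (K `^ b * (1 - b)) by field; rewrite gt_eqF.
rewrite lerD2r; have -> : K `^ b / K = q.
  by rewrite -KE powRD_gt0// powRN powRr1// ltW.
rewrite ler_wpM2r ?(ltW r0)// /q.
have y1 : 0 < y + 1 by rewrite ltr_wpDl.
rewrite mulrA ler_pdivrMr//.
have := mulr_ge0 (mulr_ge0 (ltW d0) y0) (_ : 0 <= 1 - b).
by rewrite subr_ge0 (ltW b1) => /(_ isT); nra.
Qed.

Section representation.
Variable b : R.
Hypothesis b01 : 0 < b < 1.

Let b0 : 0 < b. Proof. by case/andP: b01. Qed.

(** The solution of [kappa + b * kappa = pi * b]. On the ray of angle [- kappa] the terms in [r] and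
    in [r^b] then carry opposite phases, so both decay at rate [cos kappa], positive because [b < 1]
    forces [kappa < pi / 2]. *)
Definition wright_angle : R := pi * b / (1 + b).
Local Notation kappa := wright_angle.

Let kappa_lt : 0 < kappa /\ kappa < pi / 2.
Proof.
have pi0 := pi_gt0 R; have b1 : 0 < 1 + b by rewrite addr_gt0.
rewrite /kappa divr_gt0 ?mulr_gt0//; split => //.
rewrite ltr_pdivrMr//; move: (pi) pi0 => P P0.
have : 0 < P * (1 - b) by rewrite mulr_gt0// subr_gt0; case/andP: b01.
by rewrite mulrBr; lra.
Qed.

Let cos_kappa : 0 < cos kappa.
Proof. by have [h1 h2] := kappa_lt; rewrite cos_gt0_pihalf// h2 andbT; lra. Qed.

Let kappaE : kappa + b * kappa = pi * b.
Proof.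
rewrite /kappa; have b1 : 1 + b != 0 by rewrite gt_eqF// addr_gt0.
move: (pi : R) => P; by field.
Qed.

Definition wright_kernel y r : R := r `^ (b - 1) *
  expR (- (cos kappa * (r + y * r `^ b))) * sin (kappa + sin kappa * (r - y * r `^ b)).
Local Notation g := wright_kernel.

Let weight_int : intpos (fun r => r `^ (b - 1) * expR (- (r * cos kappa))).
Proof. exact: intpos_powR_expR. Qed.

Let norm_kernel y r : 0 <= y -> 0 < r ->
  `|g y r| <= r `^ (b - 1) * expR (- (r * cos kappa)) .
Proof.
move=> y0 r0; rewrite /g !normrM (ger0_norm (powR_ge0 _ _)) (ger0_norm (expR_ge0 _)).
rewrite -[leRHS]mulr1 ler_pM ?mulr_ge0 ?powR_ge0 ?expR_ge0 ?sin_max//.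
rewrite ler_wpM2l ?powR_ge0// ler_expR lerN2 mulrC ler_wpM2l ?(ltW cos_kappa)//.
by rewrite lerDl mulr_ge0 ?powR_ge0.
Qed.

Let continuous_kernel y r : 0 < r -> {for r, continuous (g y)}.
Proof.
move=> r0; have h1 := is_derive1_powR (b - 1) r0; have h2 := is_derive1_powR b r0.
exact: is_derive_continuous.
Qed.

Lemma intpos_wright_kernel y : 0 <= y -> intpos (g y).
Proof.
move=> y0; apply: le_intpos weight_int _; last by move=> r; exact: norm_kernel.
by apply: mpos_continuous => r; exact: continuous_kernel.
Qed.

(** A rotated Gamma integral of exponent [b (k + 1)] with total phase
    [(k + 1)(kappa + b kappa) = pi b (k + 1)], which is exactly the sine in the reflection formula
    for [rgamma]. The sign [(-1)^k] comes from the shift by [k pi]. *)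
Let termE y k : 0 <= y -> 
  intpos (fun r => r `^ (b - 1) * expR (- (r * cos kappa)) *
    ((y * r `^ b) ^+ k / k`!%:R * sin (kappa + r * sin kappa + k%:R * (kappa + pi)))) /\
  pi * wright_term b y k =
  Ipos (fun r => r `^ (b - 1) * expR (- (r * cos kappa)) *
    ((y * r `^ b) ^+ k / k`!%:R * sin (kappa + r * sin kappa + k%:R * (kappa + pi)))).
Proof.
move=> y0; have [k0 k1] := kappa_lt; have pi0 := pi_gt0 R.
pose a := b * k.+1%:R; have a0 : 0 < a by rewrite mulr_gt0.
pose h r := r `^ (a - 1) * expR (- (r * (1 * cos (- kappa)))) *
  sin (k.+1%:R * kappa - r * (1 * sin (- kappa))).
have hi : intpos h by apply: intpos_rotated => //; lra.
have sink x : sin (x + k%:R * pi) = (-1) ^+ k * sin x.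
  elim: {+}k => [|j ih]; first by rewrite mul0r addr0 expr0 mul1r.
  by rewrite -natr1 mulrDl mul1r addrA sinDpi ih exprS; ring.
have E r : 0 < r -> r `^ (b - 1) * expR (- (r * cos kappa)) *
    ((y * r `^ b) ^+ k / k`!%:R * sin (kappa + r * sin kappa + k%:R * (kappa + pi))) =
    (- y) ^+ k / k`!%:R * h r.
  move=> r0; rewrite /h cosN sinN.
  have -> : kappa + r * sin kappa + k%:R * (kappa + pi) =
      k.+1%:R * kappa - r * (1 * - sin kappa) + k%:R * pi.
    by rewrite -nat1r; ring.
  rewrite sink !mul1r (_ : a - 1 = b - 1 + b * k%:R); last by rewrite /a -nat1r; ring.
  rewrite (@powRD_gt0 _ r (b - 1) (b * k%:R))// powRrM powR_mulrn ?powR_ge0//.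
  rewrite exprMn (_ : (- y) ^+ k = (-1) ^+ k * y ^+ k); last by rewrite -exprMn mulN1r.
  move: ((-1) ^+ k) (sin _) (expR _) (_^-1) => A B C E; ring.
split; first by apply: eq_intpos (intposZ _ hi) => r r0; rewrite E.
rewrite (eq_Ipos E) (IposZ _ hi) Ipos_rotated//; [|lra|lra].
rewrite powR1 mul1r /wright_term rgamma_reflection//.
have -> : k.+1%:R * kappa - a * - kappa = pi * a.
  by rewrite /a mulrA -kappaE; ring.
move: (Gamma_pos _) (sin _) (_ / _) => G s c.
by rewrite mulrCA; congr (_ * _); rewrite mulrCA divff ?mulr1// gt_eqF.
Qed.

(** Termwise integration is legitimate here: the partial sums are at most [exp(y r^b)], and since
    [b < 1] half of the decay [exp(- r cos kappa)] absorbs this growth. The angle [kappa + pi] of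
    the series turns its sum into a decaying exponential in [y r^b]. *)
Lemma wright_term_sum_cvg y : 0 <= y ->
  series (wright_term b y) @ \oo --> pi^-1 * Ipos (g y).
Proof.
move=> y0.
pose F n r := r `^ (b - 1) * expR (- (r * cos kappa)) *
  \sum_(k < n) (y * r `^ b) ^+ k / k`!%:R * sin (kappa + r * sin kappa + k%:R * (kappa + pi)).
have FE n r : F n r = \sum_(k < n) (r `^ (b - 1) * expR (- (r * cos kappa)) *
    ((y * r `^ b) ^+ k / k`!%:R * sin (kappa + r * sin kappa + k%:R * (kappa + pi)))).
  by rewrite /F big_distrr.
have sE : series (wright_term b y) = (fun n => pi^-1 * Ipos (F n)).
  apply/funext => n; rewrite /series/= big_mkord.
  rewrite (eq_Ipos (fun r _ => FE n r)).
  rewrite (Ipos_sum (index_enum 'I_n) (fun k => (termE k y0).1)).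
  rewrite big_distrr/=; apply: eq_bigr => k _.
  by rewrite -(termE k y0).2 mulKf// gt_eqF ?pi_gt0.
rewrite sE; apply: cvgMr.
have [C hC] := mul_powR_le_linear b01 (divr_gt0 cos_kappa (ltr0Sn _ 1)) y0.
have dom : intpos (fun r => expR C * (r `^ (b - 1) * expR (- (r * (cos kappa / 2))))).
  by apply: intposZ; apply: intpos_powR_expR => //; rewrite divr_gt0.
have mF n : mpos (F n).
  apply: (eq_mpos (fun r _ => esym (FE n r))).
  by apply: intpos_mpos; apply: intpos_sum => k; exact: (termE k y0).1.
have cF r : 0 < r -> F n r @[n --> \oo] --> g y r.
  move=> r0; have yr : 0 <= y * r `^ b by rewrite mulr_ge0 ?powR_ge0.
  have := @exp_sin_series_cvg R (kappa + r * sin kappa) (kappa + pi) _ yr.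
  move=> /(@cvgMr _ _ _ _ _ (r `^ (b - 1) * expR (- (r * cos kappa)))).
  rewrite cosDpi sinDpi /g.
  have -> : expR (- (cos kappa * (r + y * r `^ b))) =
     expR (- (r * cos kappa)) * expR (y * r `^ b * - cos kappa).
    by rewrite -expRD; congr expR; ring.
  have -> : kappa + sin kappa * (r - y * r `^ b) = kappa + r * sin kappa + y * r `^ b * - sin kappa.
    by ring.
  by rewrite !mulrA.
have bF n r : 0 < r -> `|F n r| <= expR C * (r `^ (b - 1) * expR (- (r * (cos kappa / 2)))).
  move=> r0; have yr : 0 <= y * r `^ b by rewrite mulr_ge0 ?powR_ge0.
  rewrite /F normrM ger0_norm ?mulr_ge0 ?powR_ge0 ?expR_ge0//.
  have h : `|\sum_(k < n) (y * r `^ b) ^+ k / k`!%:R *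
      sin (kappa + r * sin kappa + k%:R * (kappa + pi))| <= expR (y * r `^ b).
    apply: le_trans (sum_pow_fact_le n yr).
    apply: (le_trans (ler_norm_sum _ _ _)); apply: ler_sum => k _.
    have t0 : 0 <= (y * r `^ b) ^+ k / k`!%:R by rewrite divr_ge0 ?exprn_ge0.
    by rewrite normrM (ger0_norm t0) ler_piMr// sin_max.
  apply: (le_trans (ler_wpM2l _ h)); first by rewrite mulr_ge0 ?powR_ge0 ?expR_ge0.
  rewrite mulrCA -!mulrA ler_wpM2l ?powR_ge0// -!expRD ler_expR.
  by have := hC r r0; lra.
exact: (dct_pos mF cF dom bF).2.
Qed.

Lemma wrightE y : 0 <= y -> wright b y = pi^-1 * Ipos (g y).
Proof. by move=> y0; apply: cvg_lim (wright_term_sum_cvg y0). Qed.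

Lemma wright0 : wright b 0 = (Gamma_pos (1 - b))^-1.
Proof.
have [k0 k1] := kappa_lt; have pi0 := pi_gt0 R.
rewrite wrightE// -rgamma_inv; last by case/andP: b01; rewrite subr_gt0.
rewrite rgamma_reflection//.
have -> : Ipos (g 0) = Gamma_pos b * sin (pi * b).
  have := Ipos_rotated kappa b0 _ _ ltr01 (phi := - kappa).
  rewrite powR1 mul1r mulrN opprK kappaE => <-; [|lra|lra].
  apply: eq_Ipos => r r0; rewrite /g !mul0r addr0 subr0 cosN sinN !mul1r mulrN opprK.
  by rewrite [cos _ * _]mulrC [sin _ * _]mulrC.
by rewrite mulrC.
Qed.

Lemma norm_wright_le : exists2 C : R, 0 < C & forall y, 0 <= y -> `|wright b y| <= C.
Proof.
pose C := pi^-1 * (Ipos (fun r => r `^ (b - 1) * expR (- (r * cos kappa)))).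
exists (`|C| + 1); first by rewrite ltr_wpDl.
move=> y y0; apply: (@le_trans _ _ C); last by rewrite (le_trans (ler_norm _))// lerDl.
rewrite wrightE// normrM ger0_norm ?invr_ge0 ?pi_ge0//.
rewrite ler_wpM2l ?invr_ge0 ?pi_ge0//.
apply: le_norm_Ipos => //; first by apply: intpos_mpos; exact: intpos_wright_kernel.
by move=> r; exact: norm_kernel.
Qed.

(** The representation holds for nonnegative arguments only, and the solution depends on [|x|]; in
    this form continuity includes [y = 0], as needed when integrating over the whole line. *)
Lemma continuous_wright_norm y : {for y, continuous (fun y : R => wright b `|y|)}.
Proof.
have c : {in `](y - 1), (y + 1)[%classic, continuous (fun y : R => Ipos (g `|y|))}.
  apply: (@continuity_under_integral _ _ _ mu (fun y : R => g `|y|) D _ (y - 1) (y + 1) _ _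
     (fun r => r `^ (b - 1) * expR (- (r * cos kappa))) weight_int) => //.
  - by move=> z _; apply: intpos_wright_kernel.
  - apply/aeW => r rD z _; have r0 : 0 < r by rewrite -inD.
    apply: (@continuous_comp _ _ _ (fun z : R => `|z|) (fun z : R => g z r)); first exact: norm_continuous.
    exact: is_derive_continuous.
  - by move=> z _; apply/aeW => r rD; apply: norm_kernel; rewrite // -inD.
have yI : y \in (`](y - 1), (y + 1)[%classic : set R).
  by rewrite inE /= in_itv/=; apply/andP; split; lra.
have -> : (fun y : R => wright b `|y|) = (fun y : R => pi^-1 * Ipos (g `|y|)).
  by apply/funext => z; exact: wrightE.
by apply: continuousM; [exact: cst_continuous|exact: c].
Qed.

Lemma continuous_wright y : 0 < y -> {for y, continuous (wright b)}.
Proof.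
move=> y0; have := @continuous_wright_norm y.
rewrite /prop_for /continuous_at (gtr0_norm y0); apply: cvg_trans.
apply: near_eq_cvg; near=> z; rewrite gtr0_norm//.
by near: z; exact: lt_nbhsr.
Unshelve. all: by end_near. Qed.

(** Insert the representation and swap. The integral over [y] is a rotated Gamma integral with
    exponent [1 - p] and scale [r^b], the remaining one over [r] has exponent [b p]; the phases add
    up to [p kappa + b p kappa = pi b p], and reflection turns [Gamma(b p) sin(pi b p)] into
    [pi / Gamma(1 - b p)]. *)
Lemma wright_Mellin p : 0 < p < 1 ->
  intpos (fun y => y `^ (- p) * wright b y) /\
  Ipos (fun y => y `^ (- p) * wright b y) = Gamma_pos (1 - p) / Gamma_pos (1 - b * p).
Proof.
move=> /andP[p0 p1]; have [k0 k1] := kappa_lt; have pi0 := pi_gt0 R.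
have can_pi (P c I : R) : 0 < P -> c * I = P * (c * (P^-1 * I)).
  by move=> P0; rewrite (mulrCA c) mulVKf// gt_eqF.
have q0 : 0 < 1 - p by rewrite subr_gt0.
have pE : - p = (1 - p) - 1 by ring.
have bp0 : 0 < b * p by rewrite mulr_gt0.
have L1 : - (pi / 2) < - kappa by lra.
have L2 : - kappa < pi / 2 by lra.
have bp1 : b * p < 1 by case/andP: b01 => _ b1; apply: (le_lt_trans _ p1); rewrite ler_piMl ?(ltW p0)// ltW.
have GR := @Gamma_reflection R (b * p) (introT andP (conj bp0 bp1)).
have G1 : 0 < Gamma_pos (1 - b * p) by apply: Gamma_pos_gt0; rewrite subr_gt0.
pose f r y := y `^ (- p) * g y r.
pose psi r := kappa + r * sin kappa.
pose h r y := y `^ ((1 - p) - 1) * expR (- (y * (r `^ b * cos kappa))) *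
  sin (psi r - y * (r `^ b * sin kappa)).
have fE r y : f r y = r `^ (b - 1) * expR (- (r * cos kappa)) * h r y.
  rewrite /f /h /g /psi -pE.
  have -> : expR (- (cos kappa * (r + y * r `^ b))) =
     expR (- (r * cos kappa)) * expR (- (y * (r `^ b * cos kappa))).
    by rewrite -expRD; congr expR; ring.
  have -> : kappa + sin kappa * (r - y * r `^ b) =
     kappa + r * sin kappa - y * (r `^ b * sin kappa) by ring.
  by move: (y `^ _) (expR _) (expR _) (sin _) => A B C E; ring.
have hint r : 0 < r -> intpos (h r).
  by move=> r0; apply: intpos_rotated; rewrite ?powR_gt0//; lra.
have hI r : 0 < r -> Ipos (h r) =
    (r `^ b) `^ (- (1 - p)) * Gamma_pos (1 - p) * sin (psi r - (1 - p) * kappa).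
  by move=> r0; apply: Ipos_rotated; rewrite ?powR_gt0//; lra.
have bpE : b - 1 + b * - (1 - p) = b * p - 1 by ring.
pose H r := Gamma_pos (1 - p) * cos kappa `^ (- (1 - p)) *
   (r `^ (b * p - 1) * expR (- (r * cos kappa))).
have [||||E i1 i2] := @Fubini_pos R f H.
- apply: mpos2M; last apply: mpos2M; first last.
  + apply: measurableT_comp; first exact: measurable_sin.
    apply: measurable_funD; first exact: measurable_cst.
    apply: measurable_funM; first exact: measurable_cst.
    apply: measurable_funB; first exact: (mpos2_fst (mposT (@measurable_id _ _ _))).
    apply: measurable_funM; first exact: (mpos2_snd (mposT (@measurable_id _ _ _))).
    exact: (mpos2_fst (mposT (@measurable_powR R b))).
  + apply: measurable_funM; first exact: (mpos2_fst (mposT (@measurable_powR R _))).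
    apply: measurableT_comp; first exact: measurable_expR.
    apply: measurableT_comp => //.
    apply: measurable_funM; first exact: measurable_cst.
    apply: measurable_funD; first exact: (mpos2_fst (mposT (@measurable_id _ _ _))).
    apply: measurable_funM; first exact: (mpos2_snd (mposT (@measurable_id _ _ _))).
    exact: (mpos2_fst (mposT (@measurable_powR R b))).
  + exact: (mpos2_snd (mposT (@measurable_powR R _))).
- move=> r r0; apply: eq_intpos (intposZ (r `^ (b - 1) * expR (- (r * cos kappa))) (hint r r0)) => y _.
  by rewrite fE.
- move=> r r0.
  have -> : Ipos (fun y => `|f r y|) = r `^ (b - 1) * expR (- (r * cos kappa)) * Ipos (fun y => `|h r y|).
    rewrite -(@IposZ R (r `^ (b - 1) * expR (- (r * cos kappa))) (fun y => `|h r y|) (intpos_norm (hint r r0))).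
    by apply: eq_Ipos => y _; rewrite fE normrM ger0_norm// mulr_ge0 ?powR_ge0 ?expR_ge0.
  have X0 : 0 < r `^ b * cos kappa by rewrite mulr_gt0 ?powR_gt0.
  have hle : Ipos (fun y => `|h r y|) <= (r `^ b * cos kappa) `^ (- (1 - p)) * Gamma_pos (1 - p).
    rewrite -(@Ipos_powR_expR R (1 - p) _ q0 X0).
    apply: le_Ipos; [exact: intpos_norm (hint r r0)|exact: intpos_powR_expR|].
    move=> y y0; rewrite /h normrM ger0_norm ?mulr_ge0 ?powR_ge0 ?expR_ge0//.
    by rewrite ler_piMr ?mulr_ge0 ?powR_ge0 ?expR_ge0// sin_max.
  apply: (le_trans (ler_wpM2l _ hle)); first by rewrite mulr_ge0 ?powR_ge0 ?expR_ge0.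
  rewrite /H powRM ?powR_ge0 ?(ltW cos_kappa)// -powRrM -bpE.
  rewrite (@powRD_gt0 R r (b - 1) (b * - (1 - p)))//.
  move: (Gamma_pos _) (expR _) (_ `^ _) (_ `^ _) (_ `^ _) => A B C E F.
  by rewrite [leLHS](_ : _ = A * C * (F * E * B)) ?lexx//; ring.
- by apply: intposZ; exact: intpos_powR_expR bp0 cos_kappa.
have fI y : 0 < y -> Ipos (fun r => f r y) = pi * (y `^ (- p) * wright b y).
  move=> y0; transitivity (y `^ (- p) * Ipos (g y)).
    exact: (@IposZ R (y `^ (- p)) (g y) (intpos_wright_kernel (ltW y0))).
  rewrite (wrightE (ltW y0)); move: (Ipos (g y)) (pi) pi0 => I P P0.
  exact: (can_pi P _ I P0).
have Wi : intpos (fun y => y `^ (- p) * wright b y).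
  apply: eq_intpos (intposZ pi^-1 i2) => y y0.
  rewrite (fI y y0); exact: mulKf (lt0r_neq0 pi0) _.
split; first exact: Wi.
have QE : pi * Ipos (fun y => y `^ (- p) * wright b y) = Ipos (fun x => Ipos (f x)).
  by rewrite E -(@IposZ R pi _ Wi); apply: eq_Ipos => y y0; rewrite (fI y y0).
have PE : Ipos (fun x => Ipos (f x)) = Gamma_pos (1 - p) * (Gamma_pos (b * p) * sin (pi * (b * p))).
  have hr := @intpos_rotated R (b * p) (- kappa) (p * kappa) 1 bp0 L1 L2 ltr01.
  have := @Ipos_rotated R (b * p) (- kappa) (p * kappa) 1 bp0 L1 L2 ltr01.
  rewrite powR1 [1 * Gamma_pos _]mul1r (_ : p * kappa - b * p * - kappa = pi * (b * p)); last first.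
    by rewrite [RHS]mulrA -kappaE; ring.
  move=> <-; rewrite -[RHS](@IposZ R (Gamma_pos (1 - p)) _ hr); apply: eq_Ipos => r r0.
  transitivity (r `^ (b - 1) * expR (- (r * cos kappa)) * Ipos (h r)).
    rewrite -(@IposZ R _ _ (hint r r0)); apply: eq_Ipos => y _; exact: fE.
  rewrite (hI r r0) -powRrM -bpE (@powRD_gt0 R r (b - 1) (b * - (1 - p)) r0).
  rewrite cosN sinN !mul1r (_ : psi r - (1 - p) * kappa = p * kappa - r * - sin kappa); last first.
    by rewrite /psi; ring.
  move: (Gamma_pos _) (expR _) (_ `^ _) (_ `^ _) (sin _) => A B C F G.
  by ring.
apply: (mulfI (lt0r_neq0 pi0)); rewrite QE PE -[X in X * (Gamma_pos (1 - p) / _)]GR.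
move: (Gamma_pos (1 - b * p)) G1 (Gamma_pos _) (Gamma_pos _) (sin _) => G G0 G2 G3 s.
by field; rewrite gt_eqF.
Qed.

End representation.
End WrightFunction.

(** * From vanishing real moments to pointwise vanishing *)

Section LogarithmicMoments.
Variable R : realType.
Notation mu := (@lebesgue_measure R).
Notation D := (`]0%R, +oo[%classic : set R).
Lemma exp_powR (x a : R) : 0 < a -> expR (x * ln a) = a `^ x.
Proof. by move=> a0; rewrite /powR gt_eqF. Qed.

(** Taylor series of [sin] at [psi], whose derivatives are shifts by [pi / 2]. The earlier series
    takes a nonnegative variable, so for [v < 0] the sign is moved into the angle by adding [pi]. *)
Lemma sum_sin_shift_cvg (v psi : R) :
  (\sum_(k < n) v ^+ k / k`!%:R * sin (psi + k%:R * (pi / 2))) @[n --> \oo] -->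
  sin (psi + v).
Proof.
have [v0|v0] := leP 0 v.
  have := @exp_sin_series_cvg R psi (pi / 2) v v0.
  by rewrite cos_pihalf sin_pihalf mulr0 mulr1 expR0 mul1r.
have v0' : 0 <= - v by rewrite oppr_ge0 ltW.
have := @exp_sin_series_cvg R psi (pi / 2 + pi) (- v) v0'.
rewrite cosDpi sinDpi cos_pihalf sin_pihalf oppr0 mulr0 expR0 mul1r mulrN1 opprK.
apply: cvg_trans; apply: near_eq_cvg; near=> n; apply: eq_bigr => k _.
have sink (x : R) : sin (x + k%:R * pi) = (-1) ^+ k * sin x.
  elim: {+}(nat_of_ord k) => [|j ih]; first by rewrite mul0r addr0 expr0 mul1r.
  by rewrite -natr1 mulrDl mul1r addrA sinDpi ih exprS mulN1r mulNr.
rewrite mulrDr addrA sink -[in LHS](opprK v) (_ : (- - - v) = (-1) * v); last by rewrite mulN1r opprK.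
have h : (-1) ^+ k * (-1) ^+ k = 1 :> R by rewrite -exprMn mulrNN mulr1 expr1n.
rewrite exprMn; move: (sin _) (_^-1) => s c.
transitivity (((-1) ^+ k * (-1) ^+ k) * (v ^+ k * c * s)); first by ring.
by rewrite h mul1r.
Unshelve. all: by end_near. Qed.

Lemma norm_sum_sin_shift (v psi : R) n :
  `|\sum_(k < n) v ^+ k / k`!%:R * sin (psi + k%:R * (pi / 2))| <= expR `|v|.
Proof.
apply: le_trans (sum_pow_fact_le n (normr_ge0 v)).
apply: (le_trans (ler_norm_sum _ _ _)); apply: ler_sum => k _.
by rewrite !normrM normrX normrV ?unitfE// (ger0_norm (ler0n _ _)) ler_piMr ?sin_max// divr_ge0 ?exprn_ge0.
Qed.

Lemma exprn_le_expR (d x : R) n : 0 < d -> 0 <= x -> x ^+ n <= n`!%:R / d ^+ n * expR (d * x).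
Proof.
move=> d0 x0.
have h : (d * x) ^+ n / n`!%:R <= expR (d * x).
  apply: le_trans (sum_pow_fact_le n.+1 (mulr_ge0 (ltW d0) x0)).
  rewrite big_ord_recr/= lerDr; apply: sumr_ge0 => k _.
  by rewrite divr_ge0 ?exprn_ge0 ?mulr_ge0 ?(ltW d0).
have f0 : 0 < n`!%:R :> R by rewrite ltr0n fact_gt0.
have dn0 : 0 < d ^+ n by rewrite exprn_gt0.
move: h; rewrite ler_pdivrMr// exprMn => h.
by rewrite mulrAC ler_pdivlMr// mulrC mulrC; rewrite mulrC [_ * n`!%:R]mulrC in h *.
Qed.

Lemma expR_norm_le (y u : R) : expR (y * `|u|) <= expR (y * u) + expR (- y * u).
Proof.
have [u0|u0] := leP 0 u; first by rewrite ger0_norm// lerDl expR_ge0.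
by rewrite ltr0_norm// mulrN mulNr lerDr expR_ge0.
Qed.

Lemma expR_quotient_bounds (e u : R) : 0 < e ->
  u <= (expR (e * u) - 1) / e <= u * expR (e * u).
Proof.
move=> e0; rewrite ler_pdivlMr// ler_pdivrMr//; apply/andP; split.
  by have := expR_ge1Dx (e * u); lra.
have h := expR_ge1Dx (- (e * u)).
have : (1 - e * u) * expR (e * u) <= 1.
  rewrite -[leRHS](expRxMexpNx_1 (e * u)) mulrC ler_wpM2l ?expR_ge0//.
by move: (expR _) => x; lra.
Qed.

Variables (W : R -> R) (h : R).
Hypothesis h0 : 0 < h.
Hypothesis cW : forall x : R, 0 < x -> {for x, continuous W}.
Hypothesis Wi : forall x : R, `|x| < h -> intpos (fun a => expR (x * ln a) * W a).
Hypothesis W0 : forall x : R, `|x| < h -> Ipos (fun a => expR (x * ln a) * W a) = 0.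

Let mW : mpos W. Proof. exact: mpos_continuous. Qed.
Let mln : mpos (@ln R). Proof. by apply: mposT; exact: measurable_ln. Qed.

(** Half of the gap [h - y] absorbs the power of the logarithm; the exponential of [z * |ln a|] is
    then split into the exponents [z] and [- z], both inside the strip. *)
Let dominated n (y : R) : 0 <= y < h ->
  intpos (fun a => expR (y * `|ln a|) * `|ln a| ^+ n * `|W a|).
Proof.
move=> /andP[y0 yh]; pose d := (h - y) / 2; pose z := y + d.
have d0 : 0 < d by rewrite /d; lra.
have z0 : 0 < z by rewrite /z; lra.
have zh : `|z| < h by rewrite gtr0_norm// /z /d; lra.
have zh' : `|- z| < h by rewrite normrN.
have gi : intpos (fun a => n`!%:R / d ^+ n * (`|expR (z * ln a) * W a| + `|expR (- z * ln a) * W a|)).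
  by apply: intposZ; apply: intposD; apply: intpos_norm; exact: Wi.
apply: (le_intpos _ gi).
  apply: measurable_funM; last by apply: measurableT_comp => //; exact: mW.
  apply: measurable_funM.
    apply: measurableT_comp => //; apply: measurable_funM; first exact: measurable_cst.
    by apply: measurableT_comp => //; exact: mln.
  by apply: measurable_funX; apply: measurableT_comp => //; exact: mln.
move=> a a0; rewrite !normrM !(ger0_norm (expR_ge0 _)) normr_id normrX normr_id -mulrDl mulrA.
rewrite ler_wpM2r//.
apply: (le_trans (ler_wpM2l (expR_ge0 _) (exprn_le_expR n d0 (normr_ge0 _)))).
rewrite mulrCA -expRD -mulrDl -/z ler_wpM2l ?expR_norm_le//.
by rewrite divr_ge0// exprn_ge0// ltW.
Qed.

(** Each differentiation in [x] brings down one [ln a]. The difference quotients [F k] have integral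
    0 by induction, and their steps [e k] stay below half the distance to the edge of the strip,
    which provides the dominating function. *)
Let log_moment n : forall x : R, `|x| < h ->
  Ipos (fun a => expR (x * ln a) * (ln a ^+ n * W a)) = 0.
Proof.
have mE x k : mpos (fun a => expR (x * ln a) * (ln a ^+ k * W a)).
  apply: measurable_funM; first by apply: measurableT_comp => //; apply: measurable_funM => //; exact: mln.
  by apply: measurable_funM => //; apply: measurable_funX; exact: mln.
have ii x k : `|x| < h -> intpos (fun a => expR (x * ln a) * (ln a ^+ k * W a)).
  move=> xh; apply: le_intpos (dominated k (y := `|x|) _) _; [exact: mE|by rewrite normr_ge0|].
  move=> a a0; rewrite !normrM normrX mulrA (ger0_norm (expR_ge0 _)) !ler_wpM2r ?exprn_ge0//.
  by rewrite ler_expR -normrM ler_norm.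
elim: n => [|n ih] x xh; first by rewrite -[RHS](W0 xh); apply: eq_Ipos => a _; rewrite mul1r.
pose e k := (h - `|x|) / 2 / k.+1%:R.
have e0 k : 0 < e k by rewrite !divr_gt0// subr_gt0.
have ele k : e k <= (h - `|x|) / 2.
  by rewrite /e ler_pdivrMr// ler_peMr ?ler1n// divr_ge0// subr_ge0 ltW.
have ecvg u : e k * u @[k --> \oo] --> (0 : R).
  suff : e k * u @[k --> \oo] --> ((h - `|x|) / 2 * 0 * u) by rewrite mulr0 mul0r.
  apply: cvgMl; apply: cvgMr.
  exact: cvg_harmonic.
pose F k a := (e k)^-1 * (expR ((x + e k) * ln a) * (ln a ^+ n * W a) - expR (x * ln a) * (ln a ^+ n * W a)).
have xeh k : `|x + e k| < h.
  by apply: (le_lt_trans (ler_normD _ _)); have := ele k; rewrite (gtr0_norm (e0 k)); lra.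
have FI k : Ipos (F k) = 0.
  have i1 := ii (x + e k) n (xeh k); have i2 := ii x n xh.
  by rewrite /F (IposZ _ (intposB i1 i2)) (IposB i1 i2) !ih// subrr mulr0.
have FE k a : F k a = expR (x * ln a) * (ln a ^+ n * W a) * ((expR (e k * ln a) - 1) / e k).
  by rewrite /F mulrDl expRD; ring.
have [||||_ L] := @dct_pos R F (fun a => expR (x * ln a) * (ln a ^+ n.+1 * W a))
  (fun a => expR ((`|x| + (h - `|x|) / 2) * `|ln a|) * `|ln a| ^+ n.+1 * `|W a|).
- move=> k; apply: measurable_funM => //; apply: measurable_funB; exact: mE.
- move=> a a0.
  rewrite (_ : (fun k => F k a) = fun k => expR (x * ln a) * (ln a ^+ n * W a) *
      ((expR (e k * ln a) - 1) / e k)); last by apply/funext => k; exact: FE.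
  rewrite (_ : expR (x * ln a) * (ln a ^+ n.+1 * W a) =
      expR (x * ln a) * (ln a ^+ n * W a) * ln a); last by rewrite exprS; ring.
  apply: cvgMr.
  apply: (@squeeze_cvgr _ _ _ _ (cst (ln a)) (fun k => ln a * expR (e k * ln a))).
  + by apply: nearW => k; exact: expR_quotient_bounds.
  + exact: cvg_cst.
  + suff : ln a * expR (e k * ln a) @[k --> \oo] --> ln a * expR 0 by rewrite expR0 mulr1.
    by apply: cvgMr; apply: continuous_cvg; [exact: continuous_expR|exact: ecvg].
- by apply: dominated; have := normr_ge0 x; lra.
- move=> k a a0; rewrite FE !normrM normrX exprS.
  have [l1 l2] := andP (expR_quotient_bounds (ln a) (e0 k)).
  have q : `|(expR (e k * ln a) - 1) / e k| <= expR ((h - `|x|) / 2 * `|ln a|) * `|ln a|.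
    have E1 : expR (e k * ln a) <= expR ((h - `|x|) / 2 * `|ln a|).
      rewrite ler_expR (le_trans (ler_norm _))// normrM (gtr0_norm (e0 k)).
      by rewrite ler_wpM2r// ele.
    have E2 : 1 <= expR ((h - `|x|) / 2 * `|ln a|).
      by rewrite -expR0 ler_expR mulr_ge0// divr_ge0// subr_ge0 ltW.
    move: l1 l2 E1 E2 (expR_ge0 (e k * ln a)); move: (expR (_ * `|_|)) => M.
    move: ((expR (e k * ln a) - 1) / e k) (expR (e k * ln a)) (ln a) => Q E u l1 l2 E1 E2 E0.
    rewrite ler_norml; have := ler_norm u; have := ler_norm (- u); rewrite normrN => u1 u2.
    by apply/andP; split; nra.
  rewrite -normrM.
  have E3 : expR (x * ln a) <= expR (`|x| * `|ln a|) by rewrite ler_expR -normrM ler_norm.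
  rewrite [leRHS](_ : _ = expR (`|x| * `|ln a|) * (`|ln a| ^+ n * `|W a|) *
      (expR ((h - `|x|) / 2 * `|ln a|) * `|ln a|)); last by rewrite mulrDl expRD; ring.
  rewrite ler_pM//.
  by rewrite (ger0_norm (expR_ge0 _)) ler_wpM2r// mulr_ge0 ?exprn_ge0.
rewrite -(cvg_lim _ L)//; rewrite (_ : (fun k => Ipos (F k)) = cst 0) ?lim_cst//.
by apply/funext => k; exact: FI.
Qed.

Let oscillating_int n (xi psi : R) : intpos (fun a => ln a ^+ n * sin (xi * ln a + psi) * W a).
Proof.
apply: le_intpos (dominated n (y := 0) _) _; last 2 first.
- by rewrite lexx.
- move=> a a0; rewrite mul0r expR0 mul1r !normrM normrX ler_wpM2r// ler_piMr ?exprn_ge0//.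
  exact: sin_max.
apply: measurable_funM => //; apply: measurable_funM; first by apply: measurable_funX; exact: mln.
apply: measurableT_comp; first exact: measurable_sin.
by apply: measurable_funD => //; apply: measurable_funM => //; exact: mln.
Qed.

Let oscillating0 n psi : Ipos (fun a => ln a ^+ n * sin (0 * ln a + psi) * W a) = 0.
Proof.
have h00 : `|0 : R| < h by rewrite normr0.
have i0 : intpos (fun a => ln a ^+ n * W a).
  apply: eq_intpos (intposZ 1 (oscillating_int n 0 (pi / 2))) => a _.
  by rewrite mul0r add0r sin_pihalf mulr1 mul1r.
transitivity (sin psi * Ipos (fun a => ln a ^+ n * W a)).
  by rewrite -(IposZ _ i0); apply: eq_Ipos => a _; rewrite mul0r add0r; ring.
rewrite [X in _ * X](_ : _ = 0) ?mulr0// -[RHS](log_moment n h00).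
by apply: eq_Ipos => a _; rewrite mul0r expR0 mul1r.
Qed.

(** Taylor expansion in [eta]: each term is a moment at frequency [xi] with a higher power of [ln a]
    and a shifted phase, so the induction must carry all [n] and [psi]. Domination by
    [exp(|eta| |ln a|)] is what limits a step to length [h]. *)
Let oscillating_step (xi eta : R) : `|eta| < h ->
  (forall n psi, Ipos (fun a => ln a ^+ n * sin (xi * ln a + psi) * W a) = 0) ->
  forall n psi, Ipos (fun a => ln a ^+ n * sin ((xi + eta) * ln a + psi) * W a) = 0.
Proof.
move=> etah Q n psi.
pose F N a := ln a ^+ n * (\sum_(k < N) (eta * ln a) ^+ k / k`!%:R *
   sin ((xi * ln a + psi) + k%:R * (pi / 2))) * W a.
pose t (k : nat) a := eta ^+ k / k`!%:R * (ln a ^+ (n + k) * sin (xi * ln a + (psi + k%:R * (pi / 2))) * W a).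
have FE N a : F N a = \sum_(k < N) t k a.
  rewrite /F big_distrr/= big_distrl/=; apply: eq_bigr => k _.
  by rewrite /t -addrA exprMn exprD; move: (sin _) (_ ^-1) => s c; ring.
have ti k : intpos (t k) by apply: intposZ; exact: oscillating_int.
have FI N : Ipos (F N) = 0.
  rewrite (eq_Ipos (fun a _ => FE N a)) (Ipos_sum (index_enum 'I_N) (fun k => ti k)).
  apply: big1 => k _; rewrite /t IposZ; last exact: oscillating_int.
  by rewrite Q mulr0.
have [||||_ L] := @dct_pos R F (fun a => ln a ^+ n * sin ((xi + eta) * ln a + psi) * W a)
  (fun a => expR (`|eta| * `|ln a|) * `|ln a| ^+ n * `|W a|).
- move=> N; apply: (eq_mpos (fun a _ => esym (FE N a))).
  by apply: intpos_mpos; apply: intpos_sum => k; exact: ti.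
- move=> a a0; apply: cvgMl; apply: cvgMr.
  rewrite (_ : (xi + eta) * ln a + psi = xi * ln a + psi + eta * ln a); last by ring.
  exact: sum_sin_shift_cvg.
- by apply: dominated; rewrite normr_ge0.
- move=> N a a0; rewrite !normrM ler_wpM2r// normrX mulrC ler_wpM2r ?exprn_ge0// -normrM.
  exact: norm_sum_sin_shift.
rewrite -(cvg_lim _ L)//; rewrite (_ : (fun k => Ipos (F k)) = cst 0) ?lim_cst//.
by apply/funext => k; exact: FI.
Qed.

Let oscillating (xi : R) n psi : Ipos (fun a => ln a ^+ n * sin (xi * ln a + psi) * W a) = 0.
Proof.
(* Enough equal steps, each shorter than [h], to walk from frequency 0 to [xi]. *)
pose N := (Num.truncn (`|xi| / h)).+1.
have N0 : 0 < N%:R :> R by [].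
have hN : `|xi / N%:R| < h.
  rewrite normrM normfV (gtr0_norm N0) ltr_pdivrMr// mulrC -ltr_pdivrMr//.
  exact: truncnS_gt.
suff Q j : forall n psi, Ipos (fun a => ln a ^+ n * sin ((j%:R * (xi / N%:R)) * ln a + psi) * W a) = 0.
  by have := Q N n psi; rewrite mulrC divfK// gt_eqF.
elim: j => [|j ih] {}n {}psi; first by rewrite mul0r; exact: oscillating0.
by rewrite -natr1 mulrDl mul1r; exact: oscillating_step.
Qed.

(** The Poisson kernel is the integral of [exp(- r e) cos(r (ln a - v))] over the frequency [r], and
    at every frequency the integral against [W] vanishes. *)
Let poisson (e v : R) : 0 < e ->
  Ipos (fun a => W a * (e / (e ^+ 2 + (ln a - v) ^+ 2))) = 0.
Proof.
move=> e0.
pose f r a := expR (- (r * e)) * (sin ((- r) * ln a + (pi / 2 + r * v)) * W a).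
have Wn : intpos (fun a => `|W a|).
  by apply: eq_intpos (dominated 0 (y := 0) _); rewrite ?lexx// => a _; rewrite mul0r expR0 !mul1r.
have iW r : intpos (fun a => sin ((- r) * ln a + (pi / 2 + r * v)) * W a).
  by apply: eq_intpos (oscillating_int 0 (- r) (pi / 2 + r * v)) => a _; rewrite mul1r.
have [||||E _ _] := @Fubini_pos R f (fun r => Ipos (fun a => `|W a|) * (r `^ (1 - 1) * expR (- (r * e)))).
- apply: mpos2M; first apply: (mpos2_fst (f := fun r => expR (- (r * e)))).
    apply: measurableT_comp => //; apply: measurableT_comp => //.
    by apply: measurable_funM => //; exact: mposT.
  apply: mpos2M; last exact: mpos2_snd.
  apply: measurableT_comp; first exact: measurable_sin.
  apply: measurable_funD.
    apply: measurable_funM; last exact: mpos2_snd.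
    by apply: measurableT_comp => //; apply: (mpos2_fst (f := id)); exact: mposT.
  apply: measurable_funD => //; apply: measurable_funM => //.
  by apply: (mpos2_fst (f := id)); exact: mposT.
- by move=> r r0; apply: intposZ; exact: iW.
- move=> r r0; rewrite subrr powRr0 mul1r mulrC -(IposZ _ Wn).
  apply: le_Ipos; [by apply: intpos_norm; apply: intposZ; exact: iW|exact: intposZ|].
  move=> a a0; rewrite /f !normrM (ger0_norm (expR_ge0 _)) ler_wpM2l ?expR_ge0//.
  by rewrite ler_piMl// sin_max.
- by apply: intposZ; exact: intpos_powR_expR ltr01 e0.
transitivity (Ipos (fun a => Ipos (fun r => f r a))).
  apply: eq_Ipos => a a0.
  have hi := @intpos_expR_sin R e (ln a - v) (pi / 2) e0.
  have := @Ipos_expR_sin R e (ln a - v) (pi / 2) e0.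
  rewrite sin_pihalf cos_pihalf mulr1 mulr0 subr0 => <-.
  rewrite -(@IposZ R (W a) _ hi); apply: eq_Ipos => r _.
  rewrite /f (_ : - r * ln a + (pi / 2 + r * v) = pi / 2 - r * (ln a - v)); last by ring.
  by move: (sin _) (expR _) => s x; ring.
rewrite -E -[RHS]Ipos0; apply: eq_Ipos => r r0; rewrite /f (IposZ _ (iW r)).
rewrite [X in _ * X](_ : _ = 0) ?mulr0// -[RHS](oscillating (- r) 0 (pi / 2 + r * v)).
by apply: eq_Ipos => a _; rewrite mul1r.
Qed.

Let Wn : intpos (fun a => `|W a|).
Proof. by apply: eq_intpos (dominated 0 (y := 0) _); rewrite ?lexx// => a _; rewrite mul0r expR0 !mul1r. Qed.

(* With the Poisson kernel P concentrating at [ln a0], the mass of [W * P] near [a0] is at least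
   [a0 * c / 2], while away from [a0] it is at most a multiple of [e]. *)
Lemma log_moments_le0 (a0 : R) : 0 < a0 -> W a0 <= 0.
Proof.
move=> a00; rewrite leNgt; apply/negP => W1; pose c := W a0 / 2.
have c0 : 0 < c by rewrite divr_gt0.
have [d d0 hd] : exists2 d : R, 0 < d & forall a : R, `|a - a0| < d -> c <= W a.
  have /cvgrPdist_lt/(_ c c0)[d d0 hd] := cW a00.
  exists d => // a ad; have := hd a; rewrite /ball/= distrC => /(_ ad).
  by rewrite ltr_distlC /c => /andP[]; lra.
(* By concavity of [ln] the right end of the ball around [a0] is the nearer one on the logarithmic
   scale, so [s] bounds the distance on both sides. *)
pose s := ln (a0 + d) - ln a0.
have s0 : 0 < s by rewrite subr_gt0 ltr_ln ?posrE ?addr_gt0// ltrDl.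
have far (a : R) : 0 < a -> d <= `|a - a0| -> s <= `|ln a - ln a0|.
  move=> a1; rewrite ler_normr => /orP[da|da].
    rewrite ler_normr; apply/orP; left; rewrite lerD2r ler_ln ?posrE ?addr_gt0//; lra.
  rewrite ler_normr; apply/orP; right; rewrite opprB /s lerBlDr addrAC lerBrDr.
  rewrite -!lnM ?posrE ?addr_gt0// ler_ln ?posrE ?mulr_gt0 ?addr_gt0//; nra.
pose I := Ipos (fun a => `|W a|).
have I0 : 0 <= I by apply: Ipos_ge0 => a _.
(* The first entry keeps [[a0, a0 + a0 e]] inside the ball where [W >= c]. The second makes the far
   contribution [e / s^2 * I] less than [a0 c / 2]; the [+ 1] avoids a division by 0. *)
pose e := Num.min (d / (2 * a0)) (a0 * c * s ^+ 2 / (4 * (I + 1))).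
have I1 : 0 < 4 * (I + 1) by lra.
have e0 : 0 < e.
  rewrite /e lt_min; apply/andP; split; first by rewrite divr_gt0 ?mulr_gt0.
  by apply: divr_gt0 => //; rewrite mulr_gt0 ?exprn_gt0// mulr_gt0.
have e1 : a0 * e < d.
  have : e <= d / (2 * a0) by rewrite /e ge_min lexx.
  rewrite ler_pdivlMr ?mulr_gt0//; nra.
have e2 : e / s ^+ 2 * I < a0 * c / 2.
  have : e <= a0 * c * s ^+ 2 / (4 * (I + 1)) by rewrite /e ge_min lexx orbT.
  rewrite ler_pdivlMr// => h1; rewrite mulrAC ltr_pdivrMr ?exprn_gt0//.
  have := mulr_gt0 (mulr_gt0 a00 c0) (exprn_gt0 2 s0); nra.
pose P a := e / (e ^+ 2 + (ln a - ln a0) ^+ 2).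
have den a : 0 < e ^+ 2 + (ln a - ln a0) ^+ 2 by rewrite ltr_pwDl ?exprn_gt0 ?sqr_ge0.
have P0 a : 0 <= P a by rewrite divr_ge0 ?ltW.
have iWP : intpos (fun a => W a * P a).
  apply: le_intpos (intposZ e^-1 Wn) _.
    apply: measurable_funM => //; apply: mpos_continuous => a a1.
    have hl := is_derive1_ln a1; have hn : e ^+ 2 + (ln a - ln a0) ^+ 2 != 0 by rewrite gt_eqF.
    exact: is_derive_continuous.
  move=> a _; rewrite normrM mulrC ler_wpM2r// ger0_norm// /P ler_pdivrMr//.
  rewrite mulrC ler_pdivlMr// -expr2 lerDl sqr_ge0//.
(* On [[a0, a0 + a0 e]] one has [0 <= ln a - ln a0 <= e], so the kernel is at least [1 / (2 e)];
   height times length is [a0 c / 2], independent of [e]. The added multiple of [|W|] makes the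
   integrand nonnegative away from [a0] as well. *)
have key : c / (2 * e) * (a0 + a0 * e - a0) <= Ipos (fun a => W a * P a + e / s ^+ 2 * `|W a|).
  have pw (a : R) : 0 < a -> `|a - a0| < d \/ `|W a| * P a <= e / s ^+ 2 * `|W a|.
    move=> a1; have [ad|ad] := ltP `|a - a0| d; [by left|right].
    rewrite mulrC ler_wpM2r// /P ler_wpM2l ?(ltW e0)// lef_pV2 ?posrE ?exprn_gt0//.
    have := far a a1 ad; rewrite -[(ln a - _) ^+ 2]real_normK ?num_real// => sa.
    by rewrite (le_trans (lerXn2r 2 _ _ sa)) ?nnegrE ?(ltW s0)// lerDr sqr_ge0.
  have eW a : 0 <= e / s ^+ 2 * `|W a| by rewrite mulr_ge0// divr_ge0 ?exprn_ge0 ?ltW.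
  apply: Ipos_lower_bound => //.
  - by apply: intposD => //; exact: intposZ.
  - move=> a a1; have [/hd cWa|h1] := pw a a1.
      by rewrite addr_ge0// mulr_ge0// (le_trans (ltW c0)).
    have := ler_norm (- (W a * P a)); rewrite normrN normrM (ger0_norm (P0 a)) => h2.
    by rewrite -lerBlDl sub0r (le_trans h2).
  - by rewrite lerDl mulr_ge0 ?(ltW e0) ?(ltW a00).
  - by apply: ltW; rewrite divr_gt0 ?mulr_gt0.
  move=> a /andP[aa0 aae].
  have a1 : 0 < a by lra.
  have cWa : c <= W a by apply: hd; rewrite ger0_norm; lra.
  rewrite ler_wpDr//; apply: ler_pM => //; [exact: ltW|by rewrite invr_ge0 ltW ?mulr_gt0|].
  have aE : ln a - ln a0 <= e.
    have h1 : a / a0 - 1 <= e by rewrite lerBlDr ler_pdivrMr//; nra.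
    rewrite -ln_div ?posrE//; apply: le_trans h1.
    have := @le_ln1Dx R (a / a0 - 1); rewrite addrCA subrr addr0; apply.
    by rewrite ltrBrDr addNr divr_gt0.
  have aE0 : 0 <= ln a - ln a0 by rewrite subr_ge0 ler_ln ?posrE.
  rewrite /P -[leLHS]mul1r ler_pdivrMr ?mulr_gt0//.
  move: (ln a - ln a0) (den a) aE aE0 => u du u1 u0.
  rewrite mulrAC ler_pdivlMr//; nra.
rewrite IposD// in key; last exact: intposZ.
rewrite poisson// add0r (IposZ _ Wn) -/I in key.
have : a0 * c / 2 < a0 * c / 2; last by rewrite ltxx.
apply: le_lt_trans e2; apply: le_trans key.
by rewrite [leRHS](_ : _ = a0 * c / 2) ?lexx//; field; rewrite gt_eqF.
Qed.

End LogarithmicMoments.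

(** * Injectivity of the Mellin transform on a real interval *)

Section MellinUniqueness.
Variable R : realType.
(** Centring at [p = b / 2] and absorbing [a^(b/2 - 1)] into [W] makes the strip symmetric, of
    half-width [h]. The one-sided bound suffices, since it is applied to a difference in both
    orders. *)
Lemma Mellin_le0 (b : R) (F : R -> R) : 0 < b ->
  (forall x : R, 0 < x -> {for x, continuous F}) ->
  (forall p : R, 0 < p < b -> intpos (fun a => a `^ (p - 1) * F a)) ->
  (forall p : R, 0 < p < b -> Ipos (fun a => a `^ (p - 1) * F a) = 0) ->
  forall a : R, 0 < a -> F a <= 0.
Proof.
move=> b0 cF iF F0 a a0; pose h := b / 2.
have h0 : 0 < h by rewrite divr_gt0.
pose W (a : R) := a `^ (h - 1) * F a.
have WE (x a' : R) : 0 < a' -> a' `^ ((x + h) - 1) * F a' = expR (x * ln a') * W a'.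
  by move=> a'0; rewrite exp_powR// /W mulrA -powRD_gt0// addrA.
have xh (x : R) : `|x| < h -> 0 < x + h < b.
  by rewrite ltr_norml /h => /andP[h1 h2]; apply/andP; split; lra.
have cW (x : R) : 0 < x -> {for x, continuous W}.
  by move=> x0; apply: continuousM; [exact: continuous_powR|exact: cF].
have : W a <= 0.
  apply: (log_moments_le0 h0 cW) => // x /xh xb.
  - by apply: eq_intpos (iF _ xb) => a' a'0; exact: WE.
  - by rewrite -[RHS](F0 _ xb); apply: eq_Ipos => a' a'0; rewrite WE.
by rewrite /W pmulr_rle0// powR_gt0.
Qed.

Lemma Mellin_le (b : R) (F G : R -> R) : 0 < b ->
  (forall x : R, 0 < x -> {for x, continuous F}) ->
  (forall x : R, 0 < x -> {for x, continuous G}) ->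
  (forall p : R, 0 < p < b -> intpos (fun a => a `^ (p - 1) * F a)) ->
  (forall p : R, 0 < p < b -> intpos (fun a => a `^ (p - 1) * G a)) ->
  (forall p : R, 0 < p < b ->
    Ipos (fun a => a `^ (p - 1) * F a) = Ipos (fun a => a `^ (p - 1) * G a)) ->
  forall a : R, 0 < a -> F a <= G a.
Proof.
move=> b0 cF cG iF iG FG a a0; rewrite -subr_le0.
apply: (@Mellin_le0 b (fun a => F a - G a) b0 _ _ _ a a0) => [x x0|p pb|p pb].
- by apply: continuousB; [exact: cF|exact: cG].
- by apply: eq_intpos (intposB (iF p pb) (iG p pb)) => y _; rewrite mulrBr.
transitivity (Ipos (fun a => a `^ (p - 1) * F a - a `^ (p - 1) * G a)).
  by apply: eq_Ipos => y _; rewrite mulrBr.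
by rewrite (IposB (iF p pb) (iG p pb)) (FG p pb) subrr.
Qed.

Lemma Mellin_unique (b : R) (F G : R -> R) : 0 < b ->
  (forall x : R, 0 < x -> {for x, continuous F}) ->
  (forall x : R, 0 < x -> {for x, continuous G}) ->
  (forall p : R, 0 < p < b -> intpos (fun a => a `^ (p - 1) * F a)) ->
  (forall p : R, 0 < p < b -> intpos (fun a => a `^ (p - 1) * G a)) ->
  (forall p : R, 0 < p < b ->
    Ipos (fun a => a `^ (p - 1) * F a) = Ipos (fun a => a `^ (p - 1) * G a)) ->
  forall a : R, 0 < a -> F a = G a.
Proof.
move=> b0 cF cG iF iG FG a a0; apply: le_anti.
rewrite (Mellin_le b0 cF cG iF iG FG a0).
exact: (Mellin_le b0 cG cF iG iF (fun p pb => esym (FG p pb)) a0).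
Qed.

End MellinUniqueness.

(** * Multiplicative convolutions and their iteration *)

Section DilationOperator.
Variable R : realType.
Notation mu := (@lebesgue_measure R).
Notation D := (`]0%R, +oo[%classic : set R).
Implicit Types (k Phi : R -> R) (a b p w : R).

Definition dilation k Phi a := Ipos (fun w => k w * Phi (a * w)).

Definition kernel_fun k := (forall w : R, 0 < w -> {for w, continuous k}) /\
  (forall p : R, 0 < p < 1 -> intpos (fun w => w `^ (- p) * k w)).

(** A class stable under [dilation]. The bound by [s^(-b)], paired with the moment of order [- b] of
    the kernel, gives convergence, continuity and the same bound again. It leaves the Mellin
    integral open near 0, hence the separate third clause. *)
Definition profile b Phi := [/\ forall s : R, 0 < s -> {for s, continuous Phi},
  exists2 C : R, 0 <= C & forall s : R, 0 < s -> `|Phi s| <= C * s `^ (- b) &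
  forall p : R, 0 < p < b -> intpos (fun s => s `^ (p - 1) * Phi s)].

Lemma continuous_dilate Phi a : (forall s : R, 0 < s -> {for s, continuous Phi}) -> 0 < a ->
  forall w : R, 0 < w -> {for w, continuous (fun w => Phi (a * w))}.
Proof.
move=> cP a0 w w0; apply: continuous_comp; last by apply: cP; exact: mulr_gt0.
by apply: continuousM; [exact: cst_continuous|exact: cvg_id].
Qed.

Lemma Mellin_scale Phi p a : (forall s : R, 0 < s -> {for s, continuous Phi}) -> 0 < a ->
  intpos (fun s => s `^ (p - 1) * Phi s) ->
  intpos (fun s => s `^ (p - 1) * Phi (a * s)) /\
  Ipos (fun s => s `^ (p - 1) * Phi (a * s)) = a `^ (- p) * Ipos (fun s => s `^ (p - 1) * Phi s).
Proof.
move=> cP a0 fi; pose f (s : R) := s `^ (p - 1) * Phi s.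
have cf (s : R) : 0 < s -> {for s, continuous f}.
  by move=> s0; apply: continuousM; [exact: continuous_powR|exact: cP].
pose f2 (y : R) := a * `|1| * y `^ (1 - 1) * f (a * y `^ 1).
have n1 : (1 : R) != 0 by rewrite oner_eq0.
have f2i : intpos f2 := (intpos_powR_subst a0 n1 cf).1 fi.
have fE : Ipos f = Ipos f2 := Ipos_powR_subst a0 n1 cf fi.
have E (y : R) : 0 < y -> y `^ (p - 1) * Phi (a * y) = a `^ (- p) * f2 y.
  move=> y0; rewrite /f2 /f subrr powRr0 powRr1 ?(ltW y0)// normr1 !mulr1 powRM ?(ltW a0) ?(ltW y0)//.
  rewrite -[X in _ * (X * _)](@powRr1 _ a) ?(ltW a0)// !mulrA -!powRD_gt0//.
  by rewrite (_ : - p + 1 + (p - 1) = 0) ?powRr0 ?mul1r//; ring.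
split; first by apply: eq_intpos (intposZ (a `^ (- p)) f2i) => y y0; rewrite E.
by rewrite -/f fE -(IposZ _ f2i); apply: eq_Ipos => y y0; rewrite E.
Qed.

Section boundedness.
Variables (b : R) (k Phi : R -> R).
Hypotheses (b01 : 0 < b < 1) (kK : kernel_fun k) (PP : profile b Phi).

Let ki p : 0 < p < 1 -> intpos (fun w => w `^ (- p) * k w). Proof. exact: kK.2. Qed.
Let cPhi : forall s : R, 0 < s -> {for s, continuous Phi}. Proof. by case: PP. Qed.

Let cint a : 0 < a -> forall w, 0 < w -> {for w, continuous (fun w => k w * Phi (a * w))}.
Proof.
by move=> a0 w w0; apply: continuousM; [exact: kK.1|exact: continuous_dilate].
Qed.

Lemma dilation_bound : exists2 C : R, 0 <= C & forall a w : R, 0 < a -> 0 < w ->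
  `|k w * Phi (a * w)| <= C * a `^ (- b) * `|w `^ (- b) * k w|.
Proof.
have [_ [C C0 hC] _] := PP; exists C => // a w a0 w0.
rewrite !normrM (ger0_norm (powR_ge0 _ _)) (mulrC (w `^ _)) mulrCA ler_wpM2l//.
by rewrite -mulrA -powRM ?(ltW a0) ?(ltW w0)//; apply: hC; exact: mulr_gt0.
Qed.

Lemma intpos_dilation a : 0 < a -> intpos (fun w => k w * Phi (a * w)).
Proof.
move=> a0; have [C C0 hC] := dilation_bound.
apply: le_intpos (intposZ (C * a `^ (- b)) (intpos_norm (ki b01))) _.
  by apply: mpos_continuous; exact: cint.
by move=> w w0; exact: hC.
Qed.

Lemma continuous_dilation a : 0 < a -> {for a, continuous (dilation k Phi)}.
Proof.
move=> a0; have [C C0 hC] := dilation_bound; have h0 : 0 < a / 2 by rewrite divr_gt0.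
have I0 z : `](a / 2), (a + 1)[%classic z -> a / 2 < z.
  by rewrite /= in_itv/= => /andP[].
have := @continuity_under_integral _ _ _ mu (fun a w => k w * Phi (a * w)) D _ (a / 2) (a + 1) _ _
     (fun w => C * (a / 2) `^ (- b) * `|w `^ (- b) * k w|) (intposZ _ (intpos_norm (ki b01))).
apply => //.
- by move=> z /I0 z0; apply: intpos_dilation; exact: lt_trans z0.
- apply/aeW => w wD z zI; have w0 : 0 < w by rewrite -inD.
  have z0 : 0 < z by move: zI; rewrite inE => /I0; exact: lt_trans.
  apply: continuousM; first exact: cst_continuous.
  apply: continuous_comp; last by apply: cPhi; exact: mulr_gt0.
  by apply: continuousM; [exact: cvg_id|exact: cst_continuous].
- move=> z /I0 zI; have z0 : 0 < z by exact: lt_trans zI.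
  apply/aeW => w wD; have w0 : 0 < w by rewrite -inD.
  apply: (le_trans (hC z w z0 w0)); rewrite ler_wpM2r// ler_wpM2l//.
  rewrite !powRN lef_pV2 ?posrE ?powR_gt0//.
  case/andP: b01 => b0 _.
  by rewrite ge0_ler_powR ?nnegrE ?(ltW b0) ?(ltW z0) ?(ltW h0)// ltW.
- by rewrite inE /= in_itv/= ltrDl ltr01 andbT; lra.
Qed.

(** After Fubini, the integral over [a] of [a^(p-1) Phi(w a)] scales out as [w^(-p)], which leaves
    the moment of order [- p] of the kernel as a factor. *)
Lemma Mellin_dilation p : 0 < p < b ->
  intpos (fun a => a `^ (p - 1) * dilation k Phi a) /\
  Ipos (fun a => a `^ (p - 1) * dilation k Phi a) =
  Ipos (fun w => w `^ (- p) * k w) * Ipos (fun s => s `^ (p - 1) * Phi s).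
Proof.
move=> /andP[p0 pb]; have [b0 b1] := andP b01.
have p1 : 0 < p < 1 by rewrite p0 (lt_trans pb).
have si : intpos (fun s => s `^ (p - 1) * Phi s) by have [_ _] := PP; apply; rewrite p0.
have mPhi : mpos Phi by apply: mpos_continuous.
have mk : mpos k by apply: mpos_continuous; exact: kK.1.
pose f w a := k w * (a `^ (p - 1) * Phi (w * a)).
have sc w (w0 : 0 < w) := Mellin_scale cPhi w0 si.
have cnPhi s : 0 < s -> {for s, continuous (fun s => `|Phi s|)}.
  by move=> s0; apply: continuous_comp; [exact: cPhi|exact: norm_continuous].
have nE (s : R) : `|s `^ (p - 1) * Phi s| = s `^ (p - 1) * `|Phi s|.
  by rewrite normrM (ger0_norm (powR_ge0 _ _)).
have sin : intpos (fun s => s `^ (p - 1) * `|Phi s|).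
  by apply: eq_intpos (intpos_norm si) => s _; exact: nE.
pose M := Ipos (fun s => s `^ (p - 1) * `|Phi s|).
have [||||E i1 i2] := @Fubini_pos R f (fun w => M * `|w `^ (- p) * k w|).
- apply: mpos2M; first exact: mpos2_fst.
  apply: mpos2M; last exact: mpos2_prod.
  by apply: (mpos2_snd (f := fun a => a `^ (p - 1))); apply: mposT; exact: measurable_powR.
- by move=> w w0; apply: intposZ; exact: (sc w w0).1.
- move=> w w0; have [j1 j2] := Mellin_scale cnPhi w0 sin.
  have -> : Ipos (fun a => `|f w a|) = `|k w| * Ipos (fun s => s `^ (p - 1) * `|Phi (w * s)|).
    rewrite -(@IposZ R `|k w| _ j1); apply: eq_Ipos => s _.
    by rewrite /f !normrM (ger0_norm (powR_ge0 _ _)).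
  rewrite j2 normrM (ger0_norm (powR_ge0 _ _)) -/M.
  by rewrite [leRHS](_ : _ = `|k w| * (w `^ (- p) * M)) ?lexx//; ring.
- by apply: intposZ; apply: intpos_norm; exact: ki.
have dE a : 0 < a -> Ipos (fun w => f w a) = a `^ (p - 1) * dilation k Phi a.
  move=> a0; rewrite -[RHS](@IposZ R _ _ (intpos_dilation a0)); apply: eq_Ipos => w _.
  by rewrite /f (mulrC w) mulrCA.
split; first by apply: eq_intpos i2 => a a0; rewrite dE.
transitivity (Ipos (fun w => Ipos (f w))).
  by rewrite E; apply: eq_Ipos => a a0; rewrite dE.
rewrite mulrC -(@IposZ R _ _ (ki p1)); apply: eq_Ipos => w w0.
transitivity (k w * Ipos (fun a => a `^ (p - 1) * Phi (w * a))).
  exact: (@IposZ R (k w) _ (sc w w0).1).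
by rewrite (sc w w0).2; ring.
Qed.

Lemma profile_dilation : profile b (dilation k Phi).
Proof.
split; [exact: continuous_dilation| |by move=> p pb; exact: (Mellin_dilation pb).1].
have [C C0 hC] := dilation_bound.
pose I := Ipos (fun w => `|w `^ (- b) * k w|).
have I0 : 0 <= I by apply: Ipos_ge0 => w _.
exists (C * I) => [|a a0]; first by rewrite mulr_ge0.
have nI := intpos_norm (ki b01).
rewrite mulrAC -(@IposZ R (C * a `^ (- b)) _ nI).
apply: le_norm_Ipos; first by apply: mpos_continuous; exact: cint.
  exact: intposZ.
by move=> w w0; exact: hC.
Qed.

End boundedness.

(* The kernels are applied from the outermost variable inwards, starting with [k j]. *)
Fixpoint dilations (k : nat -> R -> R) n j Phi : R -> R :=
  if n is n'.+1 then dilation (k j) (dilations k n' j.+1 Phi) else Phi.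

Lemma eq_iint n (F G : (nat -> R) -> R) :
  (forall w : nat -> R, (forall i, (i < n)%N -> 0 < w i) -> F w = G w) -> iint n F = iint n G.
Proof.
elim: n F G => [|n ih] F G FG; first by apply: FG.
apply: eq_Ipos => w w0; apply: ih => v v0; apply: FG => -[|i] hi //=.
exact: v0.
Qed.

(** The constant [c] and the scale [a] are generalised for the induction: removing the outermost
    variable [w] multiplies [c] by [k j w] and [a] by [w]. *)
Lemma iint_dilations (k : nat -> R -> R) Phi n j (c a : R) : 0 < a ->
  (forall n' j' a', 0 < a' -> intpos (fun w => k j' w * dilations k n' j'.+1 Phi (a' * w))) ->
  iint n (fun w : nat -> R => c * (\prod_(i < n) k (j + i)%N (w i)) * Phi (a * \prod_(i < n) w i)) =
  c * dilations k n j Phi a.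
Proof.
move=> a0 H; elim: n j c a a0 => [|n ih] j c a a0.
  by rewrite /= !big_ord0 !mulr1.
rewrite /= -(IposZ c (H n j a a0)); apply: eq_Ipos => w w0.
transitivity (c * k j w * dilations k n j.+1 Phi (a * w)); last by rewrite mulrA.
rewrite -ih ?mulr_gt0//; congr iint; apply/funext => v.
rewrite !big_ord_recl/= addn0 !mulrA; congr (_ * _ * Phi _).
by apply: eq_bigr => i _; rewrite /bump add1n addnS addSn.
Qed.

Section iteration.
Variables (b : R) (k : nat -> R -> R) (Phi : R -> R).
Hypotheses (b01 : 0 < b < 1) (kK : forall i, kernel_fun (k i)).

Lemma profile_dilations n j : profile b Phi -> profile b (dilations k n j Phi).
Proof.
move=> PP; elim: n j => [//|n ih] j; exact: profile_dilation b01 (kK j) (ih j.+1).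
Qed.

Lemma iint_profile n : profile b Phi ->
  iint n (fun w : nat -> R => (\prod_(i < n) k i (w i)) * Phi (\prod_(i < n) w i)) = dilations k n 0 Phi 1.
Proof.
move=> PP; rewrite -[RHS]mul1r -iint_dilations//.
  by congr iint; apply/funext => w; rewrite !mul1r.
move=> n' j' a' a'0.
exact: (intpos_dilation b01 (kK j') (profile_dilations n' j'.+1 PP) a'0).
Qed.

Lemma Mellin_dilations n j p : profile b Phi -> 0 < p < b ->
  Ipos (fun a => a `^ (p - 1) * dilations k n j Phi a) =
  (\prod_(i < n) Ipos (fun w => w `^ (- p) * k (j + i)%N w)) * Ipos (fun s => s `^ (p - 1) * Phi s).
Proof.
move=> PP pb; elim: n j => [|n ih] j; first by rewrite big_ord0 mul1r.
rewrite (Mellin_dilation b01 (kK j) (profile_dilations n j.+1 PP) pb).2 ih mulrA.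
rewrite big_ord_recl addn0; congr (_ * _ * _).
by apply: eq_bigr => i _; rewrite lift0 addnS addSn.
Qed.

(** A pure power is an eigenfunction of every dilation, with the moment of order [- b] as
    eigenvalue. Having no Mellin strip, it is not a [profile] unless [K = 0], so this is computed by
    direct induction. *)
Lemma iint_powR n (K : R) :
  iint n (fun w : nat -> R => (\prod_(i < n) k i (w i)) * (K * (\prod_(i < n) w i) `^ (- b))) =
  (\prod_(i < n) Ipos (fun w => w `^ (- b) * k i w)) * K.
Proof.
pose Psi (s : R) := K * s `^ (- b).
have TE n' : forall j a, 0 < a -> dilations k n' j Psi a =
    (\prod_(i < n') Ipos (fun w => w `^ (- b) * k (j + i)%N w)) * (K * a `^ (- b)).
  elim: n' => [|n' ih] j a a0; first by rewrite big_ord0 mul1r.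
  rewrite /= /dilation big_ord_recl addn0.
  set P := (X in _ * X * _); rewrite mulrAC.
  rewrite [RHS](_ : _ = P * (K * a `^ (- b)) * Ipos (fun w => w `^ (- b) * k j w)); last by ring.
  rewrite -(IposZ _ ((kK j).2 b b01)); apply: eq_Ipos => w w0.
  rewrite ih ?mulr_gt0// powRM ?(ltW a0) ?(ltW w0)//.
  rewrite (_ : \prod_(i < n') _ = P); first by ring.
  by apply: eq_bigr => i _; rewrite lift0 addnS addSn.
transitivity (dilations k n 0 Psi 1); last by rewrite TE// powR1 mulr1.
rewrite -[RHS]mul1r -iint_dilations//.
  by congr iint; apply/funext => w; rewrite !mul1r.
move=> n' j' a' a'0.
pose P := \prod_(i < n') Ipos (fun w => w `^ (- b) * k (j'.+1 + i)%N w) * K.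
apply: eq_intpos (intposZ (P * a' `^ (- b)) ((kK j').2 b b01)) => w w0.
by rewrite TE ?mulr_gt0// powRM ?(ltW a'0) ?(ltW w0)// /P; ring.
Qed.

End iteration.
End DilationOperator.

(** * The kernel of the theorem and the profile of the solution *)

Section Kernels.
Variable R : realType.
Notation mu := (@lebesgue_measure R).
Notation D := (`]0%R, +oo[%classic : set R).
Section factors.
Variables (m : nat) (t : R).
Hypotheses (m1 : (1 < m)%N) (t0 : 0 < t).
Let c : R := (m%:R ^+ m * t) `^ (1 / (m.-1)%:R).

Let m0 : 0 < m%:R :> R. Proof. by rewrite ltr0n ltnW. Qed.
Let c0 : 0 < c. Proof. by apply: powR_gt0; rewrite mulr_gt0 ?exprn_gt0. Qed.

Definition kernel_factor (i : nat) (w : R) : R := expR (- (w ^+ m / c)) * w ^+ i.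

Lemma kern5p2E (w : nat -> R) : kern5p2 m t w = \prod_(i < m.-1) kernel_factor i (w i).
Proof.
rewrite /kern5p2 /kernel_factor -/c big_split/= -expR_sum; congr (expR _ * _).
by rewrite mulNr sumrN mulr_suml.
Qed.

(** The substitution [r = w^m / c] in the Gamma integral at [(i + 1 - p) / m]. *)
Lemma kernel_factor_Mellin i (p : R) : 0 < i.+1%:R - p ->
  intpos (fun w => w `^ (- p) * kernel_factor i w) /\
  Ipos (fun w => w `^ (- p) * kernel_factor i w) =
  m%:R^-1 * c `^ ((i.+1%:R - p) / m%:R) * Gamma_pos ((i.+1%:R - p) / m%:R).
Proof.
move=> ip; pose a := (i.+1%:R - p) / m%:R; have a0 : 0 < a by rewrite divr_gt0.
have fi := intpos_Gamma a0; pose f (r : R) := r `^ (a - 1) * expR (- r).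
have cf (x : R) : 0 < x -> {for x, continuous f}.
  move=> x0; have h := is_derive1_powR (a - 1) x0; exact: is_derive_continuous.
have ci0 : 0 < c^-1 by rewrite invr_gt0.
have mn0 : m%:R != 0 :> R by rewrite gt_eqF.
pose f2 (y : R) := c^-1 * `|m%:R| * y `^ (m%:R - 1) * f (c^-1 * y `^ m%:R).
have f2i : intpos f2 := (intpos_powR_subst ci0 mn0 cf).1 fi.
have fE : Ipos f = Ipos f2 := Ipos_powR_subst ci0 mn0 cf fi.
have E (w : R) : 0 < w -> w `^ (- p) * kernel_factor i w = m%:R^-1 * c `^ a * f2 w.
  move=> w0; rewrite /f2 /f /kernel_factor (gtr0_norm m0).
  rewrite powRM ?powR_ge0 ?(ltW ci0)// -powRrM -!powR_mulrn ?(ltW w0)// (mulrC c^-1 (w `^ _)).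
  rewrite -[c^-1](powR_inv1 (ltW c0)) -powRrM.
  have cc : c `^ a * c `^ (-1) * c `^ (-1 * (a - 1)) = 1 :> R.
    by rewrite -!powRD_gt0// (_ : a + -1 + -1 * (a - 1) = 0) ?powRr0//; ring.
  have ww : w `^ (m%:R - 1) * w `^ (m%:R * (a - 1)) = w `^ (- p) * w `^ i%:R.
    rewrite -!powRD_gt0//; congr (_ `^ _); rewrite /a -[i.+1%:R]natr1.
    by field.
  rewrite [expR _ * w `^ _]mulrC [LHS]mulrA -ww.
  move: cc.
  move: (c `^ a) (c `^ (-1)) (c `^ (-1 * (a - 1))) (w `^ (m%:R - 1)) (w `^ (m%:R * (a - 1))) => A B C F G cc.
  move: (expR _) => H.
  transitivity ((A * B * C) * (F * G * H)); first by rewrite cc mul1r.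
  field.
  exact: mn0.
split; first by apply: eq_intpos (intposZ (m%:R^-1 * c `^ a) f2i) => w w0; rewrite E.
transitivity (m%:R^-1 * c `^ a * Ipos f2); last by rewrite -fE.
by rewrite -(@IposZ R _ _ f2i); apply: eq_Ipos => w w0; rewrite E.
Qed.

Lemma kernel_factor_fun i : kernel_fun (kernel_factor i).
Proof.
split=> [w w0|p /andP[_ p1]].
  apply: continuousM; last exact: exprn_continuous.
  apply: continuous_comp; last exact: continuous_expR.
  apply: continuousN; apply: continuousM; last exact: cst_continuous.
  exact: exprn_continuous.
by apply: (kernel_factor_Mellin _).1; rewrite subr_gt0 (lt_le_trans p1)// ler1n.
Qed.

(* Gauss' multiplication formula, with the last factor of the product moved to the right. *)
Lemma kernel_constant (p : R) : 0 <= p < 1 ->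
  const5p2 m t * \prod_(i < m.-1) Ipos (fun w => w `^ (- p) * kernel_factor i w) =
  t `^ (- (p / m%:R)) * (Gamma_pos (1 - p) / Gamma_pos (1 - p / m%:R)).
Proof.
move=> /andP[p0 p1].
have ip i : 0 < i.+1%:R - p by rewrite subr_gt0 (lt_le_trans p1)// ler1n.
under eq_bigr => i _ do rewrite (kernel_factor_Mellin (ip i)).2.
have x1 : 0 < 1 - p <= 1 by apply/andP; split; lra.
have mE : m = m.-1.+1 by rewrite prednK// ltnW.
have n0 : (0 < m.-1)%N by rewrite -ltnS -mE.
have nR : 0 < (m.-1)%:R :> R by rewrite ltr0n.
have mR : m%:R = (m.-1)%:R + 1 :> R by rewrite natr1 -mE.
have recr (f : nat -> R) : \prod_(j < m) f j = (\prod_(j < m.-1) f j) * f m.-1.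
  by move: m1; case: (m) => // n _; rewrite big_ord_recr.
have lastE : (1 - p + (m.-1)%:R) / m%:R = 1 - p / m%:R by rewrite mR; field; rewrite gt_eqF// addr_gt0.
have argE (i : nat) : (i.+1%:R - p) / m%:R = (1 - p + i%:R) / m%:R.
  by rewrite -natr1; congr (_ / _); ring.
have P0 : 0 < (2 * pi) `^ ((m%:R - 1) / 2) :> R by rewrite powR_gt0// mulr_gt0// pi_gt0.
(* The four powers of [m] come from the constant of the theorem, from the factors [1 / m] of the
   moments, from the powers of [c], and from Gauss' formula at [1 - p]; their exponents sum to 0. *)
have mm : m%:R `^ ((m%:R - 1) / 2) * m%:R `^ (- (m%:R - 1)) *
    m%:R `^ (m%:R * (2^-1 - p / m%:R)) * m%:R `^ (2^-1 - (1 - p)) = 1 :> R.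
  rewrite -!powRD_gt0// -[RHS](powRr0 m%:R); congr (_ `^ _); field; exact: lt0r_neq0.
have tt : t `^ (2^-1 - p / m%:R) = t `^ 2^-1 * t `^ (- (p / m%:R)) by rewrite powRD_gt0.
have T0 : t `^ 2^-1 != 0 by rewrite gt_eqF// powR_gt0.
have pm1 : p / m%:R < 1.
  by rewrite ltr_pdivrMr// mul1r (lt_le_trans p1)// ler1n ltnW.
have := Gamma_multiplication (ltnW m1) x1.
rewrite (recr (fun j => Gamma_pos ((1 - p + j%:R) / m%:R))) => GM.
rewrite lastE in GM.
have G0 : 0 < Gamma_pos (1 - p / m%:R) by apply: Gamma_pos_gt0; rewrite subr_gt0.
rewrite !big_split/=.
have -> : \prod_(i < m.-1) Gamma_pos ((i.+1%:R - p) / m%:R) =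
   (2 * pi) `^ ((m%:R - 1) / 2) * m%:R `^ (2^-1 - (1 - p)) * Gamma_pos (1 - p) / Gamma_pos (1 - p / m%:R).
  apply: (mulIf (lt0r_neq0 G0)); rewrite (divfK (lt0r_neq0 G0)) -GM.
  under eq_bigr do rewrite argE.
  exact: erefl.
have -> : \prod_(i < m.-1) (m%:R^-1 : R) = m%:R `^ (- (m%:R - 1)).
  by rewrite prodr_const card_ord exprVn powRN mR addrK powR_mulrn// ltW.
(* The exponents sum to [(m - 1)(m / 2 - p) / m], whose factor [m - 1] undoes the root in [c] and
   leaves [(m^m t)^(1/2 - p/m)]; the part [t^(1/2)] cancels against the constant of the theorem. *)
have -> : \prod_(i < m.-1) c `^ ((i.+1%:R - p) / m%:R) = m%:R `^ (m%:R * (2^-1 - p / m%:R)) * t `^ (2^-1 - p / m%:R).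
  have prodE n (f : nat -> R) : \prod_(i < n) c `^ f i = c `^ (\sum_(i < n) f i).
    elim: n => [|n ih]; first by rewrite !big_ord0 powRr0.
    by rewrite !big_ord_recr/= ih powRD_gt0.
  have sumE n : \sum_(i < n) (i.+1%:R - p) / m%:R = n%:R * ((n%:R + 1) / 2 - p) / m%:R.
    elim: n => [|n ih]; first by rewrite big_ord0 !mul0r.
    by rewrite big_ord_recr/= ih -natr1; field; exact: lt0r_neq0.
  rewrite (prodE _ (fun i => (i.+1%:R - p) / m%:R)) sumE -mR /c -powRrM.
  rewrite (_ : 1 / (m.-1)%:R * ((m.-1)%:R * (m%:R / 2 - p) / m%:R) = 2^-1 - p / m%:R); last first.
    by field; rewrite !gt_eqF.
  by rewrite powRM ?exprn_ge0 ?(ltW t0)// -powR_mulrn ?(ltW m0)// -powRrM.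
rewrite /const5p2.
have -> : Num.sqrt t = t `^ 2^-1 by rewrite powR12_sqrt// ltW.
rewrite tt; move: mm (lt0r_neq0 P0) (lt0r_neq0 G0) T0.
move: (Gamma_pos (1 - p)) (Gamma_pos (1 - p / m%:R)) => G1 G2.
move: ((2 * pi) `^ _) (t `^ _) (t `^ _) => P T S.
move: (m%:R `^ (_ / 2)) (m%:R `^ - _) (m%:R `^ (m%:R * _)) (m%:R `^ (2^-1 - _)) => A B C E.
move=> mm P0' G20 S0; transitivity ((A * B * C * E) * (T * (G1 / G2))); last by rewrite mm mul1r.
field; rewrite ?P0' ?G20 ?S0; exact isT.
Qed.

(** Reduces the theorem to guessing [F]: the iterated integral with its argument scaled by [a] has
    the Mellin transform required of [F], so uniqueness identifies the two and [a = 1] is taken. *)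
Lemma iint_kern5p2 (b : R) (Phi F : R -> R) : 0 < b < 1 -> profile b Phi ->
  (forall a : R, 0 < a -> {for a, continuous F}) ->
  (forall p : R, 0 < p < b -> intpos (fun a => a `^ (p - 1) * F a)) ->
  (forall p : R, 0 < p < b -> Ipos (fun a => a `^ (p - 1) * F a) =
    t `^ (- (p / m%:R)) * (Gamma_pos (1 - p) / Gamma_pos (1 - p / m%:R)) *
    Ipos (fun s => s `^ (p - 1) * Phi s)) ->
  const5p2 m t * iint m.-1 (fun w => kern5p2 m t w * Phi (\prod_(i < m.-1) w i)) = F 1.
Proof.
move=> b01 PP cF iF FE; have [b0 b1] := andP b01.
have [cT _ iT] := profile_dilations b01 kernel_factor_fun m.-1 0 PP.
pose G a := const5p2 m t * dilations kernel_factor m.-1 0 Phi a.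
have GE p : 0 < p < b -> Ipos (fun a => a `^ (p - 1) * G a) =
    const5p2 m t * Ipos (fun a => a `^ (p - 1) * dilations kernel_factor m.-1 0 Phi a).
  move=> pb; rewrite -[RHS](@IposZ R _ _ (iT p pb)).
  by apply: eq_Ipos => a _; rewrite /G mulrCA.
transitivity (G 1).
  rewrite /G -(iint_profile b01 kernel_factor_fun m.-1 PP); congr (_ * _).
  by apply: eq_iint => w _; rewrite kern5p2E.
apply: (Mellin_unique b0) => // [a a0|p pb|p pb].
- by apply: continuousM; [exact: cst_continuous|exact: cT].
- by apply: eq_intpos (intposZ (const5p2 m t) (iT p pb)) => a _; rewrite mulrCA.
have p01 : 0 <= p < 1 by case/andP: pb => p0 pb; rewrite (ltW p0) (lt_trans pb).
rewrite (FE p pb) (GE p pb) (Mellin_dilations b01 kernel_factor_fun m.-1 0 PP pb).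
by rewrite -(kernel_constant p01) mulrA.
Qed.

Lemma iint_kern5p2_powR (b K : R) : 0 < b < 1 ->
  const5p2 m t * iint m.-1 (fun w => kern5p2 m t w * (K * (\prod_(i < m.-1) w i) `^ (- b))) =
  t `^ (- (b / m%:R)) * (Gamma_pos (1 - b) / Gamma_pos (1 - b / m%:R)) * K.
Proof.
move=> b01; have b01' : 0 <= b < 1 by case/andP: b01 => b0 ->; rewrite ltW.
rewrite -(kernel_constant b01') -mulrA -(iint_powR b01 kernel_factor_fun); congr (_ * _).
by apply: eq_iint => w _; rewrite kern5p2E.
Qed.

End factors.

Lemma profileZ (b K : R) (Phi : R -> R) : profile b Phi -> profile b (fun s => K * Phi s).
Proof.
move=> [cP [C C0 hC] iP]; split=> [s s0||p pb].
- by apply: continuousM; [exact: cst_continuous|exact: cP].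
- exists (`|K| * C) => [|s s0]; first by rewrite mulr_ge0.
  by rewrite normrM -mulrA ler_wpM2l// hC.
- by apply: eq_intpos (intposZ K (iP p pb)) => s _; rewrite mulrCA.
Qed.

Section wright_profile.
Variables (b g z : R).
Hypotheses (b01 : 0 < b < 1) (g0 : 0 < g) (z0 : 0 < z).

(** The exponent [g] is kept apart from the index [b]: the inner solution has [g = b], while the
    outer one, at time [a^m t], has an exponent in [a] that is [m] times its index. *)
Definition wright_profile (s : R) : R := s `^ (- g) * wright b (z * s `^ (- g)).

Let arg_gt0 (s : R) : 0 < s -> 0 < z * s `^ (- g).
Proof. by move=> s0; rewrite mulr_gt0 ?powR_gt0. Qed.

Lemma continuous_wright_profile (s : R) : 0 < s -> {for s, continuous wright_profile}.
Proof.
move=> s0; apply: continuousM; first exact: continuous_powR.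
apply: continuous_comp; last by apply: continuous_wright => //; exact: arg_gt0.
by apply: continuousM; [exact: cst_continuous|exact: continuous_powR].
Qed.

(** The decreasing substitution [y = z * s^(- g)] in the Mellin integral of the Wright function at
    [p / g]; this is where [z > 0], that is [x] nonzero, is essential. *)
Lemma wright_profile_Mellin (p : R) : 0 < p < g ->
  intpos (fun s => s `^ (p - 1) * wright_profile s) /\
  Ipos (fun s => s `^ (p - 1) * wright_profile s) =
  g^-1 * z `^ (p / g - 1) * (Gamma_pos (1 - p / g) / Gamma_pos (1 - b * (p / g))).
Proof.
move=> /andP[p0 pg]; have q01 : 0 < p / g < 1 by rewrite divr_gt0// ltr_pdivrMr// mul1r.
have [fi fE] := wright_Mellin b01 q01.
pose f (y : R) := y `^ (- (p / g)) * wright b y.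
have cf (y : R) : 0 < y -> {for y, continuous f}.
  by move=> y0; apply: continuousM; [exact: continuous_powR|exact: continuous_wright].
have ng0 : - g != 0 by rewrite oppr_eq0 gt_eqF.
pose f2 (s : R) := z * `|- g| * s `^ (- g - 1) * f (z * s `^ (- g)).
have f2i : intpos f2 := (intpos_powR_subst z0 ng0 cf).1 fi.
have f2E : Ipos f = Ipos f2 := Ipos_powR_subst z0 ng0 cf fi.
have E (s : R) : 0 < s -> s `^ (p - 1) * wright_profile s = g^-1 * z `^ (p / g - 1) * f2 s.
  move=> s0; rewrite /f2 /f /wright_profile normrN (gtr0_norm g0).
  rewrite (powRM _ (ltW z0) (powR_ge0 _ _)) -powRrM.
  have zz : z `^ (p / g - 1) * z * z `^ (- (p / g)) = 1.
    rewrite -{2}(powRr1 (ltW z0)) -!powRD_gt0// (_ : p / g - 1 + 1 + - (p / g) = 0) ?powRr0//.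
    by ring.
  have ss : s `^ (- g - 1) * s `^ (- g * - (p / g)) = s `^ (p - 1) * s `^ (- g).
    by rewrite -!powRD_gt0//; congr (_ `^ _); field; rewrite gt_eqF.
  rewrite mulrA -ss.
  move: zz (wright b (z * s `^ (- g))).
  move: (z `^ (p / g - 1)) (z `^ (- (p / g))) (s `^ (- g - 1)) (s `^ (- g * _)) => A B C F zz W.
  transitivity ((A * z * B) * (C * F * W)); first by rewrite zz mul1r.
  by field; rewrite gt_eqF.
split; first by apply: eq_intpos (intposZ (g^-1 * z `^ (p / g - 1)) f2i) => s s0; rewrite E.
rewrite -fE; transitivity (g^-1 * z `^ (p / g - 1) * Ipos f2); last by rewrite -f2E.
by rewrite -(@IposZ R _ _ f2i); apply: eq_Ipos => s s0; rewrite E.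
Qed.

Lemma profile_wright : profile g wright_profile.
Proof.
split; [exact: continuous_wright_profile| |by move=> p pg; exact: (wright_profile_Mellin pg).1].
have [C C0 hC] := norm_wright_le b01; exists C => [|s s0]; first exact: ltW.
rewrite normrM (ger0_norm (powR_ge0 _ _)) mulrC ler_wpM2r ?powR_ge0//.
by apply: hC; exact: ltW (arg_gt0 s0).
Qed.

End wright_profile.

Lemma u_solE (lam mu x t : R) : u_sol lam mu x t =
  (2 * lam)^-1 * (t `^ (- (mu / 2)) * wright (mu / 2) (`|x| / lam * t `^ (- (mu / 2)))).
Proof.
pose y := `|x| / lam * t `^ (- (mu / 2)).
have termE : (fun k : nat => (- (`|x| / (lam * t `^ (mu / 2)))) ^+ k / (k`!)%:R
    * rgamma (- (mu * k%:R / 2) + 1 - mu / 2)) = wright_term (mu / 2) y.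
  apply/funext => k; rewrite /wright_term (_ : `|x| / (lam * _) = y); last by rewrite /y invfM -powRN mulrA.
  congr (_ * rgamma _).
  by rewrite -natr1; ring.
transitivity ((2 * lam * t `^ (mu / 2))^-1 * wright (mu / 2) y); first by rewrite /u_sol termE.
by move: (wright _ _) => W; rewrite invfM -powRN -mulrA.
Qed.

(* The pointwise identity for [m nu < 2] *)
Opaque wright iint kern5p2 const5p2.

Lemma u_sol_subordination (lam : R) (m : nat) (nu t x : R) : 0 < lam -> (1 < m)%N ->
  0 < nu -> 0 < t -> m%:R * nu < 2 ->
  u_sol lam nu x t = const5p2 m t * iint m.-1 (fun w => kern5p2 m t w *
    u_sol lam (m%:R * nu) x (\prod_(i < m.-1) w i)).
Proof.
move=> l0 m1 n0 t0 mn2; have m0 : 0 < m%:R :> R by rewrite ltr0n ltnW.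
pose b := m%:R * nu / 2; have b0 : 0 < b by rewrite !mulr_gt0.
have b01 : 0 < b < 1 by rewrite b0 ltr_pdivrMr// mul1r.
have bm : nu / 2 = b / m%:R by rewrite /b; field; rewrite gt_eqF.
have bm01 : 0 < b / m%:R < 1.
  rewrite divr_gt0//= ltr_pdivrMr// mul1r; case/andP: b01 => _ b1.
  by rewrite (lt_le_trans b1)// ler1n ltnW.
rewrite u_solE bm; set z := `|x| / lam; pose K : R := (2 * lam)^-1.
have z_ge0 : 0 <= z by rewrite divr_ge0// ltW.
under [in RHS]eq_fun do rewrite u_solE -/b -/z -/K.
(* At [z = 0] the profile is a pure power without Mellin transform. The moments at [p = b] then give
   the answer directly, with [Gamma(1 - b)] cancelling against [wright b 0]. *)
rewrite -/K; clearbody b z K; move: z_ge0; rewrite le_eqVlt => /predU1P[<-|z0].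
  transitivity (const5p2 m t * iint m.-1 (fun w => kern5p2 m t w *
      ((K * wright b 0) * (\prod_(i < m.-1) w i) `^ (- b)))); last first.
    congr (_ * _); apply: eq_iint => w _; rewrite mul0r; congr (_ * _).
    by rewrite -!mulrA [wright _ _ * _]mulrC.
  rewrite (iint_kern5p2_powR m1 t0 _ b01) mul0r (wright0 b01) (wright0 bm01).
  have G0 : 0 < Gamma_pos (1 - b) by apply: Gamma_pos_gt0; rewrite subr_gt0; case/andP: b01.
  move: G0 (_ `^ _) (Gamma_pos (1 - b / _)); move: (Gamma_pos _) => G G0 T G1.
  transitivity (K * (T * G1^-1) * (G / G)); last by ring.
  by rewrite (divff (lt0r_neq0 G0)) mulr1.
(* For [a > 0] this is the left-hand solution at time [a^m t]. *)
pose F (a : R) := K * t `^ (- (b / m%:R)) * wright_profile (b / m%:R) b (z * t `^ (- (b / m%:R))) a.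
have zt0 : 0 < z * t `^ (- (b / m%:R)) by rewrite mulr_gt0 ?powR_gt0.
transitivity (F 1); first by rewrite /F /wright_profile powR1 mul1r mulr1 mulrA.
symmetry; apply: (iint_kern5p2 (Phi := fun s => K * wright_profile b b z s) m1 t0 b01).
- exact: profileZ (profile_wright b01 b0 z0).
- move=> a a0; apply: continuousM; first exact: cst_continuous.
  exact: continuous_wright_profile.
- move=> p pb; apply: eq_intpos (intposZ (K * t `^ (- (b / m%:R))) (wright_profile_Mellin bm01 b0 zt0 pb).1) => a _.
  by rewrite /F mulrCA.
move=> p pb.
have [i1 E1] := wright_profile_Mellin b01 b0 z0 pb.
have [i2 E2] := wright_profile_Mellin bm01 b0 zt0 pb.
rewrite [X in _ = _ * X](_ : _ = K * Ipos (fun s => s `^ (p - 1) * wright_profile b b z s)); last first.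
  by rewrite -(@IposZ R _ _ i1); apply: eq_Ipos => s _; rewrite mulrCA.
rewrite [LHS](_ : _ = K * t `^ (- (b / m%:R)) *
    Ipos (fun s => s `^ (p - 1) * wright_profile (b / m%:R) b (z * t `^ (- (b / m%:R))) s)); last first.
  by rewrite -(@IposZ R _ _ i2); apply: eq_Ipos => s _; rewrite /F mulrCA.
(* The inner transform has the denominator [Gamma(1 - p)], the numerator produced by the kernel;
   after cancellation both sides carry [Gamma(1 - p / b) / Gamma(1 - p / m)]. *)
rewrite [X in _ = _ * (_ * X)]E1 [X in _ * X = _]E2 (powRM _ (ltW z0) (powR_ge0 _ _)) -powRrM.
have p1 : p < 1 by case/andP: pb => _ h; apply: lt_trans h _; case/andP: b01.
have b_neq0 := lt0r_neq0 b0; have m_neq0 := lt0r_neq0 m0.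
rewrite (_ : b * (p / b) = p); last by field.
rewrite (_ : b / m%:R * (p / b) = p / m%:R); last by field; rewrite ?b_neq0 ?m_neq0.
have tt : t `^ (- (b / m%:R)) * t `^ (- (b / m%:R) * (p / b - 1)) = t `^ (- (p / m%:R)).
  by rewrite -powRD_gt0//; congr (_ `^ _); field; rewrite ?b_neq0 ?m_neq0.
have G0 : 0 < Gamma_pos (1 - p) by apply: Gamma_pos_gt0; rewrite subr_gt0.
rewrite -tt; move: (lt0r_neq0 G0).
move: (t `^ _) (t `^ _) (z `^ _) => B A C.
move: (Gamma_pos (1 - p / b)) (Gamma_pos (1 - p / m%:R)) (Gamma_pos (1 - p)) => G1 G2 G3 G30.
rewrite [RHS](_ : _ = K * A * (b^-1 * (C * B) * (G1 / G2)) * (G3 / G3)); first by rewrite (divff G30) mulr1.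
by ring.
Qed.

(** * The identity against test functions for [m nu = 2] *)

Lemma integralT_symmetric_ge0 (f : R -> R) : continuous f -> (forall x, 0 <= f x) ->
  (\int[mu]_(x in [set: R]) (f x)%:E =
   \int[mu]_(x in D) (f x)%:E + \int[mu]_(x in D) (f (- x))%:E)%E.
Proof.
move=> cf f0.
have mf : measurable_fun [set: R] f by exact: continuous_measurable_fun.
have -> : [set: R] = D `|` `]-oo, 0%R]%classic.
  by apply/seteqP; split=> // x _; have [h|h] := ltP 0 x; [left|right]; rewrite /= in_itv/= ?h.
rewrite ge0_integral_setU//=; last 3 first.
- by apply/measurable_EFinP; apply: measurable_funS mf.
- by move=> x _; rewrite lee_fin.
- apply/disj_setPS => x [] /=; rewrite !in_itv/= andbT => h1 h2.
  by move: (lt_le_trans h1 h2); rewrite ltxx.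
congr (_ + _)%E; rewrite -[in LHS]oppr0 ge0_integration_by_substitutionNy//.
- rewrite integral_itv_obnd_cbnd//; apply/measurable_EFinP/measurable_funTS.
  by apply: measurableT_comp.
- exact: continuous_subspaceT.
Qed.

Lemma RintegralT_symmetric (f : R -> R) : continuous f -> intpos f -> intpos (fun x => f (- x)) ->
  \int[mu]_(x in [set: R]) f x = Ipos (fun x => f x + f (- x)).
Proof.
move=> cf fi gi; rewrite (IposD fi gi).
have cN (h : R -> R) : continuous h -> continuous (fun x => `|h x|).
  by move=> ch x; apply: continuous_comp; [exact: ch|exact: norm_continuous].
pose d (x : R) := `|f x| - f x.
have cd : continuous d.
  suff h (x : R) : {for x, continuous d} by exact: h.
  by apply: continuousB; [exact: cN|exact: cf].
have d0 x : 0 <= d x by rewrite subr_ge0 ler_norm.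
have ge0 (h : R -> R) : continuous h -> (forall x, 0 <= h x) -> intpos h -> intpos (fun x => h (- x)) ->
    mu.-integrable [set: R] (EFin \o h) /\
    \int[mu]_(x in [set: R]) h x = Ipos h + Ipos (fun x => h (- x)).
  move=> ch h0 hi hi'; have E := integralT_symmetric_ge0 ch h0.
  have fin1 := integrable_fin_num _ hi; have fin2 := integrable_fin_num _ hi'.
  split.
    apply/integrableP; split; first by apply/measurable_EFinP; exact: continuous_measurable_fun.
    have nE : (\int[mu]_x `|(EFin \o h) x| = \int[mu]_x (h x)%:E)%E.
      by apply: eq_integral => x _ /=; rewrite ger0_norm.
    rewrite nE E -ge0_fin_numE; last by rewrite adde_ge0// integral_ge0// => x _; rewrite lee_fin.
    by rewrite fin_numD fin1// fin2.
  rewrite {1}/Rintegral E fineD; [by []|exact: fin1|exact: fin2].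
have nfi := intpos_norm fi; have ngi := intpos_norm gi.
have [i1 E1] := ge0 _ (cN _ cf) (fun x => normr_ge0 _) nfi ngi.
have [i2 E2] := ge0 _ cd d0 (intposB nfi fi) (intposB ngi gi).
transitivity (\int[mu]_(x in [set: R]) `|f x| - \int[mu]_(x in [set: R]) d x).
  by rewrite -RintegralB//; apply: eq_Rintegral => x _; rewrite subKr.
rewrite E1 E2 (IposB nfi fi) (IposB ngi gi).
by move: (Ipos _) (Ipos _) (Ipos _) (Ipos _) => u v w z; ring.
Qed.

Section bounded_support.
Variables (C B : R) (f : R -> R).
Hypotheses (C0 : 0 <= C) (B0 : 0 < B).
Hypothesis cf : forall x : R, 0 < x -> {for x, continuous f}.
Hypothesis f_le : forall x : R, 0 < x -> `|f x| <= C.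
Hypothesis f_supp : forall x : R, B < x -> f x = 0.

Lemma intpos_bounded_support (p : R) : 0 < p -> intpos (fun x => x `^ (p - 1) * f x).
Proof.
(* On the support [expR (B - x) >= 1], so a multiple of the Gamma integrand dominates. *)
move=> p0; apply: le_intpos (intposZ (C * expR B) (intpos_Gamma p0)) _.
  by apply: mpos_continuous => x x0; apply: continuousM; [exact: continuous_powR|exact: cf].
move=> x x0; rewrite normrM (ger0_norm (powR_ge0 _ _)) mulrCA ler_wpM2l ?powR_ge0//.
have [xB|Bx] := leP x B; last by rewrite f_supp// normr0 !mulr_ge0 ?expR_ge0.
rewrite -mulrA -expRD -[leLHS]mulr1 ler_pM ?f_le//.
by rewrite -expR0 ler_expR; lra.
Qed.

Lemma profile_bounded_support (b : R) : 0 < b -> profile b f.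
Proof.
move=> b0; split; [exact: cf| |by move=> p /andP[p0 _]; exact: intpos_bounded_support].
exists (C * B `^ b) => [|x x0]; first by rewrite mulr_ge0 ?powR_ge0.
have [xB|Bx] := leP x B; last by rewrite f_supp// normr0 !mulr_ge0 ?powR_ge0.
rewrite -mulrA -[leLHS]mulr1 ler_pM ?f_le// powRN ler_pdivlMr ?powR_gt0// mul1r.
by rewrite ge0_ler_powR ?nnegrE ?(ltW b0) ?(ltW x0) ?(ltW B0).
Qed.

End bounded_support.

Lemma compact_support_bound (phi : R -> R) : continuous phi -> has_compact_support phi ->
  exists C B : R, [/\ 0 <= C, 0 < B, forall x, `|phi x| <= C &
    forall x, B < `|x| -> phi x = 0].
Proof.
move=> cphi [a [b ab]]; pose B := `|a| + `|b| + 1.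
have na := ler_norm a; have na' := ler_norm (- a); have nb := ler_norm b; have nb' := ler_norm (- b).
rewrite !normrN in na' nb'.
have B0 : 0 < B by rewrite ltr_wpDl// addr_ge0.
have supp x : B < `|x| -> phi x = 0.
  by rewrite ltr_normr /B => /orP[h|h]; apply: ab; [right|left]; lra.
(* If [b < a], every point lies below [a] or above [b], so [phi] vanishes identically. *)
have [leab|ltba] := leP a b; last first.
  exists 0, B; split=> // x; rewrite ab ?normr0//.
  by have [h|h] := ltP x a; [left|right; exact: lt_le_trans h].
have cn : {within `[a, b], continuous (fun x => `|phi x|)}.
  apply: continuous_subspaceT => x; apply: continuous_comp; [exact: cphi|exact: norm_continuous].
have [c cI hc] := EVT_max leab cn.
exists `|phi c|, B; split=> // x.
have [xI|] := boolP (x \in `[a, b]); first exact: hc.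
rewrite in_itv/= negb_and -!ltNge => h; rewrite ab ?normr0//.
by case/orP: h; [left|right].
Qed.

(** The roles change: the test function, folded into [wave_pair], is the profile, and the solution
    of index [1 / m] becomes a kernel [k] whose moments equal those of the whole right-hand kernel.
    The function [F] to compare with is then [dilation k Phi]. *)
Lemma u_sol_wave_subordination (lam : R) (m : nat) (nu t : R) (phi : R -> R) :
  0 < lam -> (1 < m)%N -> 0 < t -> m%:R * nu = 2 ->
  continuous phi -> has_compact_support phi ->
  \int[mu]_(x in [set: R]) (u_sol lam nu x t * phi x) =
  const5p2 m t * iint m.-1 (fun w => kern5p2 m t w *
    wave_pair lam (\prod_(i < m.-1) w i) phi).
Proof.
move=> l0 m1 t0 mn2 cphi sphi.
have m0 : 0 < m%:R :> R by rewrite ltr0n ltnW.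
pose b : R := m%:R^-1.
have b01 : 0 < b < 1 by rewrite invr_gt0 m0 invf_lt1// ltr1n.
have nuE : nu / 2 = b by rewrite /b -mn2; field; rewrite gt_eqF//; move: mn2; case: eqP => // ->; lra.
pose tau := t `^ (- b); have tau0 : 0 < tau by rewrite powR_gt0.
pose k (w : R) := tau * wright b (tau * w).
have cw := continuous_wright b01.
have kE (p : R) : 0 < p < 1 -> intpos (fun w => w `^ (- p) * k w) /\
    Ipos (fun w => w `^ (- p) * k w) =
    t `^ (- (p / m%:R)) * (Gamma_pos (1 - p) / Gamma_pos (1 - p / m%:R)).
  move=> p01; have [i1 E1] := wright_Mellin b01 p01.
  have pE : - p = (1 - p) - 1 by ring.
  rewrite pE in i1 E1 *; have [i2 E2] := Mellin_scale cw tau0 i1.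
  split; first by apply: eq_intpos (intposZ tau i2) => w _; rewrite mulrCA.
  transitivity (tau * Ipos (fun w => w `^ (1 - p - 1) * wright b (tau * w))).
    by rewrite -(@IposZ R _ _ i2); apply: eq_Ipos => w _; rewrite mulrCA.
  rewrite E2 E1 mulrA; congr (_ * (_ / Gamma_pos (1 - _))); last by rewrite /b mulrC.
  rewrite -{1}(powRr1 (ltW tau0)) -powRD_gt0// /tau -powRrM; congr (_ `^ _).
  by rewrite /b; ring.
have kK : kernel_fun k.
  split=> [w w0|p p01]; last exact: (kE p p01).1.
  by apply: continuousM; [exact: cst_continuous|exact: continuous_dilate].
have [C [B [C0 B0 phiC phiB]]] := compact_support_bound cphi sphi.
pose Phi (s : R) := wave_pair lam s phi.
(* As [Phi] is bounded with bounded support, any exponent in []0, 1[] would do; [2^-1] only fixes a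
   strip. *)
have PP : profile 2^-1 Phi.
  apply: (@profile_bounded_support C (B / lam)) => //; first by rewrite divr_gt0.
  - move=> s s0; apply: continuousM; last exact: cst_continuous.
    apply: continuousD; (apply: continuous_comp; last exact: cphi).
      by apply: continuousM; [exact: cst_continuous|exact: cvg_id].
    by apply: continuousN; apply: continuousM; [exact: cst_continuous|exact: cvg_id].
  - move=> s _; rewrite normrM (ger0_norm (_ : 0 <= 2^-1)) ?invr_ge0// ler_pdivrMr// mulr2n mulrDr mulr1.
    by rewrite (le_trans (ler_normD _ _))// lerD.
  - move=> s sB; have s0 : 0 < s by apply: lt_trans sB; rewrite divr_gt0.
    have h : B < `|lam * s| by rewrite gtr0_norm ?mulr_gt0// mulrC -ltr_pdivrMr.
    by rewrite /Phi /wave_pair !phiB ?normrN// addr0 mul0r.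
have h01 : 0 < (2^-1 : R) < 1 by rewrite invr_gt0 ltr0n invf_lt1 ?ltr1n.
rewrite (iint_kern5p2 (F := dilation k Phi) m1 t0 h01 PP); first last.
- move=> p pb; rewrite (Mellin_dilation h01 kK PP pb).2; congr (_ * _).
  apply: (kE p _).2; case/andP: pb => -> pb /=; apply: (lt_trans pb); by case/andP: h01.
- by move=> p pb; exact: (Mellin_dilation h01 kK PP pb).1.
- exact: continuous_dilation h01 kK PP.
pose f x := u_sol lam nu x t * phi x.
have fE x : f x = (2 * lam)^-1 * tau * wright b `|x / lam * tau| * phi x.
  by rewrite /f u_solE nuE mulrA !normrM normfV (gtr0_norm l0) (gtr0_norm tau0).
have cf : continuous f.
  suff h (x : R) : {for x, continuous f} by exact: h.
  rewrite (funext fE); apply: continuousM; last exact: cphi.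
  apply: continuousM; first exact: cst_continuous.
  apply: (@continuous_comp _ _ _ (fun x : R => x / lam * tau) (fun y : R => wright b `|y|)).
    by apply: continuousM; [apply: continuousM|]; [exact: cvg_id|exact: cst_continuous|exact: cst_continuous].
  exact: continuous_wright_norm.
have [M M0 hM] := norm_wright_le b01.
pose C' := (2 * lam)^-1 * tau * M * C.
have C'0 : 0 <= C' by rewrite !mulr_ge0 ?invr_ge0 ?mulr_ge0 ?(ltW l0) ?(ltW tau0) ?(ltW M0).
have fle x : `|f x| <= C'.
  rewrite fE !normrM ler_pM ?phiC ?mulr_ge0// ler_pM ?mulr_ge0// ?hM//.
  by rewrite !ger0_norm ?(ltW tau0)// invr_ge0 mulr_ge0// ltW.
have fB x : B < `|x| -> f x = 0 by move=> /phiB; rewrite /f => ->; rewrite mulr0.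
have intf (g : R -> R) : (forall x : R, 0 < x -> {for x, continuous g}) -> (forall x, `|g x| <= C') ->
    (forall x, B < `|x| -> g x = 0) -> intpos g.
  move=> cg gC gB.
  have gC' (x : R) : 0 < x -> `|g x| <= C' by [].
  have gB' (x : R) : B < x -> g x = 0 by move=> xB; apply: gB; rewrite gtr0_norm// (lt_trans B0).
  apply: eq_intpos (@intpos_bounded_support C' B g C'0 cg gC' gB' 1 ltr01) => x _.
  by rewrite subrr powRr0 mul1r.
have cfN : continuous (fun x => f (- x)).
  move=> x; apply: continuous_comp; [exact: opp_continuous|exact: cf].
have fi : intpos f := intf f (fun x _ => cf x) fle fB.
have fi' : intpos (fun x => f (- x)).
  apply: (intf (fun x => f (- x)) (fun x _ => cfN x) (fun x => fle (- x))) => x xB.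
  by apply: fB; rewrite normrN.
rewrite (RintegralT_symmetric cf fi fi').
have cs x : 0 < x -> {for x, continuous (fun x => f x + f (- x))}.
  by move=> _; apply: continuousD; [exact: cf|exact: cfN].
(* The line integral is folded onto the half-line and [x = lam * w] is substituted: the two halves
   combine into [wave_pair], and the Jacobian [lam] cancels the factor [(2 * lam)^-1] down to the
   one half of that pairing. *)
rewrite (Ipos_powR_subst l0 (oner_neq0 R) cs (intposD fi fi')).
apply: eq_Ipos => w w0; rewrite subrr powRr0 normr1 !mulr1 powRr1 ?(ltW w0)// mul1r.
rewrite !fE mulNr mulNr normrN -mulrDr /k /Phi /wave_pair gtr0_norm; last first.
  by rewrite !mulr_gt0 ?invr_gt0.
rewrite (_ : lam * w / lam * tau = tau * w); last by field; rewrite gt_eqF.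
move: (wright _ _) => X; field; rewrite gt_eqF//.
Qed.

End Kernels.

Theorem theorem5p2 (R : realType) (lam : R) (m : nat) (nu : R) :
  0 < lam -> (2 <= m)%N -> 0 < nu -> nu <= Num.min 1 (2 / m%:R) ->
  forall t : R, 0 < t ->
  (* case m nu < 2: u_{m nu} is a function, pointwise identity *)
  (m%:R * nu < 2 ->
   forall x : R,
   u_sol lam nu x t =
   const5p2 m t * iint m.-1 (fun w => kern5p2 m t w *
       u_sol lam (m%:R * nu) x (\prod_(i < m.-1) w i))) /\
  (* case m nu = 2: u_2 is the measure (delta_{lam s} + delta_{-lam s})/2,
     identity understood in the sense of distributions *)
  (m%:R * nu = 2 ->
   forall phi : R -> R, continuous phi -> has_compact_support phi ->
   \int[lebesgue_measure]_(x in [set: R]) (u_sol lam nu x t * phi x) =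
   const5p2 m t * iint m.-1 (fun w => kern5p2 m t w *
       wave_pair lam (\prod_(i < m.-1) w i) phi)).
Proof.
move=> l0 m2 n0 nu1 t t0; split=> [mn2 x|mn2 phi cphi sphi].
- exact: u_sol_subordination.
- exact: u_sol_wave_subordination.
Qed.
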